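(* Let $\varsigma\in M^2(\mathbb{Z}^n\times\mathbb{T}^n)$ and $g_1,g_2\in M^1(\mathbb{Z}^n)$. Then the localization operator $\mathfrak{L}^{g_1,g_2}_\varsigma$ is in $\mathcal{B}(\ell^2(\mathbb{Z}^n))$ and $$\|\mathfrak{L}^{g_1,g_2}_\varsigma\|_{\mathcal{B}(\ell^2(\mathbb{Z}^n))}\le\|\varsigma\|_{M^2(\mathbb{Z}^n\times\mathbb{T}^n)}\,\|g_1\|_{M^1(\mathbb{Z}^n)}\,\|g_2\|_{M^1(\mathbb{Z}^n)}.$$
   Context: $\mathbb{T}^n$ is the torus with normalized Haar measure $dw$; $\mathbb{Z}^n\times\mathbb{T}^n$ carries the product of counting measure and $dw$. $T_mf(k)=f(k-m)$, $M_wf(k)=e^{2\pi i w\cdot k}f(k)$, and the short-time Fourier transform is $V_gf(m,w)=\langle f,M_wT_mg\rangle=\sum_{k\in\mathbb{Z}^n}f(k)\overline{g(k-m)}e^{-2\pi i w\cdot k}$. $\mathcal{S}(\mathbb{Z}^n)$ is the space of rapidly decreasing functions on $\mathbb{Z}^n$, $\mathcal{S}'(\mathbb{Z}^n)$ its dual (tempered distributions); $\mathcal{S}(\mathbb{Z}^n\times\mathbb{T}^n)$ and $\mathcal{S}'(\mathbb{Z}^n\times\mathbb{T}^n)$ are the Schwartz functions and tempered distributions on the group $\mathbb{Z}^n\times\mathbb{T}^n$. Modulation spaces: fix a non-zero window $g\in\mathcal{S}(\mathbb{Z}^n)$; for $1\le p\le\infty$, $M^p(\mathbb{Z}^n)=\{f\in\mathcal{S}'(\mathbb{Z}^n):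 V_gf\in L^p(\mathbb{Z}^n\times\mathbb{T}^n)\}$ with $\|f\|_{M^p(\mathbb{Z}^n)}=\|V_gf\|_{L^p}$. Similarly, fix a non-zero $g\in\mathcal{S}(\mathbb{Z}^n\times\mathbb{T}^n)$ and set $$V_gF(m,\omega,\xi,k)=\sum_{j\in\mathbb{Z}^n}\int_{\mathbb{T}^n}e^{-2\pi i j\xi}e^{-2\pi i\eta k}F(j,\eta)\overline{g(j-m,\eta-\omega)}\,d\eta,\quad m,k\in\mathbb{Z}^n,\ \omega,\xi\in\mathbb{T}^n;$$ $M^p(\mathbb{Z}^n\times\mathbb{T}^n)$ is the space of $F\in\mathcal{S}'(\mathbb{Z}^n\times\mathbb{T}^n)$ with $\|F\|_{M^p(\mathbb{Z}^n\times\mathbb{T}^n)}=\|V_gF\|_{L^p((\mathbb{Z}^n\times\mathbb{T}^n)\times(\mathbb{T}^n\times\mathbb{Z}^n))}<\infty$. Different windows give equivalent norms. Localization operator: $\mathfrak{L}^{g_1,g_2}_\varsigma f(k)=\sum_{m\in\mathbb{Z}^n}\int_{\mathbb{T}^n}\varsigma(m,w)V_{g_1}f(m,w)\,M_wT_mg_2(k)\,dw$, or in the weak sense $$\langle\mathfrak{L}^{g_1,g_2}_\varsigma f,h\rangle_{\ell^2(\mathbb{Z}^n)}=\sum_{m\in\mathbb{Z}^n}\int_{\mathbb{T}^n}\varsigma(m,w)\,V_{g_1}f(m,w)\,\overline{V_{g_2}h(m,w)}\,dw,\qquad f,h\in\ell^2(\mathbb{Z}^n).$$ $\mathcal{B}(X)$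 denotes the bounded linear operators on $X$ with operator norm.
   Formalization: The inequality with constant 1 fails for arbitrary non-zero windows (shrinking a window shrinks the right side only); it is proved with a constant C > 0 depending only on the fixed windows, and with C = 1 when both windows have L² norm 1. *)

(* Defs.v *)
From HB Require Import structures.
From mathcomp Require Import all_boot all_order all_algebra.
From mathcomp Require Import complex.
From mathcomp Require Import all_classical all_reals all_analysis.

Set Implicit Arguments.
Unset Strict Implicit.
Unset Printing Implicit Defensive.

Import Order.TTheory GRing.Theory Num.Theory.
Import numFieldNormedType.Exports.

Local Open Scope classical_set_scope.
Local Open Scope ring_scope.
Local Open Scope complex_scope.

Local Notation normc := ComplexField.Normc.normc.

Definition Zn (n : nat) : Type := 'rV[int]_n.

HB.instance Definition _ n := Countable.on (Zn n).
HB.instance Definition _ n := GRing.Zmodule.on (Zn n).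
HB.instance Definition _ n := isPointed.Build (Zn n) 0.
HB.instance Definition _ n := @isMeasurable.Build default_measure_display
  (Zn n) discrete_measurable discrete_measurable0
  discrete_measurableC discrete_measurableU.

(* A constant of its own: the library declares the counting measure to be   *)
(* sigma-finite on nat only, and canonical instances are keyed by constant.  *)
Definition countingZ (R : realType) (n : nat) : set (Zn n) -> \bar R :=
  @counting (Zn n) R.
Arguments countingZ R n _ : clear implicits.

Section countingZ_sigma_finite.
Context (R : realType) (n : nat).

HB.instance Definition _ := Measure.on (countingZ R n).

Let countingZ_sigma_finite : sigma_finite [set: Zn n] (countingZ R n).
Proof.
exists (fun N => [set x : Zn n | (pickle x <= N)%N]).
  by apply/seteqP; split => // x _; exists (pickle x) => /=.
move=> N; split => //; rewrite /countingZ /counting /= asboolT ?ltry//.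
suff -> : [set x : Zn n | (pickle x <= N)%N] = pickle @^-1` `I_N.+1.
  apply: finite_preimage; last exact: finite_II.
  by move=> x y _ _; apply: (pcan_inj pickleK).
by apply/seteqP; split=> x /=; rewrite ltnS.
Qed.

HB.instance Definition _ :=
  @Measure_isSigmaFinite.Build _ _ _ (countingZ R n) countingZ_sigma_finite.

End countingZ_sigma_finite.

(* Row vectors carry the sigma-algebra generated by the coordinates. *)
Section measurable_rV.
Context {d} {T : measurableType d} (n : nat).
Let coors : 'I_n -> 'rV[T]_n -> T := fun i v => v ord0 i.
Let rV_set0 : g_sigma_preimage coors set0. Proof. exact: sigma_algebra0. Qed.
Let rV_setC A : g_sigma_preimage coors A -> g_sigma_preimage coors (~` A).
Proof. exact: sigma_algebraC. Qed.
Let rV_bigcup (F : _^nat) : (forall i, g_sigma_preimage coors (F i)) ->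
  g_sigma_preimage coors (\bigcup_i F i).
Proof. exact: sigma_algebra_bigcup. Qed.

HB.instance Definition _ := @isMeasurable.Build (measure_tuple_display d)
  'rV[T]_n (g_sigma_preimage coors) rV_set0 rV_setC rV_bigcup.
End measurable_rV.

Definition rV_cons (R : realType) (n : nat) (p : measurableTypeR R * 'rV[R]_n) : 'rV[R]_n.+1 :=
  \row_i (if unlift ord0 i is Some j then p.2 ord0 j else p.1).

Section rV_cons_measurable.
Context (R : realType) (n : nat).

Lemma measurable_rV_cons : measurable_fun [set: measurableTypeR R * 'rV[R]_n] (@rV_cons R n).
Proof.
have mcoor m (i : 'I_m) : measurable_fun [set: 'rV[R]_m] (fun v => v ord0 i).
  move=> _ Y mY; rewrite setTI; apply: sub_sigma_algebra => /=.
  rewrite -bigcup_seq/=; exists i => /=; first by rewrite mem_index_enum.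
  by exists Y => //; rewrite setTI.
apply: (@measurability _ _ _ _ _ _ (\big[setU/set0]_(i < n.+1)
  preimage_set_system setT (fun v : 'rV[R]_n.+1 => v ord0 i) measurable)).
  by [].
move=> _ [B + <-]; rewrite -bigcup_seq/= => -[i _ [A mA <-]].
rewrite !setTI; rewrite -[X in measurable X]setTI.
rewrite -comp_preimage.
suff : measurable_fun [set: measurableTypeR R * 'rV[R]_n]
    (fun p => @rV_cons R n p ord0 i) by exact.
case: (unliftP ord0 i) => [j ->|->].
- rewrite (_ : (fun _ => _) = (fun v : 'rV[R]_n => v ord0 j) \o snd).
    by apply: measurableT_comp => //; exact: mcoor.
  by apply/funext => x /=; rewrite mxE liftK.
- rewrite (_ : (fun _ => _) = fst); first exact: measurable_fst.
  by apply/funext => x /=; rewrite mxE unlift_none.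
Qed.

HB.instance Definition _ :=
  isMeasurableFun.Build _ _ _ _ (@rV_cons R n) measurable_rV_cons.

End rV_cons_measurable.

(* Functions on T^n = R^n / Z^n are functions on R^n, required to be         *)
(* Z^n-periodic wherever pointwise values matter (Schwartz functions); the   *)
(* normalized Haar measure is the n-fold product of the Lebesgue measure on  *)
(* the fundamental cell [0, 1], seen as a measure on R^n.                    *)
Fixpoint haar (R : realType) (n : nat) : probability 'rV[R]_n R :=
  match n with
  | 0%N => dirac (0 : 'rV[R]_0)
  | m.+1 => distribution (uniform_prob (@ltr01 R) \x haar R m)%E (@rV_cons R m)
  end.

Section complex_functions.
Context {d} {T : measurableType d} {R : realType}.
Variable mu : {measure set T -> \bar R}.
Implicit Type f : T -> R[i].

Definition cmeasurable f : Prop :=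
  measurable_fun [set: T] (fun x => complex.Re (f x)) /\
  measurable_fun [set: T] (fun x => complex.Im (f x)).

Definition cintegrable f : Prop :=
  mu.-integrable [set: T] (fun x => (complex.Re (f x))%:E) /\
  mu.-integrable [set: T] (fun x => (complex.Im (f x))%:E).

(* With [mu] the counting measure this is the sum of the family [f]. *)
Definition cintegral f : R[i] :=
  (\int[mu]_x complex.Re (f x)) +i* (\int[mu]_x complex.Im (f x)).

Definition cLnorm (p : \bar R) f : \bar R :=
  ('N[mu]_p[EFin \o (fun x => normc (f x))])%E.

Definition inLp (p : \bar R) f : Prop :=
  cmeasurable f /\ (cLnorm p f < +oo)%E.

End complex_functions.

(* [u] is a continuous linear functional on the space [S] of test functions, *)
(* topologized by the increasing sequence of seminorms [q]; the values of    *)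
(* [u] outside [S] are irrelevant.                                           *)
Definition distribution_on (R : realType) (X : Type) (S : set (X -> R[i]))
    (q : nat -> (X -> R[i]) -> \bar R) (u : (X -> R[i]) -> R[i]) : Prop :=
  (forall (a : R[i]) f g, S f -> S g ->
     u (fun x => a * f x + g x) = a * u f + u g) /\
  exists (N : nat) (C : R),
    forall f, S f -> ((normc (u f))%:E <= C%:E * q N f)%E.

Section analysis_on_Zn.
Context {R : realType} {n : nat}.
Local Notation C := R[i].
Local Notation Tn := 'rV[R]_n.

(* e^{2 pi i t} *)
Definition cis (t : R) : C := cos (2 * pi * t) +i* sin (2 * pi * t).

Definition dot (k : Zn n) (w : Tn) : R := \sum_(i < n) (k ord0 i)%:~R * w ord0 i.

(* Comparable to (1 + |k|^2)^(1/2), hence the same Schwartz space.           *)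
Definition bracket (k : Zn n) : R := 1 + \sum_(i < n) `|k ord0 i|%:~R.

Definition translate (m : Zn n) (f : Zn n -> C) : Zn n -> C :=
  fun k => f (k - m).

Definition modulate (w : Tn) (f : Zn n -> C) : Zn n -> C :=
  fun k => cis (dot k w) * f k.

Definition snorm_Z (N : nat) (f : Zn n -> C) : \bar R :=
  ereal_sup [set (bracket k ^+ N * normc (f k))%:E | k in [set: Zn n]].

Definition schwartz_Z : set (Zn n -> C) :=
  [set f | forall N, (snorm_Z N f < +oo)%E].

Definition tempered_Z (u : (Zn n -> C) -> C) : Prop :=
  distribution_on schwartz_Z snorm_Z u.

(* S'(Z^n) is identified with a space of functions on Z^n: the value of the  *)
(* distribution [u] at [k] is its pairing with the Kronecker delta at [k].   *)
Definition values (u : (Zn n -> C) -> C) : Zn n -> C :=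
  fun k => u (fun j => (j == k)%:R).

Definition muZ : {measure set (Zn n) -> \bar R} := countingZ R n.

Definition muZT : {measure set (Zn n * Tn) -> \bar R} :=
  (countingZ R n \x haar R n)%E.

Definition stft (f g : Zn n -> C) (x : Zn n * Tn) : C :=
  cintegral muZ (fun k => f k * conjc (modulate x.2 (translate x.1 g) k)).

(* [u] is a bilinear pairing, so <u, h> is [u] applied to the conjugate of h *)
Definition dstft (g : Zn n -> C) (u : (Zn n -> C) -> C) (x : Zn n * Tn) : C :=
  u (fun k => conjc (modulate x.2 (translate x.1 g) k)).

Definition M_Z (p : \bar R) (g : Zn n -> C) (u : (Zn n -> C) -> C) : Prop :=
  tempered_Z u /\ inLp muZT p (dstft g u).

Definition norm_M_Z (p : \bar R) (g : Zn n -> C) (u : (Zn n -> C) -> C) :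
  \bar R := cLnorm muZT p (dstft g u).

Definition cpartial (i : 'I_n) (f : Tn -> C) : Tn -> C := fun x =>
  'D_(delta_mx 0 i) (fun y => complex.Re (f y)) x +i*
  'D_(delta_mx 0 i) (fun y => complex.Im (f y)) x.

Definition cpartials (s : seq 'I_n) (f : Tn -> C) : Tn -> C :=
  foldr cpartial f s.

Definition smooth (f : Tn -> C) : Prop := forall s : seq 'I_n,
  [/\ continuous (fun x => complex.Re (cpartials s f x)),
      continuous (fun x => complex.Im (cpartials s f x)) &
      forall (i : 'I_n) (x : Tn),
        derivable (fun y => complex.Re (cpartials s f y)) x (delta_mx 0 i) /\
        derivable (fun y => complex.Im (cpartials s f y)) x (delta_mx 0 i)].

Definition periodic_Zn (f : Tn -> C) : Prop :=
  forall (x : Tn) (i : 'I_n), f (x + delta_mx 0 i) = f x.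

Definition snorm_ZT (N : nat) (F : Zn n * Tn -> C) : \bar R :=
  ereal_sup [set y | exists (s : seq 'I_n) (m : Zn n) (x : Tn),
    (size s <= N)%N /\
    y = (bracket m ^+ N * normc (cpartials s (fun t => F (m, t)) x))%:E].

Definition schwartz_ZT : set (Zn n * Tn -> C) :=
  [set F | (forall m, smooth (fun t => F (m, t)) /\
                      periodic_Zn (fun t => F (m, t))) /\
           forall N, (snorm_ZT N F < +oo)%E].

Definition tempered_ZT (u : (Zn n * Tn -> C) -> C) : Prop :=
  distribution_on schwartz_ZT snorm_ZT u.

(* [u] is the distribution given by integration against the function [s];    *)
(* only the class of [s] modulo null sets of [0, 1]^n matters.               *)
Definition represents (s : Zn n * Tn -> C) (u : (Zn n * Tn -> C) -> C) : Prop :=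
  cmeasurable s /\
  forall F, schwartz_ZT F -> cintegrable muZT (fun z => s z * F z) /\
                             u F = cintegral muZT (fun z => s z * F z).

(* The points are the quadruples (m, w, xi, k) of Z^n x T^n x T^n x Z^n.     *)
Definition muZTTZ : {measure set (Zn n * Tn * Tn * Zn n) -> \bar R} :=
  (countingZ R n \x haar R n \x haar R n \x countingZ R n)%E.

Definition dstft_ZT (G : Zn n * Tn -> C) (u : (Zn n * Tn -> C) -> C)
    (x : Zn n * Tn * Tn * Zn n) : C :=
  let: (m, w, xi, k) := x in
  u (fun z => cis (- dot z.1 xi) * cis (- dot k z.2) *
              conjc (G (z.1 - m, z.2 - w))).

Definition M_ZT (p : \bar R) (G : Zn n * Tn -> C) (u : (Zn n * Tn -> C) -> C) :
  Prop := tempered_ZT u /\ inLp muZTTZ p (dstft_ZT G u).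

Definition norm_M_ZT (p : \bar R) (G : Zn n * Tn -> C)
  (u : (Zn n * Tn -> C) -> C) : \bar R := cLnorm muZTTZ p (dstft_ZT G u).

Definition norm_l2 (f : Zn n -> C) : \bar R := cLnorm muZ 2%:E f.

Definition l2 : set (Zn n -> C) := [set f | (norm_l2 f < +oo)%E].

Definition opnorm_l2 (L : (Zn n -> C) -> (Zn n -> C)) : \bar R :=
  ereal_sup [set norm_l2 (L f) | f in [set f | (norm_l2 f <= 1)%E]].

Definition bounded_l2 (L : (Zn n -> C) -> (Zn n -> C)) : Prop :=
  [/\ forall f, l2 f -> l2 (L f),
      forall (a : C) f g, l2 f -> l2 g ->
        L (fun k => a * f k + g k) = (fun k => a * L f k + L g k) &
      (opnorm_l2 L < +oo)%E].

(* The symbol enters through the function [s] that represents it: for g1, g2 *)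
(* in M^1 and f, h in l^2, V_{g1}f and V_{g2}h need not be Schwartz, so that *)
(* a general tempered distribution cannot be paired with their product.      *)
Definition locop_integrand (s : Zn n * Tn -> C) (g1 g2 f : Zn n -> C)
    (k : Zn n) (z : Zn n * Tn) : C :=
  s z * stft f g1 z * modulate z.2 (translate z.1 g2) k.

Definition locop (s : Zn n * Tn -> C) (g1 g2 f : Zn n -> C) : Zn n -> C :=
  fun k => cintegral muZT (locop_integrand s g1 g2 f k).

Definition locop_defined (s : Zn n * Tn -> C) (g1 g2 : Zn n -> C) : Prop :=
  forall f, l2 f -> forall k, cintegrable muZT (locop_integrand s g1 g2 f k).

End analysis_on_Zn.

(* Main.v *)
(* Let e_q, q = (m, l), be the function on Z^n x T^n equal to the character   *)
(* e^{2 pi i l.w} on the fibre m and to 0 on the other fibres.  Fejer means  *)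
(* show that finite sums of the e_q are dense in the Schwartz space, so that *)
(* the Fourier coefficients on T^n x T^n of V_G sigma(m, ., ., k) can be     *)
(* computed: they are the products conj(G^(p)) sigma(e_q).  By Bessel,       *)
(* (sum_p |G^(p)|^2) (sum_q |sigma(e_q)|^2) <= |V_G sigma|_2^2.  Hence       *)
(* (Riesz-Fischer) sigma is given by a function s in L^2, unique because an  *)
(* integrable function on T^n is determined by its Fourier coefficients, and *)
(* |s|_2 |G|_2 <= |V_G sigma|_2 by Parseval.  Similarly V_g g_i(m, .) has    *)
(* Fourier coefficients conj(g(k - m)) g_i(k), which are therefore bounded   *)
(* by the integral of |V_g g_i(m, .)|; Cauchy-Schwarz in k and summation in  *)
(* m give |g_i|_2 |g|_2 <= |V_g g_i|_1.  Finally L f(k) is the inner product *)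
(* of s V_{g1} f with Phi_k(m, w) = conj(g2(k - m) e^{2 pi i w.k}), and the  *)
(* Phi_k are orthogonal of norm |g2|_2: with |V_{g1} f| <= |f|_2 |g1|_2,     *)
(* Bessel gives |L f|_2 <= |s|_2 |g1|_2 |g2|_2 |f|_2.  The constant is       *)
(* C = 1 / (|G|_2 |g|_2^2).                                                  *)

From HB Require Import structures.
From mathcomp Require Import all_boot all_order all_algebra.
From mathcomp Require Import complex.
From mathcomp Require Import all_classical all_reals all_analysis.
From mathcomp Require Import measurable_realfun.
From mathcomp Require Import ring lra zify.
Require Import Defs.

Set Implicit Arguments.
Unset Strict Implicit.
Unset Printing Implicit Defensive.

Import Order.TTheory GRing.Theory Num.Theory.
Import numFieldNormedType.Exports.

Local Open Scope classical_set_scope.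
Local Open Scope ring_scope.
Local Open Scope complex_scope.

(** The estimate passes through Hilbert spaces. An L^2 symbol with l^2 windows gives an operator
    whose norm is at most the product of the three norms ([locop_bound], [locop_opnorm]), so it
    remains to dominate the L^2 norm of the symbol by its M^2 norm and the l^2 norms of the windows
    by their M^1 norms. With windows of norm 1 in l^2 and L^2 all the comparisons have constant 1.

    Symbol and windows are given only as distributions, so the comparison is made through Fourier
    coefficients of their short-time Fourier transforms, which can be computed by density. For a
    symbol each coefficient is a coefficient of [G] times a coefficient of [sigma] ([coef_schwartz],
    [ip_bas]); hence a Bessel sum over a product of finite sets is a product of two sums
    ([stft_bessel]). As [G] has a nonzero coefficient, those of [sigma] are square-summable.
    [represents_exists] turns them into a function, [represents_unique] carries the bound over to
    every representing function, and [parseval_le] recovers the full norm of [G]. For a window the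
    coefficients are given by [cintegral_dstft], and [nrm2_values_le] sums them.

    The analytic input is the Fejer kernel, controlled throughout by the chord |1 - e^{2 pi i t}|.
    Its means commute with derivatives of periodic functions, which gives density in the Schwartz
    topology ([trig_dense]); applied to indicators of arcs it gives uniqueness of Fourier
    coefficients in L^1 ([L1_uniqueness]). *)

Local Notation normc := ComplexField.Normc.normc.
Local Notation ReC := complex.Re.
Local Notation ImC := complex.Im.

(** * Complex-valued integrable functions *)

Section complex_numbers.
Context {R : rcfType}.
Implicit Types z w : R[i].

Lemma sqr_normcE z : normc z ^+ 2 = ReC z ^+ 2 + ImC z ^+ 2.
Proof. by case: z => a b /=; rewrite sqr_sqrtr// addr_ge0 ?sqr_ge0. Qed.

Lemma normc_ge0 z : 0 <= normc z.
Proof. by case: z => a b; exact: sqrtr_ge0. Qed.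

Lemma normc_Re z : `|ReC z| <= normc z.
Proof.
rewrite -(ler_pXn2r (ltn0Sn 1)) ?nnegrE ?normc_ge0// sqr_normcE.
by rewrite real_normK ?num_real// lerDl sqr_ge0.
Qed.

Lemma normc_Im z : `|ImC z| <= normc z.
Proof.
rewrite -(ler_pXn2r (ltn0Sn 1)) ?nnegrE ?normc_ge0// sqr_normcE.
by rewrite real_normK ?num_real// lerDr sqr_ge0.
Qed.

Lemma normc_le_ReIm z : normc z <= `|ReC z| + `|ImC z|.
Proof.
rewrite -(ler_pXn2r (ltn0Sn 1)) ?nnegrE ?normc_ge0 ?addr_ge0// sqr_normcE.
rewrite sqrrD !real_normK ?num_real// -addrA lerD2l lerDr.
by rewrite mulrn_wge0// mulr_ge0.
Qed.

Lemma normcJ z : normc (conjc z) = normc z.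
Proof. by case: z => a b /=; rewrite sqrrN. Qed.

Lemma mulcJ z : z * conjc z = (normc z ^+ 2)%:C.
Proof.
rewrite sqr_normcE; case: z => a b /=; simpc; congr (_ +i* _); ring.
Qed.

Lemma normc_real (x : R) : normc x%:C = `|x|.
Proof. by rewrite /= expr0n addr0 sqrtr_sqr. Qed.

Lemma normc_D z w : normc (z + w) <= normc z + normc w.
Proof. exact: le_normcD. Qed.

Lemma normc_0 : normc (0 : R[i]) = 0.
Proof. exact: ComplexField.Normc.normc0. Qed.

Lemma normc_M z w : normc (z * w) = normc z * normc w.
Proof. exact: ComplexField.Normc.normcM. Qed.

Lemma normc_N z : normc (- z) = normc z.
Proof. exact: normcN. Qed.

Lemma normcB z w : normc (z - w) = normc (w - z).
Proof. by rewrite -normc_N opprB. Qed.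

Lemma le_normc_sum (I : Type) (s : seq I) (F : I -> R[i]) :
  normc (\sum_(i <- s) F i) <= \sum_(i <- s) normc (F i).
Proof.
elim/big_ind2 : _ => [|x a y b h1 h2|//]; first by rewrite normc_0.
by apply: le_trans (normc_D _ _) _; exact: lerD.
Qed.

Lemma normc_eq0 z : (normc z == 0) = (z == 0).
Proof.
apply/eqP/eqP => [/ComplexField.Normc.eq0_normc//|->].
exact: ComplexField.Normc.normc0.
Qed.

Lemma ReD z w : ReC (z + w) = ReC z + ReC w. Proof. by case: z w => a b []. Qed.
Lemma ImD z w : ImC (z + w) = ImC z + ImC w. Proof. by case: z w => a b []. Qed.
Lemma ReM z w : ReC (z * w) = ReC z * ReC w - ImC z * ImC w.
Proof. by case: z w => a b []. Qed.
Lemma ImM z w : ImC (z * w) = ReC z * ImC w + ImC z * ReC w.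
Proof. by case: z w => a b []. Qed.
Lemma ReN z : ReC (- z) = - ReC z. Proof. by case: z. Qed.
Lemma ImN z : ImC (- z) = - ImC z. Proof. by case: z. Qed.
Lemma ReJ z : ReC (conjc z) = ReC z. Proof. by case: z. Qed.
Lemma ImJ z : ImC (conjc z) = - ImC z. Proof. by case: z. Qed.

Lemma conjcD z w : conjc (z + w) = conjc z + conjc w. Proof. exact: rmorphD. Qed.
Lemma conjcB z w : conjc (z - w) = conjc z - conjc w. Proof. exact: rmorphB. Qed.
Lemma conjcM z w : conjc (z * w) = conjc z * conjc w. Proof. exact: rmorphM. Qed.
Lemma conjc_sum (I : Type) (s : seq I) (F : I -> R[i]) :
  conjc (\sum_(i <- s) F i) = \sum_(i <- s) conjc (F i).
Proof. exact: rmorph_sum. Qed.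
Lemma realcM (x y : R) : (x * y)%:C = x%:C * y%:C. Proof. exact: rmorphM. Qed.
Lemma realc_sum (I : Type) (s : seq I) (F : I -> R) :
  (\sum_(i <- s) F i)%:C = \sum_(i <- s) (F i)%:C.
Proof. exact: rmorph_sum. Qed.

Lemma ReImP z w : ReC z = ReC w -> ImC z = ImC w -> z = w.
Proof. by case: z w => a b [c d] /= -> ->. Qed.

Lemma sqr_normcD z w : normc (z + w) ^+ 2 <= 2 * normc z ^+ 2 + 2 * normc w ^+ 2.
Proof.
rewrite !sqr_normcE ReD ImD.
have := sqr_ge0 (ReC z - ReC w); have := sqr_ge0 (ImC z - ImC w); nra.
Qed.

End complex_numbers.

Section complex_integral.
Context {d} {T : measurableType d} {R : realType}.
Variable mu : {measure set T -> \bar R}.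
Implicit Types f g : T -> R[i].

Lemma cmeasurable_cst (c : R[i]) : cmeasurable (fun _ : T => c).
Proof. by split; exact: measurable_cst. Qed.

Lemma cmeasurableD f g : cmeasurable f -> cmeasurable g ->
  cmeasurable (fun x => f x + g x).
Proof.
move=> [fR fI] [gR gI]; split.
- by under eq_fun do rewrite ReD; exact: measurable_funD.
- by under eq_fun do rewrite ImD; exact: measurable_funD.
Qed.

Lemma cmeasurableN f : cmeasurable f -> cmeasurable (fun x => - f x).
Proof.
move=> [fR fI]; split.
- by under eq_fun do rewrite ReN; exact: measurable_funN.
- by under eq_fun do rewrite ImN; exact: measurable_funN.
Qed.

Lemma cmeasurableM f g : cmeasurable f -> cmeasurable g ->
  cmeasurable (fun x => f x * g x).
Proof.
move=> [fR fI] [gR gI]; split.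
- under eq_fun do rewrite ReM.
  by apply: measurable_funB; exact: measurable_funM.
- under eq_fun do rewrite ImM.
  by apply: measurable_funD; exact: measurable_funM.
Qed.

Lemma cmeasurableJ f : cmeasurable f -> cmeasurable (fun x => conjc (f x)).
Proof.
move=> [fR fI]; split.
- by under eq_fun do rewrite ReJ.
- by under eq_fun do rewrite ImJ; exact: measurable_funN.
Qed.

Lemma cmeasurableZ (c : R[i]) f : cmeasurable f -> cmeasurable (fun x => c * f x).
Proof. by move=> mf; apply: cmeasurableM => //; exact: cmeasurable_cst. Qed.

Lemma cmeasurable_sum (I : Type) (s : seq I) (F : I -> T -> R[i]) :
  (forall i, cmeasurable (F i)) -> cmeasurable (fun x => \sum_(i <- s) F i x).
Proof.
move=> mF; elim: s => [|i s IH].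
  by under eq_fun do rewrite big_nil; exact: cmeasurable_cst.
by under eq_fun do rewrite big_cons; exact: cmeasurableD.
Qed.

Lemma cmeasurable_real (h : T -> R) : measurable_fun setT h ->
  cmeasurable (fun x => (h x)%:C).
Proof. by move=> mh; split => //=; exact: measurable_cst. Qed.

Lemma measurable_sqr_normc f : cmeasurable f ->
  measurable_fun setT (fun x => normc (f x) ^+ 2).
Proof.
move=> [fR fI]; under eq_fun do rewrite sqr_normcE.
by apply: measurable_funD; exact: measurable_funX.
Qed.

Lemma measurable_normc f : cmeasurable f -> measurable_fun setT (fun x => normc (f x)).
Proof.
move=> mf.
have -> : (fun x => normc (f x)) = (fun x => (normc (f x) ^+ 2) `^ (2^-1)).
  by apply/funext => x; rewrite powR12_sqrt ?sqr_ge0// sqrtr_sqr ger0_norm ?normc_ge0.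
by apply: (measurableT_comp (measurable_powR _)); exact: measurable_sqr_normc.
Qed.

Lemma cmeasurable_comp d' (T' : measurableType d') (h : T' -> T) f :
  measurable_fun setT h -> cmeasurable f -> cmeasurable (f \o h).
Proof.
by move=> mh [fR fI]; split; [apply: (measurableT_comp fR)|apply: (measurableT_comp fI)].
Qed.

(** The modulus lies between each of the parts and their sum. In this form domination and Tonelli
    arguments need a single integral of the modulus. *)
Lemma cintegrableP f : cintegrable mu f <->
  cmeasurable f /\ (\int[mu]_x (normc (f x))%:E < +oo)%E.
Proof.
split.
- move=> [iR iI]; have mf : cmeasurable f.
    by split; [have /integrableP[/measurable_EFinP] := iR
              |have /integrableP[/measurable_EFinP] := iI].
  split => //; apply: (@le_lt_trans _ _
      (\int[mu]_x (`|(ReC (f x))%:E| + `|(ImC (f x))%:E|))%E).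
    apply: ge0_le_integral => //.
    - by move=> x _; rewrite lee_fin normc_ge0.
    - by apply/measurable_EFinP; exact: measurable_normc.
    - by case: mf => mR mI; apply: emeasurable_funD; apply: measurableT_comp => //;
         exact/measurable_EFinP.
    - by move=> x _; rewrite lee_fin normc_le_ReIm.
  case: mf => mR mI; rewrite ge0_integralD//; last 2 first.
    - by apply: measurableT_comp => //; exact/measurable_EFinP.
    - by apply: measurableT_comp => //; exact/measurable_EFinP.
  by apply: lte_add_pinfty; [case/integrableP: iR|case/integrableP: iI].
- move=> [mf lf].
  have mn : measurable_fun setT (EFin \o (fun x => normc (f x))).
    by apply/measurable_EFinP; exact: measurable_normc.
  have i0 : mu.-integrable setT (EFin \o (fun x => normc (f x))).
    apply/integrableP; split => //.
    by under eq_integral do rewrite /= ger0_norm ?normc_ge0//.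
  case: mf => mR mI; split.
  + apply: (le_integrable measurableT _ _ i0); first exact/measurable_EFinP.
    by move=> x _; rewrite /= lee_fin [leRHS]ger0_norm ?normc_ge0 ?normc_Re.
  + apply: (le_integrable measurableT _ _ i0); first exact/measurable_EFinP.
    by move=> x _; rewrite /= lee_fin [leRHS]ger0_norm ?normc_ge0 ?normc_Im.
Qed.

Lemma cintegrable_meas f : cintegrable mu f -> cmeasurable f.
Proof. by move=> /cintegrableP[]. Qed.

Lemma cintegrable_normc f : cintegrable mu f ->
  mu.-integrable setT (EFin \o (fun x => normc (f x))).
Proof.
move=> /cintegrableP[mf lf]; apply/integrableP; split.
  by apply/measurable_EFinP; exact: measurable_normc.
by under eq_integral do rewrite /= ger0_norm ?normc_ge0//.
Qed.

Lemma cintegrable_le f (h : T -> R) : cmeasurable f ->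
  mu.-integrable setT (EFin \o h) -> (forall x, normc (f x) <= h x) ->
  cintegrable mu f.
Proof.
move=> mf ih le; apply/cintegrableP; split => //.
case/integrableP: ih => mh; apply: le_lt_trans.
apply: ge0_le_integral => //.
- by move=> x _; rewrite lee_fin normc_ge0.
- by apply/measurable_EFinP; exact: measurable_normc.
- by apply: measurableT_comp.
- by move=> x _; rewrite lee_fin (le_trans (le _)) ?ler_norm.
Qed.

Lemma cintegrableD f g : cintegrable mu f -> cintegrable mu g ->
  cintegrable mu (fun x => f x + g x).
Proof.
move=> [fR fI] [gR gI]; split.
- by under eq_fun do rewrite ReD EFinD; exact: integrableD.
- by under eq_fun do rewrite ImD EFinD; exact: integrableD.
Qed.

Lemma cintegrableZ (c : R[i]) f : cintegrable mu f -> cintegrable mu (fun x => c * f x).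
Proof.
move=> [fR fI]; split.
- under eq_fun do rewrite ReM EFinB !EFinM.
  by apply: integrableB => //; exact: integrableZl.
- under eq_fun do rewrite ImM EFinD !EFinM.
  by apply: integrableD => //; exact: integrableZl.
Qed.

Lemma cintegrableN f : cintegrable mu f -> cintegrable mu (fun x => - f x).
Proof.
move=> h; under eq_fun do rewrite -mulN1r.
exact: cintegrableZ.
Qed.

Lemma cintegrableB f g : cintegrable mu f -> cintegrable mu g ->
  cintegrable mu (fun x => f x - g x).
Proof. by move=> h1 h2; apply: cintegrableD => //; exact: cintegrableN. Qed.

Lemma cintegrableJ f : cintegrable mu f -> cintegrable mu (fun x => conjc (f x)).
Proof.
move=> [fR fI]; split; first by under eq_fun do rewrite ReJ.
under eq_fun do rewrite ImJ EFinN.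
exact: integrableN.
Qed.

Lemma cintegrable0 : cintegrable mu (fun=> 0).
Proof. by split; exact: integrable0. Qed.

Lemma cintegrable_sum (I : Type) (s : seq I) (F : I -> T -> R[i]) :
  (forall i, cintegrable mu (F i)) -> cintegrable mu (fun x => \sum_(i <- s) F i x).
Proof.
move=> mF; elim: s => [|i s IH].
  by under eq_fun do rewrite big_nil; exact: cintegrable0.
by under eq_fun do rewrite big_cons; exact: cintegrableD.
Qed.

Lemma cintegralD f g : cintegrable mu f -> cintegrable mu g ->
  cintegral mu (fun x => f x + g x) = cintegral mu f + cintegral mu g.
Proof.
move=> [fR fI] [gR gI]; rewrite /cintegral; apply: ReImP => /=.
- by under eq_Rintegral do rewrite ReD; rewrite RintegralD.
- by under eq_Rintegral do rewrite ImD; rewrite RintegralD.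
Qed.

Lemma cintegralZ (c : R[i]) f : cintegrable mu f ->
  cintegral mu (fun x => c * f x) = c * cintegral mu f.
Proof.
move=> [fR fI].
have iZ (a : R) (h : T -> R) : mu.-integrable setT (fun x => (h x)%:E) ->
    mu.-integrable setT (EFin \o (fun x => a * h x)).
  move=> ih; rewrite (_ : EFin \o _ = (fun x => a%:E * (h x)%:E)%E)//.
  exact: integrableZl.
rewrite /cintegral; apply: ReImP; rewrite ?ReM ?ImM/=.
- under eq_Rintegral do rewrite ReM.
  by rewrite RintegralB ?RintegralZl//; exact: iZ.
- under eq_Rintegral do rewrite ImM.
  by rewrite RintegralD ?RintegralZl//; exact: iZ.
Qed.

Lemma cintegralN f : cintegrable mu f -> cintegral mu (fun x => - f x) = - cintegral mu f.
Proof.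
move=> h; under [X in cintegral _ X]eq_fun do rewrite -mulN1r.
by rewrite cintegralZ// mulN1r.
Qed.

Lemma cintegralB f g : cintegrable mu f -> cintegrable mu g ->
  cintegral mu (fun x => f x - g x) = cintegral mu f - cintegral mu g.
Proof.
by move=> h1 h2; rewrite cintegralD ?cintegralN//; exact: cintegrableN.
Qed.

Lemma cintegral0 : cintegral mu (fun=> 0) = 0.
Proof.
rewrite /cintegral /Rintegral; apply: ReImP => /=;
  by rewrite integral0.
Qed.

Lemma cintegral_sum (I : Type) (s : seq I) (F : I -> T -> R[i]) :
  (forall i, cintegrable mu (F i)) ->
  cintegral mu (fun x => \sum_(i <- s) F i x) = \sum_(i <- s) cintegral mu (F i).
Proof.
move=> mF; elim: s => [|i s IH].
  by under eq_fun do rewrite big_nil; rewrite cintegral0 big_nil.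
under eq_fun do rewrite big_cons.
by rewrite cintegralD ?IH ?big_cons//; exact: cintegrable_sum.
Qed.

Lemma cintegralJ f : cintegrable mu f ->
  cintegral mu (fun x => conjc (f x)) = conjc (cintegral mu f).
Proof.
move=> [fR fI]; rewrite /cintegral; apply: ReImP => /=.
- by under eq_Rintegral do rewrite ReJ.
- under eq_Rintegral do rewrite ImJ -mulN1r.
  by rewrite RintegralZl// mulN1r.
Qed.

Lemma cintegral_real (h : T -> R) :
  cintegral mu (fun x => (h x)%:C) = (\int[mu]_x h x)%:C.
Proof.
rewrite /cintegral/=; congr (_ +i* _).
by rewrite /Rintegral integral0.
Qed.

Lemma cintegrable_real (h : T -> R) : mu.-integrable setT (EFin \o h) ->
  cintegrable mu (fun x => (h x)%:C).
Proof. by move=> ih; split => //=; exact: integrable0. Qed.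

(** Rotate by the conjugate of the integral I: |I|^2 is the real part of the integral of conj(I) f,
    hence at most |I| times the integral of |f|. *)
Lemma le_normc_cintegral f : cintegrable mu f ->
  normc (cintegral mu f) <= \int[mu]_x normc (f x).
Proof.
move=> h; set I := cintegral mu f.
have [I0|I0] := eqVneq I 0.
  rewrite I0 normc_0; apply: Rintegral_ge0 => x _; exact: normc_ge0.
have nI : 0 < normc I by rewrite lt_neqAle normc_ge0 andbT eq_sym normc_eq0.
rewrite -(ler_pM2l nI) -expr2.
have -> : normc I ^+ 2 = ReC (cintegral mu (fun x => conjc I * f x)).
  by rewrite cintegralZ// mulrC mulcJ.
rewrite -RintegralZl//; last exact: cintegrable_normc.
rewrite [leLHS]/ReC {1}/cintegral; apply: le_Rintegral => //.
- by have [] := cintegrableZ (conjc I) h.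
- rewrite (_ : EFin \o _ = (fun x => (normc I)%:E * (normc (f x))%:E)%E)//.
  by apply: integrableZl => //; exact: cintegrable_normc.
- move=> x _; rewrite (le_trans (ler_norm _))// (le_trans (normc_Re _))//.
  by rewrite normc_M normcJ.
Qed.

Lemma eq_cintegral f g : f =1 g -> cintegral mu f = cintegral mu g.
Proof. by move=> /funext ->. Qed.

Lemma fin_normc_cintegrable f : cintegrable mu f ->
  (\int[mu]_x (normc (f x))%:E)%E = (\int[mu]_x normc (f x))%:E.
Proof.
move=> /cintegrable_normc h; rewrite fineK//.
exact: (integrable_fin_num _ h).
Qed.

Lemma cintegrable_mulr f g (B : R) : cintegrable mu f -> cmeasurable g ->
  (forall x, normc (g x) <= B) -> cintegrable mu (fun x => f x * g x).
Proof.
move=> h mg gB; apply: (@cintegrable_le _ (fun x => B * normc (f x))).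
- by apply: cmeasurableM => //; exact: cintegrable_meas h.
- rewrite (_ : EFin \o _ = (fun x => B%:E * (normc (f x))%:E)%E)//.
  by apply: integrableZl => //; exact: cintegrable_normc.
- by move=> x; rewrite normc_M mulrC ler_wpM2r ?normc_ge0.
Qed.

Lemma ae_eq_cintegral f g : cmeasurable f -> cmeasurable g ->
  (\int[mu]_x (normc (f x - g x))%:E = 0)%E ->
  {ae mu, forall x, f x = g x}.
Proof.
move=> mf mg h0.
have mfg : measurable_fun setT (EFin \o (fun x => normc (f x - g x))).
  apply/measurable_EFinP/measurable_normc.
  by apply: cmeasurableD => //; exact: cmeasurableN.
have h1 : (\int[mu]_x `|(normc (f x - g x))%:E| = 0)%E.
  by rewrite -[RHS]h0; apply: eq_integral => x _; rewrite /= ger0_norm ?normc_ge0.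
have /ae_eq_integral_abs := mfg.
move=> /(_ mu measurableT) [/(_ h1) + _].
apply: filterS => x /(_ Logic.I) /= [] /ComplexField.Normc.eq0_normc/eqP.
by rewrite subr_eq0 => /eqP.
Qed.

End complex_integral.

(** * Square-integrable functions *)

Section square_integrable.
Context {d} {T : measurableType d} {R : realType}.
Variable mu : {measure set T -> \bar R}.
Implicit Types f g : T -> R[i].

Definition sqint f : Prop :=
  cmeasurable f /\ (\int[mu]_x (normc (f x) ^+ 2)%:E < +oo)%E.

Definition ip f g : R[i] := cintegral mu (fun x => f x * conjc (g x)).

Definition nrm2 f : R := \int[mu]_x (normc (f x) ^+ 2).

Lemma sqint_integrable f : sqint f ->
  mu.-integrable setT (EFin \o (fun x => normc (f x) ^+ 2)).
Proof.
move=> [mf lf]; apply/integrableP; split.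
  by apply/measurable_EFinP; exact: measurable_sqr_normc.
by under eq_integral do rewrite /= ger0_norm ?sqr_ge0//.
Qed.

Lemma nrm2_ge0 f : 0 <= nrm2 f.
Proof. by apply: Rintegral_ge0 => x _; exact: sqr_ge0. Qed.

Lemma nrm2E f : sqint f -> (\int[mu]_x (normc (f x) ^+ 2)%:E = (nrm2 f)%:E)%E.
Proof.
move=> /sqint_integrable h; rewrite /nrm2 fineK//.
exact: (integrable_fin_num _ h).
Qed.

Lemma sqint_le f (h : T -> R) : cmeasurable f ->
  mu.-integrable setT (EFin \o h) -> (forall x, normc (f x) ^+ 2 <= h x) -> sqint f.
Proof.
move=> mf ih le; split => //.
case/integrableP: ih => mh; apply: le_lt_trans.
apply: ge0_le_integral => //.
- by move=> x _; rewrite lee_fin sqr_ge0.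
- by apply/measurable_EFinP; exact: measurable_sqr_normc.
- by apply: measurableT_comp.
- by move=> x _; rewrite lee_fin (le_trans (le _)) ?ler_norm.
Qed.

Lemma integrableZ_EFin (k : R) (h : T -> R) : mu.-integrable setT (EFin \o h) ->
  mu.-integrable setT (EFin \o (fun x => k * h x)).
Proof.
move=> ih; rewrite (_ : EFin \o _ = (fun x => k%:E * (h x)%:E)%E)//.
exact: integrableZl.
Qed.

Lemma integrableD_EFin (h k : T -> R) : mu.-integrable setT (EFin \o h) ->
  mu.-integrable setT (EFin \o k) -> mu.-integrable setT (EFin \o (fun x => h x + k x)).
Proof.
move=> ih ik; rewrite (_ : EFin \o _ = (EFin \o h) \+ (EFin \o k))%E//.
exact: integrableD.
Qed.

Lemma sqintD f g : sqint f -> sqint g -> sqint (fun x => f x + g x).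
Proof.
move=> hf hg; apply: (@sqint_le _ (fun x => 2 * normc (f x) ^+ 2 + 2 * normc (g x) ^+ 2)).
- by apply: cmeasurableD; [case: hf|case: hg].
- by apply: integrableD_EFin; apply: integrableZ_EFin; exact: sqint_integrable.
- by move=> x; exact: sqr_normcD.
Qed.

Lemma sqintM_bounded f g (B : R) : sqint f -> cmeasurable g ->
  (forall x, normc (g x) <= B) -> sqint (fun x => f x * g x).
Proof.
move=> hf mg gB; apply: (@sqint_le _ (fun x => B ^+ 2 * normc (f x) ^+ 2)).
- by apply: cmeasurableM => //; case: hf.
- by apply: integrableZ_EFin; exact: sqint_integrable.
- move=> x; rewrite normc_M exprMn mulrC ler_wpM2r ?sqr_ge0//.
  by rewrite ler_pXn2r ?nnegrE ?normc_ge0// (le_trans _ (gB x)) ?normc_ge0.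
Qed.

Lemma sqintZ (c : R[i]) f : sqint f -> sqint (fun x => c * f x).
Proof.
move=> hf; under eq_fun do rewrite mulrC.
by apply: (@sqintM_bounded _ _ (normc c)) => //; exact: cmeasurable_cst.
Qed.

Lemma sqintB f g : sqint f -> sqint g -> sqint (fun x => f x - g x).
Proof.
move=> hf hg; apply: sqintD => //; under eq_fun do rewrite -mulN1r.
exact: sqintZ.
Qed.

Lemma sqint0 : sqint (fun=> 0).
Proof.
split; first exact: cmeasurable_cst.
by under eq_integral do rewrite normc_0 expr0n/=; rewrite integral0.
Qed.

Lemma sqint_sum (I : Type) (s : seq I) (F : I -> T -> R[i]) :
  (forall i, sqint (F i)) -> sqint (fun x => \sum_(i <- s) F i x).
Proof.
move=> mF; elim: s => [|i s IH].
  by under eq_fun do rewrite big_nil; exact: sqint0.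
by under eq_fun do rewrite big_cons; exact: sqintD.
Qed.

Lemma sqintJ f : sqint f -> sqint (fun x => conjc (f x)).
Proof.
move=> [mf lf]; split; first exact: cmeasurableJ.
by under eq_integral do rewrite normcJ.
Qed.

Lemma ip_cintegrable f g : sqint f -> sqint g ->
  cintegrable mu (fun x => f x * conjc (g x)).
Proof.
move=> hf hg; apply: (@cintegrable_le _ _ _ _ _ (fun x => normc (f x) ^+ 2 + normc (g x) ^+ 2)).
- by apply: cmeasurableM; [case: hf|apply: cmeasurableJ; case: hg].
- by apply: integrableD_EFin; exact: sqint_integrable.
- move=> x; rewrite normc_M normcJ.
  have := normc_ge0 (f x); have := normc_ge0 (g x); nra.
Qed.

Lemma ipDl f g h : sqint f -> sqint g -> sqint h ->
  ip (fun x => f x + g x) h = ip f h + ip g h.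
Proof.
move=> hf hg hh; rewrite /ip -cintegralD; [|exact: ip_cintegrable..].
by apply: eq_cintegral => x; rewrite mulrDl.
Qed.

Lemma ipZl (c : R[i]) f h : sqint f -> sqint h -> ip (fun x => c * f x) h = c * ip f h.
Proof.
move=> hf hh; rewrite /ip -cintegralZ; last exact: ip_cintegrable.
by apply: eq_cintegral => x; rewrite mulrA.
Qed.

Lemma ipJ f g : sqint f -> sqint g -> ip g f = conjc (ip f g).
Proof.
move=> hf hg; rewrite /ip -cintegralJ; last exact: ip_cintegrable.
by apply: eq_cintegral => x; rewrite conjcM conjcK mulrC.
Qed.

Lemma ipBl f g h : sqint f -> sqint g -> sqint h ->
  ip (fun x => f x - g x) h = ip f h - ip g h.
Proof.
move=> hf hg hh; under [X in ip X _]eq_fun do rewrite -mulN1r.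
by rewrite ipDl ?ipZl ?mulN1r//; exact: sqintZ.
Qed.

Lemma ip_suml (I : Type) (s : seq I) (F : I -> T -> R[i]) h :
  (forall i, sqint (F i)) -> sqint h ->
  ip (fun x => \sum_(i <- s) F i x) h = \sum_(i <- s) ip (F i) h.
Proof.
move=> hF hh; rewrite /ip -cintegral_sum; last by move=> i; exact: ip_cintegrable.
by apply: eq_cintegral => x; rewrite mulr_suml.
Qed.

Lemma ipff f : ip f f = (nrm2 f)%:C.
Proof.
rewrite /ip -cintegral_real; apply: eq_cintegral => x.
by rewrite mulcJ.
Qed.

Lemma nrm2D f g : sqint f -> sqint g ->
  nrm2 (fun x => f x + g x) = nrm2 f + nrm2 g + 2 * ReC (ip f g).
Proof.
move=> hf hg; apply: complexI; rewrite -ipff.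
rewrite ipDl//; last exact: sqintD.
rewrite (ipJ (sqintD hf hg) hf) (ipJ (sqintD hf hg) hg) !ipDl// !conjcD.
rewrite !ipff (ipJ hf hg) conjcK.
apply: ReImP; rewrite !(ReD, ImD, ReJ, ImJ)/= ; ring.
Qed.

Lemma nrm2Z (c : R[i]) f : sqint f -> nrm2 (fun x => c * f x) = normc c ^+ 2 * nrm2 f.
Proof.
move=> hf; rewrite /nrm2 -RintegralZl//; last exact: sqint_integrable.
by apply: eq_Rintegral => x _; rewrite normc_M exprMn.
Qed.

Lemma nrm2_sub f g (t : R) : sqint f -> sqint g ->
  nrm2 (fun x => f x - t%:C * g x) = nrm2 f + t ^+ 2 * nrm2 g - 2 * t * ReC (ip f g).
Proof.
move=> hf hg; under [X in nrm2 X]eq_fun do rewrite -mulNr.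
have hZ : sqint (fun x => - t%:C * g x) by exact: sqintZ.
rewrite nrm2D// nrm2Z// normc_N normc_real real_normK ?num_real//.
rewrite (ipJ hZ hf) ipZl// conjcM -(ipJ hg hf) ReM/=; ring.
Qed.

Section orthogonal.
Variables (I : eqType) (e : I -> T -> R[i]) (b : R).
Hypothesis b_ge0 : 0 <= b.
Hypothesis he : forall i, sqint (e i).
Hypothesis oe : forall i j, ip (e i) (e j) = if i == j then b%:C else 0.

Lemma ip_orthogonal_sum (s : seq I) (c : I -> R[i]) j : uniq s -> j \in s ->
  ip (fun x => \sum_(i <- s) c i * e i x) (e j) = c j * b%:C.
Proof.
move=> us js; rewrite ip_suml//; last by move=> i; exact: sqintZ.
under eq_bigr do rewrite ipZl// oe.
rewrite (bigD1_seq j)//= eqxx big1 ?addr0// => i ij.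
by rewrite (negbTE ij) mulr0.
Qed.

Lemma nrm2_orthogonal_sum (s : seq I) (c : I -> R[i]) : uniq s ->
  nrm2 (fun x => \sum_(i <- s) c i * e i x) = b * \sum_(i <- s) normc (c i) ^+ 2.
Proof.
move=> us; have hs : sqint (fun x => \sum_(i <- s) c i * e i x).
  by apply: sqint_sum => i; exact: sqintZ.
apply: complexI; rewrite -ipff {1}ip_suml//; last by move=> i; exact: sqintZ.
rewrite realcM realc_sum mulr_sumr; apply: eq_big_seq => i is_.
by rewrite ipZl// (ipJ hs)// ip_orthogonal_sum// conjcM conjc_real mulrA mulcJ mulrC.
Qed.

(** With g the sum of the <f, e_i> e_i and S the left-hand side, Re <f, g> = S and |g|^2 = b S, so
    |f - t g|^2 >= 0 reads |f|^2 + t^2 b S - 2 t S >= 0. Take t = 1/b. The common squared norm [b]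
    may be 0. *)
Lemma bessel f (s : seq I) : sqint f -> uniq s ->
  \sum_(i <- s) normc (ip f (e i)) ^+ 2 <= b * nrm2 f.
Proof.
move=> hf us; set S := \sum_(i <- s) _.
pose g x := \sum_(i <- s) ip f (e i) * e i x.
have hg : sqint g by apply: sqint_sum => i; exact: sqintZ.
have fg : ReC (ip f g) = S.
  rewrite (ipJ hg hf) ReJ /g ip_suml//; last by move=> i; exact: sqintZ.
  rewrite (eq_bigr (fun i => (normc (ip f (e i)) ^+ 2)%:C)); last first.
    by move=> i _; rewrite ipZl// (ipJ hf (he i)) mulcJ.
  by rewrite -realc_sum.
have gg : nrm2 g = b * S by exact: nrm2_orthogonal_sum.
have S0 : 0 <= S by apply: sumr_ge0 => i _; exact: sqr_ge0.
have key t : 0 <= nrm2 f + t ^+ 2 * (b * S) - 2 * t * S.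
  by rewrite -gg -fg -nrm2_sub// nrm2_ge0.
have := nrm2_ge0 f => n0.
have [b00|bp] := eqVneq b 0.
  rewrite b00 mul0r; rewrite leNgt; apply/negP => Sp.
  (* For b = 0 the quadratic is affine in t; this t makes it -|f|^2 - 2, which is negative. *)
  have := key ((nrm2 f + 1) / S); rewrite b00 mul0r mulr0 addr0 -mulrA mulfVK ?gt_eqF//.
  lra.
have bb : 0 < b by rewrite lt_neqAle eq_sym bp.
have := key b^-1.
have -> : b^-1 ^+ 2 * (b * S) = b^-1 * S by rewrite expr2 mulrA mulfVK.
move=> h; have : 0 <= b * (nrm2 f + b^-1 * S - 2 / b * S) by rewrite mulr_ge0.
have -> : b * (nrm2 f + b^-1 * S - 2 / b * S) = b * nrm2 f - S by field.
by rewrite subr_ge0.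
Qed.
End orthogonal.
End square_integrable.

(** * Completeness of L^2 and the Riesz-Fischer theorem *)

Section completeness.
Context {d} {T : measurableType d} {R : realType}.
Variable mu : {measure set T -> \bar R}.
Implicit Types f g : T -> R[i].

(** Bessel's inequality for the one-element family g, with b = |g|^2; the case g = 0 is included
    because b may vanish. *)
Lemma cauchy_schwarz f g : sqint mu f -> sqint mu g ->
  normc (ip mu f g) ^+ 2 <= nrm2 mu f * nrm2 mu g.
Proof.
move=> hf hg.
have := @bessel _ _ _ mu unit (fun=> g) (nrm2 mu g) (nrm2_ge0 _ _) (fun=> hg) _ f [:: tt] hf isT.
by rewrite big_seq1 mulrC; apply=> -[] []; rewrite eqxx ipff.
Qed.

Lemma cauchy_schwarz_abs f g : sqint mu f -> sqint mu g ->
  (\int[mu]_x normc (f x * g x)) ^+ 2 <= nrm2 mu f * nrm2 mu g.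
Proof.
move=> hf hg.
have habs h : sqint mu h -> sqint mu (fun x => (normc (h x))%:C).
  move=> [mh lh]; split; first by apply: cmeasurable_real; exact: measurable_normc.
  by under eq_integral do rewrite normc_real real_normK ?num_real//.
have nabs h : nrm2 mu (fun x => (normc (h x))%:C) = nrm2 mu h.
  by apply: eq_Rintegral => x _; rewrite normc_real real_normK ?num_real.
have := cauchy_schwarz (habs _ hf) (habs _ hg).
rewrite !nabs; apply: le_trans; rewrite le_eqVlt; apply/orP; left; apply/eqP.
rewrite /ip (_ : (fun x => _) = (fun x => (normc (f x * g x))%:C)); last first.
  by apply/funext => x; rewrite conjc_real -realcM normc_M.
by rewrite cintegral_real normc_real real_normK ?num_real.
Qed.

(** A sequence that is Cauchy at the rate 2^-j in L^2 converges almost everywhere, and Fatou's lemma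
    carries the rate to the limit. *)
Lemma L2_real_complete (F : nat -> T -> R) :
  (forall j, measurable_fun setT (F j)) ->
  (forall j i, (j <= i)%N ->
     (\int[mu]_x ((F i x - F j x) ^+ 2)%:E <= ((4^-1) ^+ j)%:E)%E) ->
  exists2 f : T -> R, measurable_fun setT f &
    forall j, (\int[mu]_x ((f x - F j x) ^+ 2)%:E <= ((4^-1) ^+ j)%:E)%E.
Proof.
move=> mF cF.
(* The weight 2^j still leaves integrals at most 2^j 4^-j = 2^-j, so the sum [W] of the [D j] has
   integral at most 2 and is finite almost everywhere. *)
pose D j x : R := 2 ^+ j * (F j.+1 x - F j x) ^+ 2.
have D0 j x : 0 <= D j x by apply: mulr_ge0; [exact: exprn_ge0|exact: sqr_ge0].
have mD j : measurable_fun setT (fun x => (D j x)%:E).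
  apply/measurable_EFinP; apply: measurable_funM => //.
  by apply: measurable_funX; exact: measurable_funB.
pose W x : \bar R := (\sum_(j <oo) (D j x)%:E)%E.
have mW : measurable_fun setT W.
  by apply: ge0_emeasurable_sum => // k x _ _; rewrite lee_fin.
have iW : (\int[mu]_x W x < +oo)%E.
  rewrite integral_nneseries//; last by move=> j x _; rewrite lee_fin.
  apply: (@le_lt_trans _ _ (\sum_(j <oo) ((2^-1) ^+ j : R)%:E)%E).
    apply: lee_nneseries => [j _ _|j _]; first by apply: integral_ge0 => x _; rewrite lee_fin.
    under eq_integral do rewrite /D EFinM.
    rewrite ge0_integralZl//; last 2 first.
      + apply/measurable_EFinP/measurable_funX; exact: measurable_funB.
      + by move=> x _; rewrite lee_fin sqr_ge0.
    rewrite (_ : (2^-1) ^+ j = 2 ^+ j * (4^-1) ^+ j :> R); last first.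
      by rewrite -exprMn; congr (_ ^+ _); field.
    rewrite EFinM; apply: lee_pmul => //.
    - by apply: integral_ge0 => x _; rewrite lee_fin sqr_ge0.
    - exact: cF.
  have -> : (\sum_(j <oo) ((2^-1) ^+ j : R)%:E = 2%:E)%E.
    apply/cvg_lim => //.
    rewrite (_ : (fun n : nat => _) = EFin \o series (geometric 1 (2^-1 : R))).
      apply: cvg_EFin; first exact: nearW.
      have := @cvg_geometric_series R 1 (2^-1).
      rewrite (_ : 1 / (1 - 2^-1) = 2 :> R); last by field.
      by rewrite ger0_norm//; apply; lra.
    apply/funext => n; rewrite /series/= sumEFin; congr EFin.
    by apply: eq_bigr => i _; rewrite mul1r.
  exact: ltry.
have W0 x : (0 <= W x)%E by apply: nneseries_ge0 => j _ _; rewrite lee_fin.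
pose A : set T := [set x | (W x < +oo)%E].
have mA : measurable A.
  rewrite -[A]setTI; apply: (emeasurable_fun_infty_o measurableT mW).
have aeA : {ae mu, forall x, A x}.
  have iW' : mu.-integrable setT W.
    by apply/integrableP; split => //; under eq_integral do rewrite gee0_abs//.
  apply: filterS (integrable_ae measurableT iW') => x /(_ Logic.I).
  by rewrite ge0_fin_numE.
(* Cutting to the set where [W] is finite makes the sequence converge at every point, so that its
   limit is measurable. *)
pose G j x := F j x * \1_A x.
have mG j : measurable_fun setT (G j).
  by apply: measurable_funM => //; exact: measurable_indic.
have cG x : cvgn (fun j => G j x).
  have [Ax|nAx] := pselect (A x); last first.
    rewrite (_ : (fun j => G j x) = fun=> 0); first exact: is_cvg_cst.
    by apply/funext => j; rewrite /G indicE memNset// mulr0.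
  rewrite (_ : (fun j => G j x) = F^~ x); last first.
    by apply/funext => j; rewrite /G indicE mem_set// mulr1.
  rewrite (_ : F^~ x = (fun n => F 0%N x + series (fun j => F j.+1 x - F j x) n)); last first.
    apply/funext => n; rewrite /series/= telescope_sumr// addrC subrK//.
  apply: is_cvgD; first exact: is_cvg_cst.
  apply: normed_cvg.
  apply: (@series_le_cvg _ _ (fun j => (2^-1) ^+ j + D j x)) => [j|j|j|].
  - exact: normr_ge0.
  - by rewrite addr_ge0// exprn_ge0.
  (* The increment y satisfies |y| <= 2^-j + 2^j y^2, because a|y| <= 1 + (a|y|)^2 with a = 2^j.
     Both terms on the right are summable on [A]. *)
  - have h : 0 < (2 : R) ^+ j by rewrite exprn_gt0.
    set y := F j.+1 x - F j x; rewrite /D -/y exprVn.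
    set a := 2 ^+ j in h *.
    have hy : y ^+ 2 = `|y| ^+ 2 by rewrite real_normK ?num_real.
    rewrite hy; have := normr_ge0 y; set z := `|y| => z0.
    have ha : a * a^-1 = 1 by rewrite mulfV ?gt_eqF.
    have ai : 0 < a^-1 by rewrite invr_gt0.
    rewrite -subr_ge0 -(pmulr_rge0 _ h).
    have -> : a * (a^-1 + a * z ^+ 2 - z) = a * a^-1 + (a * z) ^+ 2 - a * z by ring.
    rewrite ha; have := sqr_ge0 (a * z - 1); nra.
  - rewrite seriesD; apply: is_cvgD.
      have := @cvg_geometric_series R 1 (2^-1).
      rewrite ger0_norm// => /(_ ltac:(lra)) /cvgP.
      by congr (cvgn _); congr series; apply/funext => i; rewrite /geometric/= mul1r.
    apply: nondecreasing_is_cvgn.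
      by apply/nondecreasing_seqP => n; rewrite /series/= big_nat_recr//= lerDl.
    exists (fine (W x)) => _ [n _ <-].
    rewrite -lee_fin fineK ?ge0_fin_numE// /series/= -sumEFin.
    by apply: nneseries_lim_ge => k _ _; rewrite lee_fin.
pose f x := limn (fun j => G j x).
have mf : measurable_fun setT f.
  by apply: (@measurable_fun_cvg _ _ _ _ G) => // x _; exact: cG.
exists f => // j.
have -> : (\int[mu]_x ((f x - F j x) ^+ 2)%:E = \int[mu]_x ((f x - G j x) ^+ 2)%:E)%E.
  apply: ge0_ae_eq_integral => //.
  - by apply/measurable_EFinP/measurable_funX; exact: measurable_funB.
  - by apply/measurable_EFinP/measurable_funX; exact: measurable_funB.
  - by move=> x _; rewrite lee_fin sqr_ge0.
  - by move=> x _; rewrite lee_fin sqr_ge0.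
  - apply: filterS aeA => x Ax _; by rewrite /G indicE mem_set// mulr1.
(* The integrand is rewritten as a lower limit over i so that Fatou applies; the indices [maxn n j]
   then keep the Cauchy bound available. *)
have -> : (\int[mu]_x ((f x - G j x) ^+ 2)%:E =
    \int[mu]_x limn_einf (fun i => ((G i x - G j x) ^+ 2)%:E))%E.
  apply: eq_integral => x _.
  have h : (fun i => ((G i x - G j x) ^+ 2)%:E) @ \oo --> ((f x - G j x) ^+ 2)%:E.
    apply: cvg_EFin; first exact: nearW.
    apply: cvgM; apply: cvgB; [exact: cG|exact: cvg_cst|exact: cG|exact: cvg_cst].
  by rewrite is_cvg_limn_einfE ?(cvg_lim _ h)//; apply/cvg_ex; exists ((f x - G j x) ^+ 2)%:E.
apply: le_trans (fatou mu measurableT _ _) _.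
- by move=> n; apply/measurable_EFinP/measurable_funX; exact: measurable_funB.
- by move=> n x _; rewrite lee_fin sqr_ge0.
rewrite limn_einf_lim; apply: lime_le; first exact: is_cvg_einfs.
apply: nearW => n; apply: (@le_trans _ _ (\int[mu]_x ((G (maxn n j) x - G j x) ^+ 2)%:E)%E).
  by apply: ereal_inf_lbound; exists (maxn n j) => //=; rewrite leq_maxl.
apply: le_trans (cF j (maxn n j) (leq_maxr _ _)).
apply: ge0_le_integral => //.
- by move=> x _; rewrite lee_fin sqr_ge0.
- by apply/measurable_EFinP/measurable_funX; exact: measurable_funB.
- by apply/measurable_EFinP/measurable_funX; exact: measurable_funB.
- move=> x _; rewrite lee_fin -mulrBl exprMn ler_piMr ?sqr_ge0// indicE.
Qed.

(** The cross term satisfies 2 Re <f, g> <= t |f|^2 + |g|^2 / t. The free parameter lets the factor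
    of |f|^2 tend to 1 in a limit argument. *)
Lemma nrm2D_le f g (t : R) : sqint mu f -> sqint mu g -> 0 < t ->
  nrm2 mu (fun x => f x + g x) <= (1 + t) * nrm2 mu f + (1 + t^-1) * nrm2 mu g.
Proof.
move=> hf hg t0; rewrite nrm2D//.
have := nrm2_ge0 mu (fun x => f x - (t^-1)%:C * g x); rewrite nrm2_sub//.
set r := ReC _; set a := nrm2 mu f; set b := nrm2 mu g => h.
have : 0 <= t * (a + t^-1 ^+ 2 * b - 2 / t * r) by rewrite mulr_ge0// ltW.
have -> : t * (a + t^-1 ^+ 2 * b - 2 / t * r) = t * a + t^-1 * b - 2 * r.
  by field; rewrite gt_eqF.
lra.
Qed.


Lemma ler_geometric_limit (a b M : R) :
  (forall j : nat, a <= M + b * (2^-1) ^+ j) -> a <= M.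
Proof.
move=> h; have c : (fun j : nat => M + b * (2^-1 : R) ^+ j) @ \oo --> M + b * 0.
  apply: cvgD; first exact: cvg_cst.
  apply: cvgM; first exact: cvg_cst.
  by apply: cvg_expr; rewrite ger0_norm//; lra.
rewrite mulr0 addr0 in c; rewrite -(cvg_lim _ c)//.
apply: limr_ge; first by apply/cvg_ex; exists M.
exact: nearW.
Qed.

Section riesz_fischer.
Variables (I : countType) (e : I -> T -> R[i]) (c : I -> R[i]) (M : R).
Hypothesis he : forall i, sqint mu (e i).
Hypothesis oe : forall i j, ip mu (e i) (e j) = if i == j then 1%:C else 0.
Hypothesis cM : forall s : seq I, uniq s -> \sum_(i <- s) normc (c i) ^+ 2 <= M.

Let ind (m n : nat) : seq I := pmap (@pickle_inv I) (index_iota m n).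
Let S (n : nat) (x : T) : R[i] := \sum_(i <- ind 0 n) c i * e i x.
Let P (n : nat) : R := \sum_(i <- ind 0 n) normc (c i) ^+ 2.

Let uniq_ind m n : uniq (ind m n).
Proof. by apply: (pmap_uniq (@pickle_invK I)); exact: iota_uniq. Qed.

Let ind_cat m n : (m <= n)%N -> ind 0 n = ind 0 m ++ ind m n.
Proof.
move=> mn; rewrite /ind -pmap_cat; congr pmap.
by rewrite /index_iota !subn0 -{1}(subnKC mn) iotaD.
Qed.

Let hS n : sqint mu (S n). Proof. by apply: sqint_sum => i; exact: sqintZ. Qed.

Let nrm2_S n m : (m <= n)%N -> nrm2 mu (fun x => S n x - S m x) = P n - P m.
Proof.
move=> mn; have -> : (fun x => S n x - S m x) = (fun x => \sum_(i <- ind m n) c i * e i x).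
  by apply/funext => x; rewrite /S (ind_cat mn) big_cat/= addrAC subrr add0r.
by rewrite (nrm2_orthogonal_sum he oe)// mul1r /P (ind_cat mn) big_cat/= addrAC subrr add0r.
Qed.

(** Along the enumeration of [I] by codes, |S n - S m|^2 = P n - P m with [P] increasing and bounded
    by [M]. A subsequence is therefore Cauchy at the rate that [L2_real_complete] asks for, which is
    applied to the real and imaginary parts separately. *)
Lemma riesz_fischer : exists f, [/\ sqint mu f, nrm2 mu f <= M &
  forall i, ip mu f (e i) = c i].
Proof.
have ndP : {homo P : m n / (m <= n)%N >-> m <= n}.
  by move=> m n mn; rewrite -subr_ge0 -nrm2_S// nrm2_ge0.
have cP : cvgn P.
  by apply: nondecreasing_is_cvgn => //; exists M => _ [n _ <-]; exact: cM.
have Plim n : P n <= limn P by exact: nondecreasing_cvgn_le.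
have /choice[N hN] : forall j : nat, exists N : nat, limn P - P N <= (4^-1 : R) ^+ j.
  move=> j; have e0 : 0 < (4^-1 : R) ^+ j by rewrite exprn_gt0.
  have /cvgrPdist_le/(_ _ e0)[N _ hN] := cP.
  by exists N; apply: le_trans (hN N (leqnn _)); rewrite ler_norm.
(* Dominates [N j], dominates [j], and is nondecreasing. *)
pose K j := (j + \sum_(i < j.+1) N i)%N.
have NK j : (N j <= K j)%N by rewrite /K big_ord_recr/=; lia.
have jK j : (j <= K j)%N by rewrite /K leq_addr.
have ndK j i : (j <= i)%N -> (K j <= K i)%N.
  move=> ji; rewrite /K leq_add// -!(big_mkord xpredT N).
  by rewrite [leqRHS](big_cat_nat (n := j.+1))//= leq_addr.
have bF j i : (j <= i)%N -> nrm2 mu (fun x => S (K i) x - S (K j) x) <= (4^-1) ^+ j.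
  move=> ji; rewrite nrm2_S ?ndK//; apply: le_trans (hN j).
  by apply: lerB; [exact: Plim|exact: ndP].
have hB j i : sqint mu (fun x => S (K i) x - S (K j) x) by exact: sqintB.
have bound (p : R[i] -> R) : (forall z w, p (z - w) = p z - p w) ->
    (forall z, p z ^+ 2 <= normc z ^+ 2) -> (forall n, measurable_fun setT (fun x => p (S n x))) ->
    forall j i, (j <= i)%N -> (\int[mu]_x ((p (S (K i) x) - p (S (K j) x)) ^+ 2)%:E <= ((4^-1) ^+ j)%:E)%E.
  move=> pB pn mp j i ji; apply: (@le_trans _ _ (nrm2 mu (fun x => S (K i) x - S (K j) x))%:E); last first.
    by rewrite lee_fin bF.
  rewrite -nrm2E//; apply: ge0_le_integral => //.
  - by move=> x _; rewrite lee_fin sqr_ge0.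
  - by apply/measurable_EFinP/measurable_funX; exact: measurable_funB.
  - by apply/measurable_EFinP; apply: measurable_sqr_normc; case: (hB j i).
  - by move=> x _; rewrite lee_fin -pB.
have [fR mfR hfR] : exists2 fR : T -> R, measurable_fun setT fR & forall j,
    (\int[mu]_x ((fR x - ReC (S (K j) x)) ^+ 2)%:E <= ((4^-1) ^+ j)%:E)%E.
  apply: L2_real_complete => [j|]; first by have [[]] := hS (K j).
  apply: bound => [z w|z|n]; first by rewrite ReD ReN.
    by rewrite sqr_normcE lerDl sqr_ge0.
  by have [[]] := hS n.
have [fI mfI hfI] : exists2 fI : T -> R, measurable_fun setT fI & forall j,
    (\int[mu]_x ((fI x - ImC (S (K j) x)) ^+ 2)%:E <= ((4^-1) ^+ j)%:E)%E.
  apply: L2_real_complete => [j|]; first by have [[]] := hS (K j).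
  apply: bound => [z w|z|n]; first by rewrite ImD ImN.
    by rewrite sqr_normcE lerDr sqr_ge0.
  by have [[]] := hS n.
pose f x := fR x +i* fI x.
have mf : cmeasurable f by split.
have bf j : (\int[mu]_x (normc (f x - S (K j) x) ^+ 2)%:E <= (2 * (4^-1) ^+ j)%:E)%E.
  under eq_integral do rewrite sqr_normcE !(ReD, ImD, ReN, ImN)/= EFinD.
  rewrite ge0_integralD//; last 4 first.
  - by move=> x _; rewrite lee_fin sqr_ge0.
  - apply/measurable_EFinP/measurable_funX; apply: measurable_funB => //.
    by have [[]] := hS (K j).
  - by move=> x _; rewrite lee_fin sqr_ge0.
  - apply/measurable_EFinP/measurable_funX; apply: measurable_funB => //.
    by have [[]] := hS (K j).
  by rewrite mulrDl mul1r EFinD; apply: leeD; [exact: hfR|exact: hfI].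
have hfB j : sqint mu (fun x => f x - S (K j) x).
  split; last by apply: le_lt_trans (bf j) _; rewrite ltry.
  by apply: cmeasurableD => //; apply: cmeasurableN; case: (hS (K j)).
have nf j : nrm2 mu (fun x => f x - S (K j) x) <= 2 * (4^-1) ^+ j.
  by rewrite -lee_fin -nrm2E.
have fE j : f = (fun x => S (K j) x + (f x - S (K j) x)).
  by apply/funext => x; rewrite addrCA subrr addr0.
have hf : sqint mu f by rewrite (fE 0%N); exact: sqintD.
have quarter j : (4^-1 : R) ^+ j = (2^-1) ^+ j * (2^-1) ^+ j.
  by rewrite -exprMn; congr (_ ^+ _); field.
exists f; split => //.
(* With t = 2^-j the squared norm of the error is at most 2 t^2, so [nrm2D_le] gives (1 + t) M + 2 t
   (t + 1), which is at most M + (M + 4) t. *)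
- apply: (@ler_geometric_limit _ (M + 4)) => j; rewrite {1}(fE j).
  have t0 : 0 < (2^-1 : R) ^+ j by rewrite exprn_gt0.
  have t1 : (2^-1 : R) ^+ j <= 1 by apply: exprn_ile1; lra.
  apply: le_trans (nrm2D_le (hS _) (hfB j) t0) _.
  have n1 : nrm2 mu (S (K j)) <= M by rewrite (nrm2_orthogonal_sum he oe)// mul1r; exact: cM.
  have n2 := nf j; rewrite quarter in n2.
  have n3 := nrm2_ge0 mu (S (K j)).
  have -> : 1 + ((2^-1) ^+ j)^-1 = ((2^-1) ^+ j)^-1 * ((2^-1) ^+ j + 1) :> R.
    by rewrite mulrDr mulVf ?gt_eqF// mulr1.
  set t := (2^-1) ^+ j in t0 t1 n2 *.
  have h : t^-1 * (t + 1) * nrm2 mu (fun x => f x - S (K j) x) <= t^-1 * (t + 1) * (2 * (t * t)).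
    by apply: ler_wpM2l => //; rewrite mulr_ge0 ?invr_ge0 ?addr_ge0// ltW.
  have e1 : t^-1 * (t + 1) * (2 * (t * t)) = 2 * t * (t + 1) by field; rewrite gt_eqF.
  rewrite e1 in h; nra.
- move=> i; apply/eqP; rewrite -subr_eq0 -normc_eq0 -sqrf_eq0 eq_le sqr_ge0 andbT.
  apply: (@ler_geometric_limit _ 2) => j; rewrite add0r.
  (* The partial sum must contain the index i, and the error 2 * 4^-k must be at most 2 * 2^-j. *)
  pose k := (j + (pickle i).+1)%N.
  have ik : i \in ind 0 (K k).
    rewrite /ind mem_pmap; apply/mapP; exists (pickle i); last by rewrite pickleK_inv.
    by rewrite mem_index_iota/= (leq_trans _ (jK k))// /k; lia.
  rewrite (fE k) ipDl// (ip_orthogonal_sum he oe)// mulr1 addrAC subrr add0r.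
  apply: le_trans (cauchy_schwarz (hfB k) (he i)) _.
  have -> : nrm2 mu (e i) = 1 by apply: complexI; rewrite -ipff oe eqxx.
  rewrite mulr1; apply: le_trans (nf k) _.
  rewrite ler_pM2l// quarter /k exprD.
  have t1 m : (2^-1 : R) ^+ m <= 1 by apply: exprn_ile1; lra.
  have t0 m : 0 <= (2^-1 : R) ^+ m by rewrite exprn_ge0.
  rewrite -mulrA ler_piMr//; apply: mulr_ile1 => //.
  by apply: mulr_ile1.
Qed.
End riesz_fischer.
End completeness.

(** * Fubini's theorem for complex functions, and image measures *)

Section fubini_real_complex.
Local Open Scope ereal_scope.
Context {d1 d2} {T1 : measurableType d1} {T2 : measurableType d2} {R : realType}.
Variables (m1 : {sigma_finite_measure set T1 -> \bar R}).
Variables (m2 : {sigma_finite_measure set T2 -> \bar R}).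

(** An integrable function is finite almost everywhere, so truncating its infinite values changes
    nothing. This turns Fubini for extended-real inner integrals into Fubini for real ones. *)
Lemma fine_integral d (T : measurableType d) (m : {measure set T -> \bar R})
    (F : T -> \bar R) : m.-integrable setT F ->
  m.-integrable setT (EFin \o (fine \o F)) /\ (\int[m]_x fine (F x))%R = fine (\int[m]_x F x).
Proof.
move=> iF; have mF : measurable_fun setT F by exact: measurable_int iF.
have mfF : measurable_fun setT (EFin \o (fine \o F)).
  by apply/measurable_EFinP; apply: measurableT_comp => //; exact: measurable_fine.
split.
  apply: (le_integrable measurableT mfF _ iF) => x _ /=.
  by case: (F x) => [r| |] //=; rewrite normr0 ?leey.
rewrite /Rintegral; congr fine; apply: ae_eq_integral => //.
apply: filterS (integrable_ae measurableT iF) => x /(_ Logic.I) fx _ /=.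
by rewrite fineK.
Qed.

Lemma rfubini12 (h : T1 * T2 -> R) : (m1 \x m2).-integrable setT (EFin \o h) ->
  m1.-integrable setT (EFin \o (fun x => \int[m2]_y h (x, y))%R) /\
  (\int[m1]_x (\int[m2]_y h (x, y)) = \int[m1 \x m2]_z h z)%R.
Proof.
move=> ih; have [i1 e1] := fine_integral (integrable_fubini_F ih).
by split => //; rewrite /Rintegral -integral12_prod_meas1 -?e1.
Qed.

Lemma integrable_fubini_snd (f : T1 * T2 -> \bar R) :
  (m1 \x m2).-integrable setT f -> m2.-integrable setT (fun y => \int[m1]_x f (x, y)).
Proof.
move=> ih; have mf : measurable_fun setT f by exact: measurable_int ih.
apply/integrableP; split; first exact: (measurable_fubini_G ih).
apply: le_lt_trans ((integrable21ltyP m1 m2 mf).1 ih); apply: ge0_le_integral => //.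
- by apply: measurableT_comp => //; exact: (measurable_fubini_G ih).
- apply: (@measurable_fun_fubini_tonelli_G _ _ _ _ _ m1 (abse \o f)) => //=.
  by apply: measurableT_comp.
- move=> y _; apply: le_abse_integral => //.
  by apply: measurableT_comp => //; exact: measurable_pair2.
Qed.

Lemma rfubini21 (h : T1 * T2 -> R) : (m1 \x m2).-integrable setT (EFin \o h) ->
  m2.-integrable setT (EFin \o (fun y => \int[m1]_x h (x, y))%R) /\
  (\int[m2]_y (\int[m1]_x h (x, y)) = \int[m1 \x m2]_z h z)%R.
Proof.
move=> ih; have [i1 e1] := fine_integral (integrable_fubini_snd ih).
by split => //; rewrite /Rintegral -integral21_prod_meas1 -?e1.
Qed.

Lemma cfubini12 (f : T1 * T2 -> R[i]) : cintegrable (m1 \x m2) f ->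
  cintegrable m1 (fun x => cintegral m2 (fun y => f (x, y))) /\
  cintegral m1 (fun x => cintegral m2 (fun y => f (x, y))) = cintegral (m1 \x m2) f.
Proof.
move=> [/rfubini12[iR eR] /rfubini12[iI eI]]; split; first by split.
by rewrite /cintegral/= eR eI.
Qed.

Lemma cfubini21 (f : T1 * T2 -> R[i]) : cintegrable (m1 \x m2) f ->
  cintegrable m2 (fun y => cintegral m1 (fun x => f (x, y))) /\
  cintegral m2 (fun y => cintegral m1 (fun x => f (x, y))) = cintegral (m1 \x m2) f.
Proof.
move=> [/rfubini21[iR eR] /rfubini21[iI eI]]; split; first by split.
by rewrite /cintegral/= eR eI.
Qed.

Lemma cmeasurable_fst (f : T1 -> R[i]) : cmeasurable f -> cmeasurable (fun z : T1 * T2 => f z.1).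
Proof. by apply: cmeasurable_comp; exact: measurable_fst. Qed.

Lemma cmeasurable_snd (f : T2 -> R[i]) : cmeasurable f -> cmeasurable (fun z : T1 * T2 => f z.2).
Proof. by apply: cmeasurable_comp; exact: measurable_snd. Qed.

Lemma cmeasurable_section1 (f : T1 * T2 -> R[i]) x : cmeasurable f ->
  cmeasurable (fun y => f (x, y)).
Proof. by apply: cmeasurable_comp; exact: measurable_pair1. Qed.

Lemma cmeasurable_section2 (f : T1 * T2 -> R[i]) y : cmeasurable f ->
  cmeasurable (fun x => f (x, y)).
Proof. by apply: cmeasurable_comp; exact: measurable_pair2. Qed.

Lemma cintegrableX (f : T1 -> R[i]) (g : T2 -> R[i]) :
  cintegrable m1 f -> cintegrable m2 g ->
  cintegrable (m1 \x m2) (fun z => f z.1 * g z.2)%R.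
Proof.
move=> /cintegrableP[mf lf] /cintegrableP[mg lg]; apply/cintegrableP.
have mfg : cmeasurable (fun z : T1 * T2 => f z.1 * g z.2)%R.
  by apply: cmeasurableM; [exact: cmeasurable_fst|exact: cmeasurable_snd].
split => //; rewrite fubini_tonelli1//; last 2 first.
- by apply/measurable_EFinP; exact: measurable_normc.
- by move=> x; rewrite lee_fin normc_ge0.
rewrite /fubini_F.
have -> : (fun x => \int[m2]_y (normc (f (x, y).1 * g (x, y).2)%R)%:E) =
    (fun x => (normc (f x))%:E * \int[m2]_y (normc (g y))%:E).
  apply/funext => x; rewrite -ge0_integralZl//.
  - by apply: eq_integral => y _; rewrite normc_M EFinM.
  - by apply/measurable_EFinP; exact: measurable_normc.
  - by move=> y _; rewrite lee_fin normc_ge0.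
  - by rewrite lee_fin normc_ge0.
rewrite ge0_integralZr//.
- by apply: lte_mul_pinfty => //; [apply: integral_ge0 => x _; rewrite lee_fin normc_ge0|
   rewrite ge0_fin_numE//; apply: integral_ge0 => x _; rewrite lee_fin normc_ge0].
- by apply/measurable_EFinP; exact: measurable_normc.
- by move=> x _; rewrite lee_fin normc_ge0.
- by apply: integral_ge0 => x _; rewrite lee_fin normc_ge0.
Qed.

Lemma cintegralX (f : T1 -> R[i]) (g : T2 -> R[i]) :
  cintegrable m1 f -> cintegrable m2 g ->
  (cintegral (m1 \x m2) (fun z => f z.1 * g z.2) = cintegral m1 f * cintegral m2 g)%R.
Proof.
move=> hf hg; have [_ <-] := cfubini12 (cintegrableX hf hg).
rewrite mulrC -cintegralZ//; apply: eq_cintegral => x.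
by rewrite mulrC -cintegralZ.
Qed.

End fubini_real_complex.

Section pushforward.
Context {d d'} {T : measurableType d} {T' : measurableType d'} {R : realType}.
Variables (P : probability T R) (X : {RV P >-> T'}).

Lemma cintegrable_distribution (f : T' -> R[i]) : cmeasurable f ->
  cintegrable P (f \o X) -> cintegrable (distribution P X) f.
Proof.
move=> mf /cintegrableP[_ lf]; apply/cintegrableP; split => //.
rewrite ge0_integral_distribution//; last by move=> y; rewrite lee_fin normc_ge0.
by apply/measurable_EFinP; exact: measurable_normc.
Qed.

Lemma cintegrable_distributionP (f : T' -> R[i]) : cintegrable (distribution P X) f ->
  cintegrable P (f \o X).
Proof.
move=> /cintegrableP[mf lf]; apply/cintegrableP; split.
  by apply: cmeasurable_comp.
rewrite ge0_integral_distribution// in lf; last by move=> y; rewrite lee_fin normc_ge0.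
by apply/measurable_EFinP; exact: measurable_normc.
Qed.

Lemma cintegral_distribution (f : T' -> R[i]) : cintegrable (distribution P X) f ->
  cintegral (distribution P X) f = cintegral P (f \o X).
Proof.
move=> hf; have [iR iI] := cintegrable_distributionP hf.
have [mR mI] := cintegrable_meas hf.
rewrite /cintegral /Rintegral; congr (fine _ +i* fine _).
- by rewrite integral_distribution//; exact/measurable_EFinP.
- by rewrite integral_distribution//; exact/measurable_EFinP.
Qed.

Lemma cintegrable_bounded (f : T -> R[i]) (B : R) : cmeasurable f ->
  (forall x, normc (f x) <= B) -> cintegrable P f.
Proof.
move=> mf fB; apply: (@cintegrable_le _ _ _ P f (fun=> B)) => //.
exact: finite_measure_integrable_cst.
Qed.

Lemma cintegral_cst_prob (c : R[i]) : cintegral P (fun=> c) = c.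
Proof.
rewrite /cintegral /Rintegral !integral_cst//.
have P1 (x : \bar R) : (x * P [set: T] = x)%E.
  by rewrite -[RHS]mule1; congr (_ * _)%E; exact: probability_setT.
by rewrite !P1; case: c.
Qed.
End pushforward.

(** * Exponentials on the circle *)

Section circle.
Context {R : realType}.

Definition unif : probability (measurableTypeR R) R := uniform_prob (@ltr01 R).

Lemma cisD (a b : R) : cis (a + b) = cis a * cis b.
Proof. by rewrite /cis mulrDr cosD sinD; apply: ReImP => /=; ring. Qed.

Lemma cis0 : cis (0 : R) = 1.
Proof. by rewrite /cis mulr0 cos0 sin0. Qed.

Lemma cisN (a : R) : cis (- a) = conjc (cis a).
Proof. by rewrite /cis mulrN cosN sinN. Qed.

Lemma normc_cis (a : R) : normc (cis a) = 1.
Proof. by rewrite /cis /= cos2Dsin2 sqrtr1. Qed.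

Lemma cis_nat (k : nat) : cis (k%:R : R) = 1.
Proof.
elim: k => [|k IH]; first by rewrite cis0.
rewrite -natr1 cisD IH mul1r /cis mulr1 mulrC mulr_natr.
by rewrite cos2pi sin2pi.
Qed.

Lemma cis_int (z : int) : cis (z%:~R : R) = 1.
Proof.
case: z => k; first by rewrite -pmulrn cis_nat.
by rewrite NegzE rmorphN/= -pmulrn cisN cis_nat conjc1.
Qed.

Lemma continuous_cis_Re (a : R) : continuous (fun t : R => ReC (cis (a * t))).
Proof.
move=> t; rewrite /cis /=; apply: continuous_comp; last exact: continuous_cos.
by apply: cvgM; [exact: cvg_cst|]; apply: cvgM; [exact: cvg_cst|exact: cvg_id].
Qed.

Lemma continuous_cis_Im (a : R) : continuous (fun t : R => ImC (cis (a * t))).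
Proof.
move=> t; rewrite /cis /=; apply: continuous_comp; last exact: continuous_sin.
by apply: cvgM; [exact: cvg_cst|]; apply: cvgM; [exact: cvg_cst|exact: cvg_id].
Qed.

Lemma measurable_cis_mul (a : R) :
  cmeasurable (fun t : measurableTypeR R => cis (a * t)).
Proof.
split; apply: continuous_measurable_fun; [exact: continuous_cis_Re|exact: continuous_cis_Im].
Qed.

Lemma integrable_unif (h : R -> R) : measurable_fun setT (h : measurableTypeR R -> R) ->
  (\int[unif]_x `|h x|%:E < +oo)%E <-> (\int[lebesgue_measure]_(x in `[0%R, 1%R]) `|h x|%:E < +oo)%E.
Proof.
move=> mh; rewrite integral_uniform//; first by rewrite subr0 invr1 mul1e.
by apply/measurable_EFinP; exact: measurableT_comp.
Qed.

Lemma Rintegral_unif (h : R -> R) : measurable_fun setT (h : measurableTypeR R -> R) ->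
  \int[unif]_x h x = \int[lebesgue_measure]_(x in `[0%R, 1%R]) h x.
Proof.
move=> mh; rewrite /Rintegral integralE [in RHS]integralE.
have mE : measurable_fun setT (EFin \o h) by exact/measurable_EFinP.
rewrite !integral_uniform//.
- by rewrite subr0 invr1 !mul1e.
- exact: measurable_funeneg.
- exact: measurable_funepos.
Qed.

(** The fundamental theorem of calculus on [0, 1]. It yields both the orthogonality of the
    characters and integration by parts on the torus. *)
Lemma Rintegral_deriv_periodic (F f : R -> R) : continuous f ->
  (forall t, is_derive t (1 : R) F (f t)) -> F 0 = F 1 ->
  \int[unif]_t f t = 0.
Proof.
move=> cf dF F01; rewrite Rintegral_unif; last exact: continuous_measurable_fun.
rewrite /Rintegral (@continuous_FTC2 _ f F)//.
- by rewrite F01 subee.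
- exact: continuous_subspaceT.
- split.
  + by move=> x _; have [] := dF x.
  + apply: cvg_at_right_filter.
    by have [h _] := dF 0; apply: differentiable_continuous; exact/derivable1_diffP.
  + apply: cvg_at_left_filter.
    by have [h _] := dF 1; apply: differentiable_continuous; exact/derivable1_diffP.
- by move=> x _; rewrite derive1E; have [_ ->] := dF x.
Qed.

Lemma cintegral_cis (z : int) :
  cintegral unif (fun t : measurableTypeR R => cis (z%:~R * t)) = if z == 0 then 1 else 0.
Proof.
case: eqVneq => [->|z0].
  under eq_fun do rewrite mul0r cis0.
  exact: cintegral_cst_prob.
have zR : z%:~R != 0 :> R by rewrite intr_eq0.
have := mulf_neq0 (mulf_neq0 (lt0r_neq0 (@ltr0n R 2)) (lt0r_neq0 (pi_gt0 R))) zR.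
have eR t : ReC (cis (z%:~R * t)) = cos ((2 * pi * z%:~R) * t) :> R by rewrite /cis/= !mulrA.
have eI t : ImC (cis (z%:~R * t)) = sin ((2 * pi * z%:~R) * t) :> R by rewrite /cis/= !mulrA.
have : cos (2 * pi * z%:~R) = 1 :> R by have [] := cis_int z.
have : sin (2 * pi * z%:~R) = 0 :> R by have [] := cis_int z.
have cR : continuous (fun t : R => cos ((2 * pi * z%:~R) * t)).
  by under eq_fun do rewrite -eR; exact: continuous_cis_Re.
have cI : continuous (fun t : R => sin ((2 * pi * z%:~R) * t)).
  by under eq_fun do rewrite -eI; exact: continuous_cis_Im.
rewrite /cintegral; under eq_Rintegral do rewrite eR.
under [X in _ +i* X]eq_Rintegral do rewrite eI.
move: (2 * pi * z%:~R) cR cI => a cR cI sa ca a0; congr (_ +i* _).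
- apply: (@Rintegral_deriv_periodic (fun t => a^-1 * sin (a * t))) => //.
  + by move=> t; apply: is_derive_eq; rewrite /GRing.scale/=; field.
  + by rewrite !mulr0 mulr1 sin0 sa mulr0.
- apply: (@Rintegral_deriv_periodic (fun t => - a^-1 * cos (a * t))) => //.
  + by move=> t; apply: is_derive_eq; rewrite /GRing.scale/=; field.
  + by rewrite !mulr0 mulr1 cos0 ca.
Qed.

End circle.

(** * Characters of the torus *)

Section measurability.
Context {R : realType}.

Lemma measurable_countable_codomain d (T : measurableType d) (n : nat) (r : T -> Zn n) :
  (forall k, measurable (r @^-1` [set k])) -> measurable_fun setT r.
Proof.
move=> mr _ A _; rewrite setTI.
have -> : r @^-1` A = \bigcup_(i in [set: nat])
    (if unpickle i is Some k then (if k \in A then r @^-1` [set k] else set0) else set0).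
  apply/seteqP; split => [x Ax|x [i _]].
    by exists (pickle (r x)) => //; rewrite pickleK mem_set.
  by case: unpickle => // k; case: ifPn => // /set_mem Ak /= ->.
apply: bigcupT_measurable => i; case: unpickle => // k.
by case: ifP.
Qed.

(** The preimage is a union, over the countably many points of [Zn n], of measurable rectangles. *)
Lemma measurable_Zn_prod d d' (T : measurableType d) (T' : measurableType d') (n : nat)
  (f : Zn n * T -> T') : (forall m, measurable_fun setT (fun x => f (m, x))) ->
  measurable_fun setT f.
Proof.
move=> mf _ Y mY; rewrite setTI.
have -> : f @^-1` Y = \bigcup_(i in [set: nat])
    (if unpickle i is Some k then [set k] `*` ((fun x => f (k, x)) @^-1` Y) else set0).
  apply/seteqP; split => [[m x] Yx|x [i _]].
    by exists (pickle m) => //; rewrite pickleK.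
  by case: unpickle => // k; case: x => m x [/= -> ].
apply: bigcupT_measurable => i; case: unpickle => // k.
by apply: measurableX => //; rewrite -[X in measurable X]setTI; exact: mf.
Qed.

Lemma cmeasurable_Zn_prod d (T : measurableType d) (n : nat) (f : Zn n * T -> R[i]) :
  (forall m, cmeasurable (fun x => f (m, x))) -> cmeasurable f.
Proof. by move=> mf; split; apply: measurable_Zn_prod => m; case: (mf m). Qed.

Lemma cmeasurable_Zn (n : nat) (f : Zn n -> R[i]) : cmeasurable f.
Proof. by []. Qed.

Lemma measurable_coord (n : nat) (i : 'I_n) :
  measurable_fun setT (fun v : 'rV[R]_n => v ord0 i : measurableTypeR R).
Proof.
move=> _ Y mY; rewrite setTI; apply: sub_sigma_algebra => /=.
rewrite -bigcup_seq/=; exists i => /=; first by rewrite mem_index_enum.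
by exists Y => //; rewrite setTI.
Qed.

(** The sigma-algebra on row vectors is generated by the coordinates, not by the open sets. Rounding
    down to the grid of mesh 1/(N+1) is measurable with countably many values, and f is the
    pointwise limit of its compositions with these roundings. *)
Lemma continuous_measurable_rV (n : nat) (f : 'rV[R]_n -> R) : continuous f ->
  measurable_fun setT f.
Proof.
move=> cf.
pose r (N : nat) (x : 'rV[R]_n) : Zn n := \row_i Num.floor (N.+1%:R * x ord0 i).
pose q (N : nat) (k : Zn n) : 'rV[R]_n := \row_i ((k ord0 i)%:~R / N.+1%:R).
have mr N : measurable_fun setT (r N).
  apply: measurable_countable_codomain => k.
  have -> : r N @^-1` [set k] = \bigcap_(i : 'I_n)
      ((fun v : 'rV[R]_n => N.+1%:R * v ord0 i) @^-1` `[(k ord0 i)%:~R, (k ord0 i + 1)%:~R[%classic).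
    apply/seteqP; split => x /=.
      move=> <- i _ /=; rewrite in_itv/= mxE.
      by rewrite Num.Theory.floor_le Num.Theory.floorD1_gt.
    move=> h; apply/rowP => i; rewrite mxE; have := h i I; rewrite /= in_itv/= => hi.
    exact: Num.Theory.floor_def.
  apply: fin_bigcap_measurable => // i _.
  rewrite -[X in measurable X]setTI.
  have h : measurable_fun setT (fun v : 'rV[R]_n => N.+1%:R * v ord0 i : measurableTypeR R).
    by apply: measurable_funM => //; exact: measurable_coord.
  by apply: h => //; exact: measurable_itv.
apply: (@measurable_fun_cvg _ _ _ _ (fun N => f \o q N \o r N)).
  by move=> N; apply: (measurableT_comp _ (mr N)).
move=> x _.
have cq : (fun N => q N (r N x)) @ \oo --> x.
  apply/cvg_ballP => e e0; near=> N.
  split => // i j; rewrite ord1 /ball/= !mxE.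
  have N0 : 0 < N.+1%:R :> R by [].
  have : (N.+1%:R)^-1 < e by near: N; exact: (near_infty_natSinv_lt (PosNum e0)).
  apply: le_lt_trans; rewrite ger0_norm.
    rewrite -(ler_pM2l N0) mulrBr [_ * (_ / _)]mulrC divfK ?gt_eqF// mulfV ?gt_eqF//.
    have := Num.Theory.floorD1_gt (N.+1%:R * x ord0 j); rewrite intrD; lra.
  rewrite subr_ge0 ler_pdivrMr// mulrC; exact: Num.Theory.floor_le.
by apply: (cvg_comp _ _ cq); exact: cf.
Unshelve. all: by end_near. Qed.

Lemma cmeasurable_continuous (n : nat) (f : 'rV[R]_n -> R[i]) :
  continuous (fun x => ReC (f x)) -> continuous (fun x => ImC (f x)) -> cmeasurable f.
Proof. by move=> cR cI; split; exact: continuous_measurable_rV. Qed.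

End measurability.

Section haar_integral.
Context {R : realType}.
Local Notation unif := (@unif R).

Lemma cintegrable_haarS n (f : 'rV[R]_n.+1 -> R[i]) :
  cintegrable (haar R n.+1) f <->
  cmeasurable f /\ cintegrable (unif \x haar R n)%E (fun p => f (rV_cons p)).
Proof.
split => [h|[mf h]].
  split; first exact: cintegrable_meas h.
  exact: (cintegrable_distributionP h).
exact: (cintegrable_distribution mf).
Qed.

Lemma cintegral_haarS n (f : 'rV[R]_n.+1 -> R[i]) : cintegrable (haar R n.+1) f ->
  cintegral (haar R n.+1) f = cintegral (unif \x haar R n)%E (fun p => f (rV_cons p)).
Proof. exact: cintegral_distribution. Qed.

Lemma rV_cons0 n (p : R * 'rV[R]_n) : rV_cons p ord0 ord0 = p.1.
Proof. by rewrite mxE unlift_none. Qed.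

Lemma rV_consS n (p : R * 'rV[R]_n) j : rV_cons p ord0 (lift ord0 j) = p.2 ord0 j.
Proof. by rewrite mxE liftK. Qed.

Lemma cmeasurable_prod (I : Type) d (T : measurableType d) (s : seq I) (F : I -> T -> R[i]) :
  (forall i, cmeasurable (F i)) -> cmeasurable (fun x => \prod_(i <- s) F i x).
Proof.
move=> mF; elim: s => [|i s IH].
  by under eq_fun do rewrite big_nil; exact: cmeasurable_cst.
by under eq_fun do rewrite big_cons; exact: cmeasurableM.
Qed.

(** Induction on the dimension, splitting off the first coordinate as in the definition of
    [haar]. *)
Lemma haar_prod n (phi : 'I_n -> measurableTypeR R -> R[i]) :
  (forall i, cintegrable unif (phi i)) ->
  cintegrable (haar R n) (fun v => \prod_(i < n) phi i (v ord0 i)) /\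
  cintegral (haar R n) (fun v => \prod_(i < n) phi i (v ord0 i)) =
    \prod_(i < n) cintegral unif (phi i).
Proof.
elim: n phi => [|n IH] phi hphi.
  split.
    by under eq_fun do rewrite big_ord0; apply: (@cintegrable_bounded _ _ _ _ _ 1) => [|x];
      [exact: cmeasurable_cst|rewrite /= expr0n addr0 expr1n sqrtr1].
  under [X in cintegral _ X]eq_fun do rewrite big_ord0.
  by rewrite cintegral_cst_prob big_ord0.
have [IH1 IH2] := IH (fun i => phi (lift ord0 i)) (fun i => hphi _).
have mphi : cmeasurable (fun v : 'rV[R]_n.+1 => \prod_(i < n.+1) phi i (v ord0 i)).
  apply: cmeasurable_prod => i.
  apply: (@cmeasurable_comp _ _ _ _ _ (fun v : 'rV[R]_n.+1 => v ord0 i) (phi i)).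
    exact: measurable_coord.
  exact: cintegrable_meas (hphi i).
have E (p : measurableTypeR R * 'rV[R]_n) :
    \prod_(i < n.+1) phi i (rV_cons p ord0 i) =
    phi ord0 p.1 * \prod_(i < n) phi (lift ord0 i) (p.2 ord0 i).
  by rewrite big_ord_recl rV_cons0; congr (_ * _); apply: eq_bigr => i _; rewrite rV_consS.
have i1 : cintegrable (haar R n.+1) (fun v => \prod_(i < n.+1) phi i (v ord0 i)).
  apply/cintegrable_haarS; split => //; under eq_fun do rewrite E.
  exact: (@cintegrableX _ _ _ _ _ unif (haar R n) (phi ord0) _ (hphi ord0) IH1).
split => //; rewrite cintegral_haarS//.
under [X in cintegral _ X]eq_fun do rewrite E.
rewrite (@cintegralX _ _ _ _ _ unif (haar R n) (phi ord0) _ (hphi ord0) IH1).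
by rewrite IH2 big_ord_recl.
Qed.

End haar_integral.

Section characters.
Context {R : realType} {n : nat}.
Implicit Types (k l : Zn n) (w : 'rV[R]_n).

Definition chr k w : R[i] := cis (dot k w).

Lemma dotDl k l w : dot (k + l) w = dot k w + dot l w.
Proof.
by rewrite /dot -big_split/=; apply: eq_bigr => i _; rewrite mxE intrD mulrDl.
Qed.

Lemma dotNl k w : dot (- k) w = - dot k w.
Proof.
by rewrite /dot -sumrN; apply: eq_bigr => i _; rewrite mxE intrN mulNr.
Qed.

Lemma dot0l w : dot 0 w = 0.
Proof. by rewrite /dot big1// => i _; rewrite mxE mul0r. Qed.

Lemma dotDr k w w' : dot k (w + w') = dot k w + dot k w'.
Proof.
by rewrite /dot -big_split/=; apply: eq_bigr => i _; rewrite mxE mulrDr.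
Qed.

Lemma dotNr k w : dot k (- w) = - dot k w.
Proof.
by rewrite /dot -sumrN; apply: eq_bigr => i _; rewrite mxE mulrN.
Qed.

Lemma dot_delta k (i : 'I_n) : dot k (delta_mx 0 i : 'rV[R]_n) = (k ord0 i)%:~R.
Proof.
rewrite /dot (bigD1 i)//= mxE !eqxx mulr1 big1 ?addr0// => j ji.
by rewrite mxE (negbTE ji) andbF mulr0.
Qed.

Lemma chrD k l w : chr (k + l) w = chr k w * chr l w.
Proof. by rewrite /chr dotDl cisD. Qed.

Lemma chrN k w : chr (- k) w = conjc (chr k w).
Proof. by rewrite /chr dotNl cisN. Qed.

Lemma chrDr k w w' : chr k (w + w') = chr k w * chr k w'.
Proof. by rewrite /chr dotDr cisD. Qed.

Lemma chrNr k w : chr k (- w) = conjc (chr k w).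
Proof. by rewrite /chr dotNr cisN. Qed.

Lemma normc_chr k w : normc (chr k w) = 1.
Proof. exact: normc_cis. Qed.

Lemma chr_prod k w : chr k w = \prod_(i < n) cis ((k ord0 i)%:~R * w ord0 i).
Proof.
rewrite /chr /dot; elim/big_rec2 : _ => [|i y x _ <-]; first exact: cis0.
by rewrite cisD.
Qed.

Lemma cintegrable_cis (z : int) :
  cintegrable (@unif R) (fun t : measurableTypeR R => cis (z%:~R * t)).
Proof.
apply: (@cintegrable_bounded _ _ _ _ _ 1); first exact: measurable_cis_mul.
by move=> x; rewrite normc_cis.
Qed.

Lemma cintegrable_chr k : cintegrable (haar R n) (chr k).
Proof.
have [h _] := @haar_prod R n (fun i t => cis ((k ord0 i)%:~R * t)) (fun i => cintegrable_cis _).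
by rewrite (_ : chr k = (fun v => \prod_(i < n) cis ((k ord0 i)%:~R * v ord0 i)))//; apply/funext => w; rewrite chr_prod.
Qed.

Lemma measurable_chr k : cmeasurable (chr k : 'rV[R]_n -> R[i]).
Proof. exact: cintegrable_meas (cintegrable_chr k). Qed.

Lemma cintegral_chr k : cintegral (haar R n) (chr k) = if k == 0 then 1 else 0.
Proof.
have [_] := @haar_prod R n (fun i t => cis ((k ord0 i)%:~R * t)) (fun i => cintegrable_cis _).
under [X in cintegral _ X = _ -> _]eq_fun do rewrite -chr_prod.
move=> ->; under eq_bigr do rewrite cintegral_cis.
case: eqVneq => [->|k0]; first by rewrite big1// => i _; rewrite mxE eqxx.
have [i ki] : exists i, k ord0 i != 0.
  apply/existsP; apply: contraNT k0 => /existsPn h; apply/eqP/rowP => i.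
  by rewrite mxE; apply/eqP; rewrite -[_ == _]negbK; exact: h.
by rewrite (bigD1 i)//= (negbTE ki) mul0r.
Qed.

Lemma chr_orthonormal k l :
  ip (haar R n) (chr k) (chr l) = if k == l then 1%:C else 0.
Proof.
rewrite /ip; under eq_fun do rewrite -chrN -chrD.
by rewrite cintegral_chr subr_eq0.
Qed.

Lemma sqint_bounded d (T : measurableType d) (P : probability T R) (f : T -> R[i]) (B : R) :
  cmeasurable f -> (forall x, normc (f x) <= B) -> sqint P f.
Proof.
move=> mf fB; apply: (@sqint_le _ _ _ P f (fun=> B ^+ 2)) => //.
  exact: finite_measure_integrable_cst.
by move=> x; rewrite ler_pXn2r ?nnegrE ?normc_ge0// (le_trans _ (fB x)) ?normc_ge0.
Qed.

Lemma sqint_chr k : sqint (haar R n) (chr k).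
Proof. by apply: (@sqint_bounded _ _ _ _ 1); [exact: measurable_chr|move=> x; rewrite normc_chr]. Qed.

End characters.

(** * Fejer means *)

Lemma realc_prod (R : rcfType) (I : Type) (s : seq I) (P : pred I) (F : I -> R) :
  (\prod_(i <- s | P i) F i)%:C = \prod_(i <- s | P i) (F i)%:C.
Proof. exact: (rmorph_prod (real_complex R)). Qed.

Section chord.
Context {R : realType}.
Implicit Types (y t : R).

(** For y > 1/4, sin(pi y) >= sin(pi/4) >= 1/2. For y <= 1/4, the mean value theorem gives sin(pi y)
    = cos(c) pi y with cos(c) >= cos(pi/4) >= 1/2 and pi >= 2. *)
Lemma sin_ge y : 0 <= y <= 2^-1 -> y <= 2 * sin (pi * y).
Proof.
move=> /andP[y0 y2]; have pi0 : 0 < pi :> R := pi_gt0 R.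
have pi2 : 2 <= pi :> R := pi_ge2 R.
have c2 : cos (pi / 4) ^+ 2 = 2^-1 :> R.
  have := @cos_mulr2n R (pi / 4).
  rewrite (_ : pi / 4 *+ 2 = pi / 2); last by field.
  rewrite cos_pihalf; lra.
have cq : 2^-1 <= cos (pi / 4) :> R.
  rewrite -(ler_pXn2r (ltn0Sn 1)) ?nnegrE ?c2//; last by apply: cos_ge0_pihalf; lra.
  by lra.
have sq : 2^-1 <= sin (pi / 4) :> R.
  rewrite -(ler_pXn2r (ltn0Sn 1)) ?nnegrE ?sin2cos2 ?c2//; last by apply: sin_ge0_pi; lra.
  by lra.
have [y4|y4] := leP y (4^-1); last first.
  have : sin (pi / 4) <= sin (pi * y) :> R.
    by apply: ltW; rewrite ltr_sin// ?in_itv/=; nra.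
  lra.
have [->|yn0] := eqVneq y 0; first by rewrite !mulr0 sin0 mulr0.
have yp : 0 < y by rewrite lt_neqAle eq_sym yn0.
have p0 : 0 < pi * y by rewrite mulr_gt0.
have [c /=] := @MVT R sin cos 0 (pi * y) p0 (fun x _ => is_derive_sin x)
  (continuous_subspaceT (@continuous_sin R)).
rewrite in_itv/= sin0 !subr0 => /andP[c0 cy] ->.
have : cos (pi / 4) <= cos c.
  have : c <= pi / 4 by nra.
  rewrite le_eqVlt => /predU1P[->//|c4].
  by apply: ltW; rewrite ltr_cos// in_itv/=; lra.
nra.
Qed.

Lemma normc_1Bcis t : normc (1 - cis t) ^+ 2 = (2 * sin (pi * t)) ^+ 2.
Proof.
rewrite sqr_normcE ReD ImD ReN ImN /cis/=.
rewrite (_ : 2 * pi * t = pi * t *+ 2); last by ring.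
rewrite cos_mulr2n sin_mulr2n; have := cos2Dsin2 (pi * t).
move: (cos _) (sin _) => c s h.
have -> : c ^+ 2 = 1 - s ^+ 2 by rewrite -h; ring.
have h2 : c ^+ 2 = 1 - s ^+ 2 by rewrite -h; ring.
have -> : (0 - (c * s) *+ 2) ^+ 2 = 4 * c ^+ 2 * s ^+ 2 by ring.
rewrite h2; ring.
Qed.

Lemma normc_1BcisE t : normc (1 - cis t) = 2 * `|sin (pi * t)|.
Proof.
apply/eqP; rewrite -(eqrXn2 (ltn0Sn 1)) ?normc_ge0 ?mulr_ge0// normc_1Bcis.
by rewrite !exprMn real_normK ?num_real.
Qed.

Lemma sin_abs_ge y : `|y| <= 2^-1 -> `|y| <= 2 * `|sin (pi * y)|.
Proof.
wlog y0 : y / 0 <= y => [hw|].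
  have [|y0] := leP 0 y; first exact: hw.
  by move=> y2; have := hw (- y); rewrite mulrN sinN !normrN oppr_ge0 (ltW y0) => ->.
rewrite ger0_norm// => y2; have := @sin_ge y; rewrite y0 y2 => /(_ isT).
by move=> /le_trans; apply; rewrite ler_pM2l// ler_norm.
Qed.

(** The chord serves as distance on R / Z: it dominates the distance to the nearest integer, and its
    square can be integrated explicitly against the Fejer kernel. *)
Lemma dist_chord t : exists z : int, `|t - z%:~R| <= normc (1 - cis t).
Proof.
pose z := Num.floor (t + 2^-1); exists z.
have h1 := Num.Theory.floor_le (t + 2^-1); have := Num.Theory.floorD1_gt (t + 2^-1).
rewrite -/z in h1 *; rewrite intrD1 => h2.
set y := t - z%:~R.
have -> : cis t = cis y.
  by rewrite -[t](subrK (z%:~R)) cisD cis_int mulr1.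
rewrite normc_1BcisE; apply: sin_abs_ge; rewrite ler_norml /y; lra.
Qed.

End chord.

Section fejer_kernel.
Context {R : realType}.
Variable N : nat.
Local Notation unif := (@unif R).
Local Notation n1 := (N.+1%:R : R).

(** The one-sided exponential sum. Its squared modulus over N+1 is the Fejer kernel, so that
    positivity is immediate. *)
Definition dirichlet (t : R) : R[i] := \sum_(j < N.+1) cis (j%:R * t).

Definition fejer (t : R) : R := normc (dirichlet t) ^+ 2 / n1.

Lemma fejer_ge0 t : 0 <= fejer t.
Proof. by rewrite mulr_ge0 ?sqr_ge0// invr_ge0. Qed.

Lemma fejerE t : (fejer t)%:C =
  (n1^-1)%:C * \sum_(p : 'I_N.+1 * 'I_N.+1) cis ((p.1%:Z - p.2%:Z)%:~R * t).
Proof.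
rewrite /fejer mulrC realcM -mulcJ; congr (_ * _).
rewrite /dirichlet conjc_sum big_distrl/= -(pair_big xpredT xpredT
  (fun i j : 'I_N.+1 => cis ((i%:Z - j%:Z)%:~R * t)))/=.
apply: eq_bigr => i _; rewrite big_distrr/=; apply: eq_bigr => j _.
by rewrite -[X in _ * X]/(conjc (cis (j%:R * t))) -cisN -cisD intrB mulrBl.
Qed.

Lemma dirichlet_telescope t : normc (1 - cis t) * normc (dirichlet t) <= 2.
Proof.
rewrite -normc_M; have -> : (1 - cis t) * dirichlet t = 1 - cis (n1 * t).
  rewrite /dirichlet; elim: (N.+1) => [|k IH].
    by rewrite big_ord0 mulr0 mul0r cis0 subrr.
  rewrite big_ord_recr/= mulrDr IH -[in RHS]natr1 [in RHS]mulrDl mul1r cisD; ring.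
apply: le_trans (normc_D _ _) _; rewrite normc_N normc_cis /= expr0n addr0 expr1n sqrtr1.
by [].
Qed.

(** The geometric sum telescopes to 1 - e^{2 pi i (N+1) t}, of modulus at most 2. This is the form
    in which the concentration of the kernel at the integers is used. *)
Lemma fejer_chord t : normc (1 - cis t) ^+ 2 * fejer t <= 4 / n1.
Proof.
rewrite /fejer mulrA ler_wpM2r ?invr_ge0// -exprMn.
rewrite (_ : 4 = 2 ^+ 2); last by rewrite expr2; lra.
rewrite ler_pXn2r ?nnegrE ?mulr_ge0 ?normc_ge0//; exact: dirichlet_telescope.
Qed.

Lemma fejer_le t : fejer t <= n1.
Proof.
rewrite /fejer ler_pdivrMr// -expr2 ler_pXn2r ?nnegrE ?normc_ge0//.
apply: le_trans (le_normc_sum _ _) _.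
by under eq_bigr do rewrite normc_cis; rewrite sumr_const card_ord.
Qed.

Lemma measurable_cis_shift (a x : R) :
  cmeasurable (fun t : measurableTypeR R => cis (a * (x - t))).
Proof.
have -> : (fun t => cis (a * (x - t))) = (fun t : R => cis (a * x) * cis (- a * t)).
  by apply/funext => t; rewrite mulrBr mulNr cisD.
by apply: cmeasurableZ; exact: measurable_cis_mul.
Qed.

Lemma measurable_fejer (x : R) :
  measurable_fun setT (fun t : measurableTypeR R => fejer (x - t)).
Proof.
apply: measurable_funM => //; apply: measurable_sqr_normc.
by apply: cmeasurable_sum => j; exact: measurable_cis_shift.
Qed.

Lemma cintegrable_fejer (x : R) :
  cintegrable unif (fun t : measurableTypeR R => (fejer (x - t))%:C).
Proof.
apply: (@cintegrable_bounded _ _ _ _ _ n1).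
  by apply: cmeasurable_real; exact: measurable_fejer.
by move=> t; rewrite normc_real ger0_norm ?fejer_ge0 ?fejer_le.
Qed.

Lemma cintegral_fejer (x : R) :
  cintegral unif (fun t : measurableTypeR R => (fejer (x - t))%:C) = 1.
Proof.
have icis (a : R) : cintegrable unif (fun t : measurableTypeR R => cis (a * t)).
  apply: (@cintegrable_bounded _ _ _ _ _ 1); first exact: measurable_cis_mul.
  by move=> t; rewrite normc_cis.
have -> : (fun t => (fejer (x - t))%:C) = (fun t : measurableTypeR R => (n1^-1)%:C *
   \sum_(p : 'I_N.+1 * 'I_N.+1) cis ((p.1%:Z - p.2%:Z)%:~R * x) * cis ((p.2%:Z - p.1%:Z)%:~R * t)).
  apply/funext => t; rewrite fejerE; congr (_ * _); apply: eq_bigr => p _.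
  by rewrite mulrBr cisD; congr (_ * cis _); rewrite -mulNr -intrN opprB.
rewrite cintegralZ; last by apply: cintegrable_sum => p; apply: cintegrableZ.
rewrite cintegral_sum; last by move=> p; apply: cintegrableZ.
under eq_bigr do rewrite cintegralZ// cintegral_cis.
rewrite -(pair_big xpredT xpredT (fun i j : 'I_N.+1 => cis ((i%:Z - j%:Z)%:~R * x) *
   (if j%:Z - i%:Z == 0 then 1 else 0)))/=.
rewrite (eq_bigr (fun=> 1)); last first.
  move=> i _; rewrite (bigD1 i)//= subrr mul0r cis0 mul1r big1 ?addr0// => j ji.
  have -> : (j%:Z - i%:Z == 0) = false by rewrite subr_eq0 eqz_nat; exact: negbTE.
  by rewrite mulr0.
rewrite sumr_const card_ord -(@rmorph_nat _ _ (real_complex R)) -realcM.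
by rewrite mulVf// pnatr_eq0.
Qed.

Lemma Rintegral_fejer (x : R) :
  \int[unif]_t fejer (x - t) = 1.
Proof. by have := cintegral_fejer x; rewrite cintegral_real => /complexI. Qed.

End fejer_kernel.

Section fejer_mean.
Context {R : realType} {n : nat}.
Local Notation Tn := 'rV[R]_n.
Implicit Types (f : Tn -> R[i]) (x t : Tn).

Definition fcoef f (k : Zn n) : R[i] := ip (haar R n) f (chr k).

Variable N : nat.
Local Notation n1 := (N.+1%:R : R).

Definition kern t : R := \prod_(i < n) fejer N (t ord0 i).

Lemma kern_ge0 t : 0 <= kern t.
Proof. by apply: prodr_ge0 => i _; exact: fejer_ge0. Qed.

(** One pair of summation indices per coordinate. The triangular Fejer weights appear as
    multiplicities of the frequencies. *)
Definition freq (p : {ffun 'I_n -> 'I_N.+1 * 'I_N.+1}) : Zn n :=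
  \row_i ((p i).1%:Z - (p i).2%:Z).

Lemma kernE t : (kern t)%:C = (n1^-1 ^+ n)%:C *
  \sum_(p : {ffun 'I_n -> 'I_N.+1 * 'I_N.+1}) chr (freq p) t.
Proof.
rewrite /kern realc_prod.
under eq_bigr do rewrite fejerE.
rewrite big_split/= prodr_const card_ord -rmorphXn/=; congr (_ * _).
rewrite bigA_distr_bigA/=; apply: eq_bigr => p _.
by rewrite chr_prod; apply: eq_bigr => i _; rewrite mxE.
Qed.

Lemma kern_integral x : cintegrable (haar R n) (fun t => (kern (x - t))%:C) /\
  cintegral (haar R n) (fun t => (kern (x - t))%:C) = 1.
Proof.
have [h1 h2] := @haar_prod R n (fun i (t : measurableTypeR R) => (fejer N (x ord0 i - t))%:C) (fun i => cintegrable_fejer _ _).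
have E t : (kern (x - t))%:C = \prod_(i < n) (fejer N (x ord0 i - t ord0 i))%:C.
  by rewrite realc_prod; apply: eq_bigr => i _; rewrite !mxE.
under eq_fun do rewrite E; split => //.
by rewrite h2 big1// => i _; rewrite cintegral_fejer.
Qed.

Lemma Rintegral_kern x : \int[haar R n]_t kern (x - t) = 1.
Proof. by have [_] := kern_integral x; rewrite cintegral_real => /complexI. Qed.

Lemma integrable_kern x : (haar R n).-integrable setT (EFin \o (fun t => kern (x - t))).
Proof. by have [[]] := kern_integral x. Qed.

(** The integrand is a product over the coordinates: the i-th factor is at most 4/(N+1) by
    [fejer_chord], and each of the others integrates to 1. *)
Lemma kern_chord x (i : 'I_n) :
  (haar R n).-integrable setT
    (EFin \o (fun t => normc (1 - cis (x ord0 i - t ord0 i)) ^+ 2 * kern (x - t))) /\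
  \int[haar R n]_t (normc (1 - cis (x ord0 i - t ord0 i)) ^+ 2 * kern (x - t)) <= 4 / n1.
Proof.
pose phi (j : 'I_n) (t : measurableTypeR R) : R :=
  (if j == i then normc (1 - cis (x ord0 j - t)) ^+ 2 else 1) * fejer N (x ord0 j - t).
have mphi j : measurable_fun setT (phi j).
  apply: measurable_funM; last exact: measurable_fejer.
  case: (j == i) => //; apply: measurable_sqr_normc.
  apply: cmeasurableD; first exact: cmeasurable_cst.
  apply: cmeasurableN; have := @measurable_cis_shift R 1 (x ord0 j).
  by under eq_fun do rewrite mul1r.
have phi0 j (t : measurableTypeR R) : 0 <= phi j t.
  by rewrite mulr_ge0 ?fejer_ge0//; case: ifP => // _; exact: sqr_ge0.
have iphi j : cintegrable (@unif R) (fun u => (phi j u)%:C).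
  have [ji|ji] := eqVneq j i.
    apply: (@cintegrable_bounded _ _ _ _ _ (4 / n1)); first exact: cmeasurable_real.
    by move=> t; rewrite normc_real ger0_norm// /phi ji eqxx fejer_chord.
  rewrite (_ : (fun u => _) = fun t : measurableTypeR R => (fejer N (x ord0 j - t))%:C).
    exact: cintegrable_fejer.
  by apply/funext => t; rewrite /phi (negbTE ji) mul1r.
have [h1 h2] := haar_prod iphi.
have E t : (normc (1 - cis (x ord0 i - t ord0 i)) ^+ 2 * kern (x - t))%:C =
    \prod_(j < n) (phi j (t ord0 j))%:C.
  rewrite -realc_prod; congr _%:C.
  rewrite /phi big_split/= -big_mkcond/= big_pred1_eq; congr (_ * _).
  by apply: eq_bigr => j _; rewrite !mxE.
have h1' : cintegrable (haar R n) (fun t => (normc (1 - cis (x ord0 i - t ord0 i)) ^+ 2 * kern (x - t))%:C).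
  by under eq_fun do rewrite E.
split; first by case: h1'.
have -> : \int[haar R n]_t (normc (1 - cis (x ord0 i - t ord0 i)) ^+ 2 * kern (x - t)) =
   \prod_(j < n) (\int[@unif R]_u phi j u).
  apply: complexI; rewrite -cintegral_real; under eq_cintegral do rewrite E.
  rewrite h2 realc_prod; apply: eq_bigr => j _.
  by rewrite cintegral_real.
rewrite (bigD1 i)//= [X in _ * X]big1 ?mulr1; last first.
  move=> j ji; rewrite -[RHS](@Rintegral_fejer R N (x ord0 j)); apply: eq_Rintegral => t _.
  by rewrite /phi (negbTE ji) mul1r.
apply: (@le_trans _ _ (\int[@unif R]_u (4 / n1))); last first.
  rewrite Rintegral_cst//; rewrite (_ : fine _ = 1) ?mulr1//.
  by rewrite -[RHS]/(fine 1%:E); congr fine; exact: probability_setT.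
apply: le_Rintegral => //.
- by case: (iphi i).
- exact: finite_measure_integrable_cst.
- by move=> t _; rewrite /phi eqxx fejer_chord.
Qed.

Definition fmean f x : R[i] := cintegral (haar R n) (fun t => f t * (kern (x - t))%:C).

Lemma chr_mulr_cintegrable f k : cintegrable (haar R n) f ->
  cintegrable (haar R n) (fun t => f t * conjc (chr k t)).
Proof.
move=> h; apply: (@cintegrable_mulr _ _ _ _ _ _ 1) => //.
  by apply: cmeasurableJ; exact: measurable_chr.
by move=> t; rewrite normcJ normc_chr.
Qed.

Lemma fmeanE f x : cintegrable (haar R n) f ->
  fmean f x = (n1^-1 ^+ n)%:C *
    \sum_(p : {ffun 'I_n -> 'I_N.+1 * 'I_N.+1}) fcoef f (freq p) * chr (freq p) x.
Proof.
move=> h; rewrite /fmean /fcoef /ip.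
rewrite (eq_cintegral _ (g := fun t => (n1^-1 ^+ n)%:C *
   \sum_(p : {ffun 'I_n -> 'I_N.+1 * 'I_N.+1}) chr (freq p) x * (f t * conjc (chr (freq p) t)))).
  rewrite cintegralZ; last first.
    by apply: cintegrable_sum => p; apply: cintegrableZ; exact: chr_mulr_cintegrable.
  rewrite cintegral_sum; last by move=> p; apply: cintegrableZ; exact: chr_mulr_cintegrable.
  congr (_ * _); apply: eq_bigr => p _; rewrite cintegralZ 1?mulrC//.
  exact: chr_mulr_cintegrable.
move=> t; rewrite kernE mulrCA; congr (_ * _); rewrite big_distrr/=.
by apply: eq_bigr => p _; rewrite chrDr chrNr mulrCA.
Qed.

(** As the kernel has integral 1, the error is the integral of (f x - f t) against it. Each chord a
    is bounded by delta + a^2 / delta, which replaces the first moment of the kernel by the second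
    moment from [kern_chord]. *)
Lemma fmean_bound f (L delta : R) x : cmeasurable f -> 0 < delta -> 0 <= L ->
  (forall t, normc (f x - f t) <= L * \sum_(i < n) normc (1 - cis (x ord0 i - t ord0 i))) ->
  normc (f x - fmean f x) <= L * n%:R * (delta + 4 / (delta * n1)).
Proof.
move=> mf d0 L0 Lf; have [ik ik1] := kern_integral x.
pose H t : R := L * \sum_(i < n) (delta * kern (x - t) +
   delta^-1 * (normc (1 - cis (x ord0 i - t ord0 i)) ^+ 2 * kern (x - t))).
have Hsum_int : (haar R n).-integrable setT (EFin \o H).
  apply: integrableZ_EFin.
  rewrite (_ : EFin \o _ = fun t => (\sum_(i < n) ((delta * kern (x - t) +
     delta^-1 * (normc (1 - cis (x ord0 i - t ord0 i)) ^+ 2 * kern (x - t)))%:E))%E); last first.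
    by apply/funext => t; rewrite /= sumEFin.
  apply: integrable_sum => // i _; apply: integrableD_EFin; apply: integrableZ_EFin.
    exact: integrable_kern.
  by case: (kern_chord x i).
have fH t : normc ((f x - f t) * (kern (x - t))%:C) <= H t.
  rewrite normc_M normc_real ger0_norm ?kern_ge0//.
  apply: le_trans (ler_wpM2r (kern_ge0 _) (Lf t)) _.
  rewrite /H -mulrA ler_wpM2l// mulr_suml; apply: ler_sum => i _.
  rewrite mulrA -mulrDl ler_wpM2r ?kern_ge0//.
  set a := normc _; have a0 : 0 <= a := normc_ge0 _.
  rewrite -(ler_pM2l d0) mulrDr mulrA mulfV ?gt_eqF// mul1r.
  have := sqr_ge0 (delta - a); have := mulr_ge0 (ltW d0) a0; nra.
have mk : cmeasurable (fun t => (kern (x - t))%:C) by exact: cintegrable_meas ik.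
have i1 : cintegrable (haar R n) (fun t => (f x - f t) * (kern (x - t))%:C).
  apply: (@cintegrable_le _ _ _ _ _ H) => //; apply: cmeasurableM => //.
  by apply: cmeasurableD; [exact: cmeasurable_cst|exact: cmeasurableN].
have i2 : cintegrable (haar R n) (fun t => f x * (kern (x - t))%:C) by exact: cintegrableZ.
have -> : f x - fmean f x = cintegral (haar R n) (fun t => (f x - f t) * (kern (x - t))%:C).
  rewrite -[f x in LHS]mulr1 -ik1 -cintegralZ// /fmean.
  have -> : (fun t => f t * (kern (x - t))%:C) =
      (fun t => f x * (kern (x - t))%:C - (f x - f t) * (kern (x - t))%:C).
    by apply/funext => t; ring.
  by rewrite cintegralB// opprB addrC subrK.
apply: le_trans (le_normc_cintegral i1) _.
apply: (@le_trans _ _ (\int[haar R n]_t H t)).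
  by apply: le_Rintegral => //; exact: cintegrable_normc.
have hi (i : 'I_n) : (haar R n).-integrable setT (EFin \o (fun t => delta * kern (x - t) +
     delta^-1 * (normc (1 - cis (x ord0 i - t ord0 i)) ^+ 2 * kern (x - t)))).
  apply: integrableD_EFin; apply: integrableZ_EFin; first exact: integrable_kern.
  by case: (kern_chord x i).
rewrite /H RintegralZl//; last first.
  rewrite (_ : EFin \o _ = fun t => (\sum_(i < n) ((delta * kern (x - t) +
     delta^-1 * (normc (1 - cis (x ord0 i - t ord0 i)) ^+ 2 * kern (x - t)))%:E))%E); last first.
    by apply/funext => t; rewrite /= sumEFin.
  by apply: integrable_sum => // i _; exact: hi.
rewrite -mulrA ler_wpM2l//.
have -> : \int[haar R n]_t (\sum_(i < n) (delta * kern (x - t) +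
     delta^-1 * (normc (1 - cis (x ord0 i - t ord0 i)) ^+ 2 * kern (x - t)))) =
   \sum_(i < n) \int[haar R n]_t (delta * kern (x - t) +
     delta^-1 * (normc (1 - cis (x ord0 i - t ord0 i)) ^+ 2 * kern (x - t))).
  apply: complexI; rewrite realc_sum -cintegral_real.
  under eq_cintegral do rewrite realc_sum.
  rewrite cintegral_sum => [|i]; last exact: cintegrable_real.
  by apply: eq_bigr => i _; rewrite cintegral_real.
rewrite (_ : n%:R = \sum_(i < n) (1 : R)) ?mulr_suml; last by rewrite sumr_const card_ord.
apply: ler_sum => i _; rewrite mul1r RintegralD//; last 2 first.
- by apply: integrableZ_EFin; exact: integrable_kern.
- by apply: integrableZ_EFin; case: (kern_chord x i).
have [k1 k2] := kern_chord x i.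
rewrite !RintegralZl//; last exact: integrable_kern.
rewrite Rintegral_kern mulr1 lerD2l.
rewrite (_ : 4 / (delta * n1) = delta^-1 * (4 / n1)); last by rewrite invfM mulrCA.
by rewrite ler_wpM2l// invr_ge0 ltW.
Qed.

End fejer_mean.

(** * Uniqueness of Fourier coefficients *)

Lemma integrableB_EFin d (T : measurableType d) (R : realType)
    (mu : {measure set T -> \bar R}) (h k : T -> R) :
  mu.-integrable setT (EFin \o h) -> mu.-integrable setT (EFin \o k) ->
  mu.-integrable setT (EFin \o (fun x => h x - k x)).
Proof.
move=> ih ik; rewrite (_ : EFin \o _ = (EFin \o h) \- (EFin \o k))%E//.
exact: integrableB.
Qed.

Lemma Rintegral_cst_prob d (T : measurableType d) (R : realType) (P : probability T R) (c : R) :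
  \int[P]_x c = c.
Proof.
by apply: complexI; rewrite -cintegral_real cintegral_cst_prob.
Qed.

Section uniqueness_circle.
Context {R : realType}.
Local Notation unif := (@unif R).
Local Notation leb := (@lebesgue_measure R).

(* The preimage in R of the arc [0, b[ of R / Z. *)
Definition arc (b : R) : set R := [set t | t - (Num.floor t)%:~R < b].

Lemma measurable_arc b : measurable (arc b : set (measurableTypeR R)).
Proof.
have -> : arc b = \bigcup_(i in [set: nat])
    (if (unpickle i : option int) is Some z then `[z%:~R, (z + 1)%:~R[ `&` `]-oo, (z%:~R + b)[ else set0).
  apply/seteqP; split => [t /= tb|t [i _]].
    exists (pickle (Num.floor t)); [by []|rewrite pickleK; split => /=].
      by rewrite in_itv/= Num.Theory.floor_le Num.Theory.floorD1_gt.
    by rewrite in_itv/= -ltrBlDl.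
  case: unpickle => // z [/=]; rewrite !in_itv/= => h1 h2.
  by rewrite /arc/= (Num.Theory.floor_def h1) ltrBlDl.
apply: bigcupT_measurable => i; case: unpickle => // z.
by apply: measurableI; exact: measurable_itv.
Qed.

Let ind b (t : R) : R := \1_(arc b) t.

Let ind01 b t : 0 <= ind b t <= 1.
Proof. by rewrite /ind indicE; case: (t \in _); rewrite /= ?lexx ler01. Qed.

Let measurable_ind b : measurable_fun setT (ind b : measurableTypeR R -> R).
Proof. by apply: measurable_indic; exact: measurable_arc. Qed.

(** The indicator is constant near x, which avoids the endpoints of the arc modulo 1. The quadratic
    majorant matches [fejer_chord]. *)
Lemma arc_chord b x : 0 < x < 1 -> x != b -> exists2 C : R, 0 <= C &
  forall t, `|ind b x - ind b t| <= C * normc (1 - cis (x - t)) ^+ 2.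
Proof.
move=> /andP[x0 x1] xb.
(* If the chord is at least eta, then eta^-2 times its square is at least 1. Otherwise an integer
   translate of t lies within eta of x, hence in ]0, 1[ and on the same side of b. *)
pose eta := Num.min (Num.min x (1 - x)) `|x - b|.
have e0 : 0 < eta by rewrite /eta !lt_min x0 subr_gt0 x1 normr_gt0 subr_eq0 xb.
have [ex e1 eb] : [/\ eta <= x, eta <= 1 - x & eta <= `|x - b|].
  by rewrite /eta !ge_min !lexx !orbT.
exists (eta ^- 2) => [|t]; first by rewrite invr_ge0 sqr_ge0.
have [h|h] := leP eta (normc (1 - cis (x - t))).
  apply: (@le_trans _ _ 1).
    have := ind01 b x; have := ind01 b t; rewrite ler_norml; lra.
  rewrite mulrC ler_pdivlMr ?exprn_gt0// mul1r ler_pXn2r ?nnegrE ?normc_ge0//.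
  exact: ltW.
have [z hz] := dist_chord (x - t).
have {}hz : `|x - (t + z%:~R)| < eta by rewrite opprD addrA; exact: le_lt_trans h.
have ft : Num.floor t = - z.
  apply: Num.Theory.floor_def; rewrite intrD intrN/=; move: hz; rewrite ltr_norml; lra.
have fx : Num.floor x = 0 by apply: Num.Theory.floor_def; rewrite add0r/=; lra.
suff -> : ind b x = ind b t.
  by rewrite subrr normr0 mulr_ge0 ?invr_ge0 ?sqr_ge0.
rewrite /ind !indicE; congr (_%:R); congr (nat_of_bool _).
have E : arc b x <-> arc b t.
  rewrite /arc/= ft fx intrN subr0 opprK.
  by split; move: hz eb; rewrite ltr_norml; have [?|?] := leP b x;
     [rewrite ger0_norm ?subr_ge0//|rewrite ltr0_norm ?subr_lt0//|
      rewrite ger0_norm ?subr_ge0//|rewrite ltr0_norm ?subr_lt0//]; lra.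
by apply/idP/idP => /set_mem h1; apply/mem_set; apply/E.
Qed.

Let FN b N (x : R) : R := \int[unif]_t (ind b t * fejer N (x - t)).

Let iF b N x : cintegrable unif (fun t : measurableTypeR R => (ind b t * fejer N (x - t))%:C).
Proof.
apply: (@cintegrable_bounded _ _ _ _ _ N.+1%:R).
  by apply: cmeasurable_real; apply: measurable_funM => //; exact: measurable_fejer.
move=> t; have /andP[i0 i1] := ind01 b t.
rewrite normc_real ger0_norm; last by apply: mulr_ge0 => //; exact: fejer_ge0.
by apply: le_trans (fejer_le N (x - t)); rewrite ler_piMl ?fejer_ge0.
Qed.

Let FN01 b N x : 0 <= FN b N x <= 1.
Proof.
apply/andP; split.
  by apply: Rintegral_ge0 => t _; rewrite mulr_ge0 ?fejer_ge0//; case/andP: (ind01 b t).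
rewrite -(Rintegral_fejer N x); apply: le_Rintegral => //.
- by case: (iF b N x).
- by case: (cintegrable_fejer N x).
- by move=> t _; rewrite ler_piMl ?fejer_ge0//; case/andP: (ind01 b t).
Qed.

(** Combining [arc_chord] with [fejer_chord] bounds the error of the N-th Fejer mean by 4C/(N+1). *)
Lemma FN_cvg b x : 0 < x < 1 -> x != b -> (fun N => FN b N x) @ \oo --> ind b x.
Proof.
move=> x01 xb; have [C C0 hC] := arc_chord x01 xb.
have bd N : `|ind b x - FN b N x| <= C * 4 * (N.+1%:R)^-1.
  have ik : unif.-integrable setT (EFin \o (fun t => ind b x * fejer N (x - t))).
    by apply: integrableZ_EFin; case: (cintegrable_fejer N x).
  have iF' : unif.-integrable setT (EFin \o (fun t => ind b t * fejer N (x - t))).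
    by case: (iF b N x).
  have -> : ind b x - FN b N x = \int[unif]_t (ind b x * fejer N (x - t) - ind b t * fejer N (x - t)).
    rewrite RintegralB// RintegralZl//; last by case: (cintegrable_fejer N x).
    by rewrite Rintegral_fejer mulr1.
  have iB : unif.-integrable setT (EFin \o (fun t => ind b x * fejer N (x - t) - ind b t * fejer N (x - t))).
    exact: integrableB_EFin.
  apply: le_trans (le_normr_Rintegral _ iB) _ => //.
  apply: (@le_trans _ _ (\int[unif]_t (C * 4 / N.+1%:R))); last first.
    by rewrite Rintegral_cst_prob.
  apply: le_Rintegral => //.
  - exact: integrable_norm iB.
  - exact: finite_measure_integrable_cst.
  - move=> t _; rewrite -mulrBl normrM [`|fejer _ _|]ger0_norm ?fejer_ge0//.
    apply: le_trans (ler_wpM2r (fejer_ge0 _ _) (hC t)) _.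
    rewrite -[leRHS]mulrA -[leLHS]mulrA; apply: ler_wpM2l => //.
    exact: (fejer_chord N (x - t)).
have C1 : 0 < C * 4 + 1 by rewrite ltr_wpDl// mulr_ge0.
apply/cvgrPdist_le => e e0; near=> N.
apply: le_trans (bd N) _.
have : (N.+1%:R)^-1 < e / (C * 4 + 1).
  near: N; exact: (near_infty_natSinv_lt (PosNum (divr_gt0 e0 C1))).
move=> /ltW; rewrite ler_pdivlMr// mulrC => h; apply: le_trans h.
by rewrite ler_wpM2r ?invr_ge0// lerDl.
Unshelve. all: by end_near. Qed.

Let FN_trig b N : exists (c : 'I_N.+1 * 'I_N.+1 -> R[i]), forall x : R,
  (FN b N x)%:C = \sum_p c p * cis ((p.1%:Z - p.2%:Z)%:~R * x).
Proof.
exists (fun p : 'I_N.+1 * 'I_N.+1 => (N.+1%:R^-1)%:C * cintegral unif (fun t : measurableTypeR R => (ind b t)%:C * cis ((p.2%:Z - p.1%:Z)%:~R * t))) => x.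
rewrite /FN -cintegral_real.
have ii (p : 'I_N.+1 * 'I_N.+1) : cintegrable unif (fun t : measurableTypeR R => (ind b t)%:C * cis ((p.2%:Z - p.1%:Z)%:~R * t)).
  apply: (@cintegrable_bounded _ _ _ _ _ 1).
    by apply: cmeasurableM; [exact: cmeasurable_real|exact: measurable_cis_mul].
  by move=> t; rewrite normc_M normc_cis mulr1 normc_real ger0_norm; case/andP: (ind01 b t).
rewrite (eq_cintegral _ (g := fun t : measurableTypeR R => (N.+1%:R^-1)%:C *
   \sum_(p : 'I_N.+1 * 'I_N.+1) cis ((p.1%:Z - p.2%:Z)%:~R * x) * ((ind b t)%:C * cis ((p.2%:Z - p.1%:Z)%:~R * t)))); last first.
  move=> t; rewrite realcM fejerE mulrCA; congr (_ * _).
  rewrite big_distrr/=; apply: eq_bigr => p _.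
  rewrite mulrBr cisD [RHS]mulrCA; congr (_ * (_ * cis _)).
  by rewrite -mulNr -intrN opprB.
rewrite cintegralZ; last by apply: cintegrable_sum => p; exact: cintegrableZ.
rewrite cintegral_sum; last by move=> p; exact: cintegrableZ.
rewrite big_distrr/=; apply: eq_bigr => p _.
by rewrite cintegralZ// -!mulrA; congr (_ * _); rewrite mulrC.
Qed.

Let unif_ae (P : R -> Prop) : {ae leb, forall x, P x} -> {ae unif, forall x, P x}.
Proof.
move=> [A [mA A0 sub]]; exists A; split => //.
by move/null_content_dominatesP: (@dominates_uniform_prob R 0 1 (@ltr01 R)); apply.
Qed.

Let ae_neq (b : R) : {ae leb, forall x, x != b}.
Proof.
exists [set b]; split => //; first exact: lebesgue_measure_set1.
by move=> x /= /negP; rewrite negbK => /eqP.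
Qed.

Let ae_01 : {ae unif, forall x : R, 0 < x < 1}.
Proof.
have h1 : {ae unif, forall x : R, 0 <= x <= 1}.
  exists (~` `[0, 1]%classic); split.
  - by apply: measurableC; exact: measurable_itv.
  - transitivity (\int[leb]_(x in ~` `[0%R, 1%R]) (uniform_pdf 0 1 x)%:E)%E; first by [].
    by rewrite integral_uniform_pdf setICl integral_set0.
  - by move=> x /=; rewrite in_itv/=.
have h0 := unif_ae (ae_neq 0); have h2 := unif_ae (ae_neq 1).
have Fu := ae_filter_ringOfSetsType unif.
apply: filterS3 h0 h1 h2 => x x0 /andP[x0' x1'] x1.
by rewrite !lt_neqAle x1 x0' x1' eq_sym x0.
Qed.

(** The means [FN b N] are trigonometric polynomials, so r integrates to 0 against each. They
    converge almost everywhere to the indicator at distance at most 1, and |r| dominates. *)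
Lemma cintegral_arc0 (r : measurableTypeR R -> R[i]) b : cintegrable unif r ->
  (forall z : int, cintegral unif (fun t : measurableTypeR R => r t * cis (z%:~R * t)) = 0) ->
  cintegral unif (fun t => r t * (\1_(arc b) t)%:C) = 0.
Proof.
move=> hr r0.
have mFN N : measurable_fun setT (FN b N : measurableTypeR R -> R).
  have [c hc] := FN_trig b N.
  have : cmeasurable (fun x : measurableTypeR R => \sum_p c p * cis ((p.1%:Z - p.2%:Z)%:~R * x)).
    by apply: cmeasurable_sum => p; apply: cmeasurableZ; exact: measurable_cis_mul.
  by move=> [+ _]; under eq_fun do rewrite -hc.
have F0 N : cintegral unif (fun t : measurableTypeR R => r t * (FN b N t)%:C) = 0.
  have [c hc] := FN_trig b N.
  under eq_cintegral do rewrite hc big_distrr/=.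
  have hz (z : int) : cintegrable unif (fun t : measurableTypeR R => r t * cis (z%:~R * t)).
    apply: (@cintegrable_mulr _ _ _ _ _ _ 1) => //; first exact: measurable_cis_mul.
    by move=> t; rewrite normc_cis.
  under eq_cintegral do under eq_bigr do rewrite mulrCA.
  rewrite cintegral_sum; last by move=> p; exact: cintegrableZ.
  by rewrite big1// => p _; rewrite cintegralZ// r0 mulr0.
have bnd N t : `|ind b t - FN b N t| <= 1.
  have := ind01 b t; have := FN01 b N t; rewrite ler_norml; lra.
have hind : cintegrable unif (fun t => r t * (ind b t)%:C).
  apply: (@cintegrable_mulr _ _ _ _ _ _ 1) => //; first exact: cmeasurable_real.
  by move=> t; rewrite normc_real ger0_norm; case/andP: (ind01 b t).
have hFN N : cintegrable unif (fun t : measurableTypeR R => r t * (FN b N t)%:C).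
  apply: (@cintegrable_mulr _ _ _ _ _ _ 1) => //; first exact: cmeasurable_real.
  by move=> t; rewrite normc_real ger0_norm; case/andP: (FN01 b N t).
set J := cintegral _ _; apply/eqP; rewrite -normc_eq0 eq_le normc_ge0 andbT.
have JN N : ((normc J)%:E <= \int[unif]_t (normc (r t) * `|ind b t - FN b N t|)%:E)%E.
  rewrite (_ : J = cintegral unif (fun t : measurableTypeR R => r t * (ind b t)%:C - r t * (FN b N t)%:C)).
    rewrite (_ : (\int[unif]_t _)%E = \int[unif]_t (normc (r t * (ind b t)%:C - r t * (FN b N t)%:C))%:E)%E.
      have hB := cintegrableB hind (hFN N).
      by rewrite fin_normc_cintegrable// lee_fin; exact: le_normc_cintegral.
    apply: eq_integral => t _; congr EFin.
    by rewrite -mulrBr normc_M -(rmorphB (real_complex R)) normc_real.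
  by rewrite cintegralB// F0 subr0.
rewrite -lee_fin.
have cv : (fun N => \int[unif]_t (normc (r t) * `|ind b t - FN b N t|)%:E)%E @ \oo --> (\int[unif]_t (cst 0 t))%E.
  have mdiff N : measurable_fun setT (fun t : measurableTypeR R => (normc (r t) * `|ind b t - FN b N t|)%:E).
    apply/measurable_EFinP; apply: measurable_funM.
      by apply: measurable_normc; exact: cintegrable_meas hr.
    by apply: measurableT_comp => //; exact: measurable_funB.
  have aec : {ae unif, forall t : measurableTypeR R, setT t ->
      (fun N => (normc (r t) * `|ind b t - FN b N t|)%:E) @ \oo --> cst 0%E t}.
    have Fu := ae_filter_ringOfSetsType unif.
    apply: filterS2 ae_01 (unif_ae (ae_neq b)) => t t01 tb _ /=.
    apply: cvg_EFin; first exact: nearW.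
    rewrite -(mulr0 (normc (r t))); apply: cvgM; first exact: cvg_cst.
    rewrite -(normr0 R) -(subrr (ind b t)); apply: cvg_norm.
    by apply: cvgB; [exact: cvg_cst|exact: FN_cvg].
  have aeb : {ae unif, forall (t : measurableTypeR R) N, setT t ->
      (`|(normc (r t) * `|ind b t - FN b N t|)%:E| <= (normc (r t))%:E)%E}.
    apply: aeW => t N _; rewrite lee_fin ger0_norm ?mulr_ge0 ?normc_ge0//.
    by rewrite ler_piMr ?normc_ge0.
  by have [] := dominated_convergence measurableT mdiff (measurable_cst _) aec (cintegrable_normc hr) aeb.
rewrite integral0 in cv.
apply: (@le_trans _ _ (limn (fun N => (\int[unif]_t (normc (r t) * `|ind b t - FN b N t|)%:E)%E))).
  apply: lime_ge; first by apply/cvg_ex; exists 0%E.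
  exact: nearW.
by rewrite (cvg_lim _ cv).
Qed.

(* The Fejer means of the indicator of an arc converge to it boundedly, so   *)
(* that r integrates to 0 over every arc; then differentiate the primitive.  *)
Lemma L1_uniqueness_circle (r : measurableTypeR R -> R[i]) : cintegrable unif r ->
  (forall z : int, cintegral unif (fun t : measurableTypeR R => r t * cis (z%:~R * t)) = 0) ->
  (\int[unif]_t (normc (r t))%:E = 0)%E.
Proof.
move=> hr r0.
have arc0 (b : R) := @cintegral_arc0 r b hr r0.
have mr := cintegrable_meas hr.
have real_case (p : R -> R) : measurable_fun setT (p : measurableTypeR R -> R) ->
    unif.-integrable setT (EFin \o p) ->
    (forall b, \int[unif]_t (p t * \1_(arc b) t) = 0) -> {ae unif, forall t, p t = 0}.
  move=> mp ip p0.
  (* Extension by 0 makes the primitive [F] from minus infinity available. On ]0, 1[, F x is the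
     integral over the arc [0, x[, which vanishes, while F has derivative h almost everywhere. *)
  pose h : R -> R := p \_ `[0, 1].
  have ih : leb.-integrable setT (EFin \o h).
    rewrite (_ : EFin \o h = (EFin \o p) \_ `[0, 1]); last first.
      by apply/funext => t; rewrite /h/= !patchE; case: ifP.
    have mI : measurable (`[0, 1]%classic : set (measurableTypeR R)) by exact: measurable_itv.
    apply/(integrable_mkcond _ mI).
    apply/integrableP; split; first by apply: measurable_funTS; exact/measurable_EFinP.
    by apply/integrable_unif => //; case/integrableP: ip.
  have mh : measurable_fun setT h by apply/measurable_EFinP; exact: measurable_int ih.
  have ihy y : leb.-integrable `]-oo, y] (EFin \o h).
    by apply: (integrableS measurableT _ _ ih) => //; exact: measurable_itv.
  have lh : locally_integrable [set: R] h.
    by apply: open_integrable_locally => //; exact: openT.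
  pose F x := \int[leb]_(t in `]-oo, x]) h t.
  have aeF : {ae leb, forall x, derivable F x 1 /\ derive1 F x = h x} by exact: (FTC1Ny ihy lh).
  have F0 x : 0 < x < 1 -> F x = 0.
    move=> x01; rewrite -[RHS](p0 x) Rintegral_unif; last first.
      by apply: measurable_funM => //; exact: measurable_ind.
    rewrite /F /Rintegral [in LHS]integral_mkcond [in RHS]integral_mkcond; congr fine.
    apply: ae_eq_integral => //.
    - apply/(measurable_restrictT _ (measurable_itv _)); apply: measurable_funTS; exact/measurable_EFinP.
    - apply/(measurable_restrictT _ (measurable_itv _)); apply: measurable_funTS.
      by apply/measurable_EFinP; apply: measurable_funM => //; exact: measurable_ind.
    - have Fl := ae_filter_ringOfSetsType leb.
      (* The arc and the half-line ]-oo, x] disagree inside [0, 1] at t = x, which only the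
         half-line contains, and at t = 1, which only the arc contains. *)
      apply: filterS2 (ae_neq x) (ae_neq 1) => t tx t1 _ /=.
      rewrite !patchE /h patchE /= !mem_setE !in_itv/=.
      have [/andP[t0 t1']|t01] := boolP (0 <= t <= 1); last by case: ifP.
      have ft : Num.floor t = 0.
        by apply: Num.Theory.floor_def; rewrite add0r/= t0 lt_neqAle t1 t1'.
      rewrite indicE; have -> : (t \in arc x) = (t < x).
        by apply/idP/idP => [/set_mem|h1]; [|apply/mem_set]; rewrite /arc/= ft subr0.
      by rewrite le_eqVlt (negbTE tx)/=; case: (t < x); rewrite ?mulr1 ?mulr0.
  have aeP : {ae leb, forall t, 0 < t < 1 -> p t = 0}.
    have Fl := ae_filter_ringOfSetsType leb.
    apply: filterS aeF => t [_ dt] t01.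
    have : derive1 F t = 0.
      rewrite derive1E (@near_eq_derive _ _ _ F (cst 0)) ?derive_cst ?oner_neq0//.
      have : t \in `]0, 1[ by rewrite in_itv.
      move=> /near_in_itvoo; apply: filterS => y; rewrite in_itv/= => y01.
      by rewrite F0.
    by rewrite dt /h patchE mem_set//= in_itv/=; case/andP: t01 => /ltW -> /ltW ->.
  have Fu := ae_filter_ringOfSetsType unif.
  by apply: filterS2 ae_01 (unif_ae aeP) => t t01; apply.
have indR b : \int[unif]_t (ReC (r t) * \1_(arc b) t) = 0.
  have := congr1 (@complex.Re R) (arc0 b); rewrite /cintegral/=.
  by under eq_Rintegral do rewrite ReM/= mulr0 subr0.
have indI b : \int[unif]_t (ImC (r t) * \1_(arc b) t) = 0.
  have := congr1 (@complex.Im R) (arc0 b); rewrite /cintegral/=.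
  by under eq_Rintegral do rewrite ImM/= mulr0 add0r.
have [iR iI] := hr.
have hR := real_case _ mr.1 iR indR.
have hI := real_case _ mr.2 iI indI.
rewrite -[RHS](integral0 unif setT); apply: ge0_ae_eq_integral => //.
- by apply/measurable_EFinP; exact: measurable_normc.
- by move=> t _; rewrite lee_fin normc_ge0.
- have Fu := ae_filter_ringOfSetsType unif.
  apply: filterS2 hR hI => t h1 h2 _ /=.
  by rewrite (_ : r t = 0) ?normc_0//; apply: ReImP.
Qed.
End uniqueness_circle.

Section uniqueness_torus.
Context {R : realType}.
Local Notation unif := (@unif R).

Lemma ae_cintegral d (T : measurableType d) (mu : {measure set T -> \bar R}) (f g : T -> R[i]) :
  cmeasurable f -> cmeasurable g -> {ae mu, forall x, f x = g x} ->
  cintegral mu f = cintegral mu g.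
Proof.
move=> [fR fI] [gR gI] fg; rewrite /cintegral /Rintegral.
congr (fine _ +i* fine _); apply: ae_eq_integral => //; try exact/measurable_EFinP;
  by apply: filterS fg => x -> .
Qed.

Lemma ae_section2 d1 d2 (T1 : measurableType d1) (T2 : measurableType d2)
    (m1 : {sigma_finite_measure set T1 -> \bar R})
    (m2 : {sigma_finite_measure set T2 -> \bar R}) (f : T1 * T2 -> R[i]) :
  cintegrable (m1 \x m2)%E f -> {ae m2, forall y, cintegrable m1 (fun x => f (x, y))}.
Proof.
move=> [iR iI]; have Fm := ae_filter_ringOfSetsType m2.
by apply: filterS2 (ae_integrable2 iR) (ae_integrable2 iI) => y h1 h2; split.
Qed.

Let cons_freq n (z : int) (k : Zn n) : Zn n.+1 :=
  \row_i (if unlift ord0 i is Some j then k ord0 j else z).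

Let chr_cons n z (k : Zn n) (p : R * 'rV[R]_n) :
  chr (cons_freq z k) (rV_cons p) = cis (z%:~R * p.1) * chr k p.2.
Proof.
rewrite /chr -cisD; congr cis; rewrite /dot big_ord_recl rV_cons0 mxE unlift_none.
by congr (_ + _); apply: eq_bigr => i _; rewrite rV_consS mxE liftK.
Qed.

(** Induction on the dimension. For each integer z, the z-th coefficient in the first variable,
    [rho z], is a function of the others with vanishing Fourier coefficients, hence null. As there
    are countably many z, for almost every w all coefficients of f(., w) vanish; the circle case and
    Tonelli conclude. *)
Lemma L1_uniqueness n (f : 'rV[R]_n -> R[i]) : cintegrable (haar R n) f ->
  (forall k, cintegral (haar R n) (fun w => f w * chr k w) = 0) ->
  (\int[haar R n]_w (normc (f w))%:E = 0)%E.
Proof.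
elim: n f => [|n IH] f hf f0.
  have fc w : f w = f 0 by congr f; apply/rowP => -[].
  have := f0 0; under eq_cintegral do rewrite fc /chr dot0l cis0 mulr1.
  rewrite cintegral_cst_prob => f00.
  by under eq_integral do rewrite fc f00 normc_0; rewrite integral0.
have [mf hg] := (cintegrable_haarS f).1 hf.
pose g (p : measurableTypeR R * 'rV[R]_n) := f (rV_cons p).
have mg : cmeasurable g by exact: cintegrable_meas hg.
have mc z : cmeasurable (fun p : measurableTypeR R * 'rV[R]_n => cis (z%:~R * p.1)).
  by apply: (cmeasurable_fst (f := fun t : measurableTypeR R => cis (z%:~R * t))); exact: measurable_cis_mul.
have hgz (z : int) : cintegrable (unif \x haar R n)%E (fun p => g p * cis (z%:~R * p.1)).
  by apply: (@cintegrable_mulr _ _ _ _ _ _ 1) => // p; rewrite normc_cis.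
pose rho (z : int) (w : 'rV[R]_n) := cintegral unif (fun t : measurableTypeR R => g (t, w) * cis (z%:~R * t)).
have irho z : cintegrable (haar R n) (rho z) by have [] := cfubini21 (hgz z).
have rho0 z : (\int[haar R n]_w (normc (rho z w))%:E = 0)%E.
  apply: IH => // k; rewrite -(f0 (cons_freq z k)) cintegral_haarS; last first.
    apply: (@cintegrable_mulr _ _ _ _ _ _ 1) => //; first exact: measurable_chr.
    by move=> w; rewrite normc_chr.
  have hgzk : cintegrable (unif \x haar R n)%E (fun p => g p * cis (z%:~R * p.1) * chr k p.2).
    apply: (@cintegrable_mulr _ _ _ _ _ _ 1) => //.
      by apply: (cmeasurable_snd (f := chr k)); exact: measurable_chr.
    by move=> p; rewrite normc_chr.
  have [ii <-] : cintegrable (haar R n) (fun w => cintegral unif (fun t : measurableTypeR R => g (t, w) * cis (z%:~R * t) * chr k w)) /\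
     cintegral (haar R n) (fun w => cintegral unif (fun t : measurableTypeR R => g (t, w) * cis (z%:~R * t) * chr k w)) =
     cintegral (unif \x haar R n)%E (fun p => f (rV_cons p) * chr (cons_freq z k) (rV_cons p)).
    have [h1 h2] := cfubini21 hgzk; split => //; rewrite h2; apply: eq_cintegral => p.
    by rewrite chr_cons mulrA.
  apply: ae_cintegral.
  - by apply: cmeasurableM; [exact: cintegrable_meas (irho z)|exact: measurable_chr].
  - exact: cintegrable_meas ii.
  - have Fm := ae_filter_ringOfSetsType (haar R n).
    apply: filterS (ae_section2 (hgz z)) => w hw.
    by rewrite mulrC -cintegralZ//; apply: eq_cintegral => t; rewrite mulrC.
have ae_rho : {ae haar R n, forall w, forall i : nat, if unpickle i is Some z then rho z w = 0 else True}.
  apply/ae_foralln => i; case: unpickle => [z|]; last exact: aeW.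
  have := @ae_eq_cintegral _ _ _ (haar R n) (rho z) (fun=> 0) (cintegrable_meas (irho z)) (cmeasurable_cst _).
  by apply; rewrite -[RHS](rho0 z); apply: eq_integral => w _; rewrite subr0.
have aeg : {ae haar R n, forall w, \int[unif]_t (normc (g (t, w)))%:E = 0}%E.
  have Fm := ae_filter_ringOfSetsType (haar R n).
  apply: filterS2 ae_rho (ae_section2 hg) => w hw ig.
  by apply: L1_uniqueness_circle => // z; have := hw (pickle z); rewrite pickleK.
have mng : measurable_fun setT (fun p => (normc (g p))%:E).
  by apply/measurable_EFinP; exact: measurable_normc.
transitivity (\int[unif \x haar R n]_p (normc (g p))%:E)%E.
  rewrite [LHS]ge0_integral_distribution//; last by move=> w; rewrite lee_fin normc_ge0.
  by apply/measurable_EFinP; exact: measurable_normc.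
rewrite fubini_tonelli2//; last by move=> p; rewrite lee_fin normc_ge0.
rewrite -[RHS](integral0 (haar R n) setT); apply: ge0_ae_eq_integral => //.
- apply: measurable_fun_fubini_tonelli_G => //.
  by move=> p; rewrite lee_fin normc_ge0.
- by move=> w _; apply: integral_ge0 => t _; rewrite lee_fin normc_ge0.
- have Fm := ae_filter_ringOfSetsType (haar R n).
  by apply: filterS aeg => w h _.
Qed.

End uniqueness_torus.

(** * Counting measure and Lebesgue norms *)

Section counting_measure.
Local Open Scope ereal_scope.
Context {R : realType} {n : nat}.
Local Notation cZ := (countingZ R n).
Implicit Types (f : Zn n -> \bar R) (s : seq (Zn n)).

Lemma countingZ1 (k : Zn n) : cZ [set k] = 1.
Proof. by rewrite /countingZ /counting /= asboolT// fset_set1 finmap.cardfs1. Qed.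

Lemma integral_countingZ1 f (k : Zn n) : 0 <= f k -> \int[cZ]_(x in [set k]) f x = f k.
Proof.
move=> f0; transitivity (\int[cZ]_(x in [set k]) cst (f k) x).
  by apply: eq_integral => x; rewrite inE/= => ->.
by rewrite integral_cst// [X in _ * X]countingZ1 mule1.
Qed.

Lemma sum_le_integral_countingZ f s : (forall k, 0 <= f k) -> uniq s ->
  \sum_(k <- s) f k <= \int[cZ]_k f k.
Proof.
move=> f0 us.
have -> : \sum_(k <- s) f k = \sum_(k <- s) \int[cZ]_(x in [set k]) f x.
  by apply: eq_bigr => k _; rewrite integral_countingZ1.
rewrite -ge0_integral_bigsetU//.
- exact: ge0_subset_integral.
- by move=> i j _ _ [x [/= -> ->]].
Qed.

(** Together with [sum_le_integral_countingZ], this identifies the integral with the supremum of the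
    sums over finitely many distinct points. A code that belongs to no point contributes an empty
    set. *)
Lemma integral_countingZ_le f (M : \bar R) : (forall k, 0 <= f k) ->
  (forall s, uniq s -> \sum_(k <- s) f k <= M) -> \int[cZ]_k f k <= M.
Proof.
move=> f0 fM.
pose A (i : nat) : set (Zn n) := [set k | pickle k = i].
have tA : trivIset setT A by move=> i j _ _ [x [/= <- <-]].
have -> : [set: Zn n] = \bigcup_i A i.
  by apply/seteqP; split => // k _; exists (pickle k).
rewrite ge0_integral_bigcup//.
apply: lime_le.
  by apply: is_cvg_nneseries => i _ _; exact: integral_ge0.
apply: nearW => N.
apply: le_trans (fM (pmap (@pickle_inv (Zn n)) (iota 0 N)) _); last first.
  by apply: (pmap_uniq (@pickle_invK (Zn n))); exact: iota_uniq.
rewrite /index_iota subn0; elim: (iota 0 N) => [|i t IH]; first by rewrite !big_nil.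
rewrite big_cons /=; case E : (pickle_inv i) => [k|] /=.
  have Ak : A i = [set k].
    have := @pickle_invK (Zn n) i; rewrite E /= => ik; apply/seteqP; split => x /=.
      by rewrite -ik => /(pcan_inj pickleK).
    by move=> ->.
  by rewrite big_cons Ak integral_countingZ1//; exact: leeD2l.
have -> : A i = set0.
  by apply/seteqP; split => // x /= xi; move: E; rewrite -xi pickleK_inv.
by rewrite integral_set0 add0e.
Qed.

Lemma integral_countingZ_inj f (phi : Zn n -> Zn n) : (forall k, 0 <= f k) ->
  injective phi -> \int[cZ]_k f (phi k) <= \int[cZ]_k f k.
Proof.
move=> f0 ip; apply: integral_countingZ_le => // s us.
rewrite -(big_map phi xpredT f); apply: sum_le_integral_countingZ => //.
by rewrite map_inj_uniq.
Qed.

Lemma integral_countingZ_shift f (m : Zn n) : (forall k, 0 <= f k) ->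
  \int[cZ]_k f (k - m)%R = \int[cZ]_k f k.
Proof.
move=> f0; apply/eqP; rewrite eq_le; apply/andP; split.
  by apply: (integral_countingZ_inj (phi := fun k => k - m)%R) => // x y /addIr.
rewrite -[X in X <= _](_ : \int[cZ]_k f (k + m - m)%R = _).
  apply: (integral_countingZ_inj (f := fun k => f (k - m)%R) (phi := fun k => k + m)%R) => //.
  by move=> x y /addIr.
by apply: eq_integral => k _; rewrite addrK.
Qed.

Lemma integral_countingZ_refl f (k : Zn n) : (forall k, 0 <= f k) ->
  \int[cZ]_m f (k - m)%R = \int[cZ]_m f m.
Proof.
move=> f0; apply/eqP; rewrite eq_le; apply/andP; split.
  by apply: (integral_countingZ_inj (phi := fun m => k - m)%R) => // x y /addrI/oppr_inj.
rewrite -[X in X <= _](_ : \int[cZ]_m f (k - (k - m))%R = _).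
  apply: (integral_countingZ_inj (f := fun m => f (k - m)%R) (phi := fun m => k - m)%R) => //.
  by move=> x y /addrI/oppr_inj.
by apply: eq_integral => m _; rewrite opprB addrC subrK.
Qed.

Lemma ge_integral_countingZ f (k : Zn n) : (forall k, 0 <= f k) -> f k <= \int[cZ]_k f k.
Proof.
by move=> f0; have := sum_le_integral_countingZ (s := [:: k]) f0 isT; rewrite big_seq1.
Qed.

End counting_measure.

(** * Summability of negative powers of the bracket *)

Section bracket_summable.
Context {R : realType} {n : nat}.
Local Notation cZ := (countingZ R n).

Lemma bracket_ge1 (k : Zn n) : 1 <= bracket k :> R.
Proof. by rewrite /bracket lerDl sumr_ge0. Qed.

Lemma bracket_gt0 (k : Zn n) : 0 < bracket k :> R.
Proof. exact: lt_le_trans ltr01 (bracket_ge1 k). Qed.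

Lemma bracket_coord (k : Zn n) i : 1 + `|k ord0 i|%:~R <= bracket k :> R.
Proof. by rewrite /bracket lerD2l (bigD1 i)//= lerDl sumr_ge0. Qed.

(** Submultiplicativity lets decay weights pass through translations. *)
Lemma bracketD (k l : Zn n) : bracket (k + l) <= bracket k * bracket l :> R.
Proof.
have s0 (j : Zn n) : 0 <= \sum_(i < n) (`|j ord0 i|%:~R : R) by rewrite sumr_ge0.
apply: (@le_trans _ _ (1 + \sum_(i < n) (`|k ord0 i|%:~R + `|l ord0 i|%:~R))).
  rewrite /bracket lerD2l; apply: ler_sum => i _.
  by rewrite mxE -intrD ler_int ler_normD.
rewrite big_split/= /bracket; have := s0 k; have := s0 l; nra.
Qed.

Let w (j : int) : R := (1 + `|j|%:~R) ^- 2.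

Let w0 j : 0 <= w j. Proof. by rewrite invr_ge0 sqr_ge0. Qed.

(** The term 2/(M+1) is subtracted for the induction to close: the two new summands 1/(M+2)^2 fit
    between 2/(M+1) and 2/(M+2). *)
Lemma sum_inv_sqr_le (M : nat) : \sum_(a < M.*2.+1) w (a%:Z - M%:Z) <= 3 - 2 / M.+1%:R.
Proof.
elim: M => [|M IH].
  by rewrite big_ord1 /w subrr normr0 addr0 expr1n invr1; lra.
rewrite doubleS big_ord_recl big_ord_recr /=.
have -> : \sum_(i < M.*2.+1) w ((bump 0 i)%:Z - M.+1%:Z) = \sum_(a < M.*2.+1) w (a%:Z - M%:Z).
  by apply: eq_bigr => i _; congr w; rewrite /bump /=; lia.
have e1 : w (0%:Z - M.+1%:Z) = M.+2%:R ^- 2.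
  by rewrite /w sub0r normrN /= -natr1 addrC.
have e2 : w ((bump 0 M.*2.+1)%:Z - M.+1%:Z) = M.+2%:R ^- 2.
  have -> : (bump 0 M.*2.+1)%:Z - M.+1%:Z = M.+1%:Z by rewrite /bump /=; lia.
  by rewrite /w /= -natr1 addrC.
rewrite e1 e2.
have m0 : 0 <= M%:R :> R by [].
have h1 : 0 < M.+1%:R :> R by [].
have h2 : 0 < M.+2%:R :> R by [].
have e3 : M.+2%:R = M.+1%:R + 1 :> R by rewrite natr1.
have : 2 / M.+2%:R + 2 * M.+2%:R ^- 2 <= 2 / M.+1%:R :> R.
  rewrite -(ler_pM2r (mulr_gt0 h1 (mulr_gt0 h2 h2))).
  rewrite (_ : (2 / _ + _) * _ = 2 * M.+1%:R * (M.+2%:R + 1)); last by field; rewrite !gt_eqF.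
  rewrite (_ : 2 / _ * _ = 2 * M.+2%:R * M.+2%:R); last by field; rewrite gt_eqF.
  rewrite e3; nra.
have key (S a b c : R) : S <= 3 - 2 * c -> 2 * a + 2 * b <= 2 * c ->
    b + (S + b) <= 3 - 2 * a by lra.
exact: key IH.
Qed.

(** A finite set sits in a cube [-M, M]^n, and the sum over the cube is the n-th power of a
    one-dimensional sum, which is at most 3. *)
Lemma sum_prod_inv_le (s : seq (Zn n)) : uniq s ->
  \sum_(k <- s) \prod_(i < n) w (k ord0 i) <= 3 ^+ n.
Proof.
move=> us.
pose M := \sum_(k <- s) \sum_(i < n) `|k ord0 i|%N.
have hM k i : k \in s -> (`|k ord0 i| <= M)%N.
  move=> ks; rewrite /M (bigD1_seq k)//= (bigD1 i)//=; lia.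
pose p (k : Zn n) : {ffun 'I_n -> 'I_M.*2.+1} := [ffun i => inord (absz (k ord0 i + M%:Z))].
have pE k i : k \in s -> (p k i)%:Z - M%:Z = k ord0 i.
  move=> ks; rewrite ffunE inordK; first by have := hM _ i ks; lia.
  by have := hM _ i ks; lia.
have pinj : {in s &, injective p}.
  move=> k l ks ls kl; apply/rowP => i.
  by rewrite -(pE k i ks) -(pE l i ls) kl.
pose F (q : {ffun 'I_n -> 'I_M.*2.+1}) : R := \prod_(i < n) w ((q i)%:Z - M%:Z).
have -> : \sum_(k <- s) \prod_(i < n) w (k ord0 i) = \sum_(q <- map p s) F q.
  rewrite big_map; apply: eq_big_seq => k ks; apply: eq_bigr => i _.
  by rewrite pE.
have um : uniq (map p s) by rewrite map_inj_in_uniq.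
rewrite big_uniq//=.
apply: (@le_trans _ _ (\sum_q F q)).
  rewrite [leRHS](bigID (fun q => q \in map p s))/= lerDl sumr_ge0// => q _.
  by apply: prodr_ge0.
rewrite /F -(bigA_distr_bigA (fun (i : 'I_n) (a : 'I_M.*2.+1) => w (a%:Z - M%:Z))) prodr_const card_ord.
rewrite lerXn2r ?nnegrE ?sumr_ge0//; apply: le_trans (sum_inv_sqr_le M) _.
by rewrite gerBl divr_ge0.
Qed.

Lemma bracket_summable : exists N : nat, (\int[cZ]_k ((bracket k ^- N : R)%:E) < +oo)%E.
Proof.
(* Since the bracket dominates every 1 + |k_i|, its power -2n is at most the product of the (1 +
   |k_i|)^-2. *)
exists (2 * n)%N.
apply: (@le_lt_trans _ _ (3 ^+ n)%:E); last by rewrite ltry.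
apply: integral_countingZ_le => [k|s us].
  by rewrite lee_fin invr_ge0 exprn_ge0// ltW// bracket_gt0.
rewrite sumEFin lee_fin; apply: le_trans (sum_prod_inv_le us).
apply: ler_sum => k _; rewrite exprM -exprVn.
have -> : (bracket k ^- 2) ^+ n = \prod_(i < n) (bracket k ^- 2) :> R by rewrite prodr_const card_ord.
apply: ler_prod => i _.
rewrite invr_ge0 sqr_ge0/= /w lef_pV2 ?posrE ?exprn_gt0 ?bracket_gt0 ?ltr_wpDr//.
rewrite ler_pXn2r ?nnegrE; [exact: bracket_coord|by []|by rewrite addr_ge0|].
exact: ltW (bracket_gt0 k).
Qed.

End bracket_summable.

Section lebesgue_norms.
Context d (T : measurableType d) (R : realType).
Variable mu : {measure set T -> \bar R}.
Implicit Types f : T -> R[i].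

Lemma cLnorm1E f : cLnorm mu 1%:E f = (\int[mu]_x (normc (f x))%:E)%E.
Proof.
rewrite /cLnorm Lnorm1; apply: eq_integral => x _.
by rewrite /= ger0_norm ?normc_ge0.
Qed.

Lemma cLnorm2_pow f : (\int[mu]_x (normc (f x) ^+ 2)%:E = cLnorm mu 2%:E f `^ 2)%E.
Proof.
rewrite /cLnorm poweR_Lnorm ?pnatr_eq0//; apply: eq_integral => x _.
rewrite [X in (X `^ _)%E](_ : _ = (normc (f x))%:E); last by rewrite /= ger0_norm ?normc_ge0.
by rewrite poweR_EFin powR_mulrn ?normc_ge0.
Qed.

Lemma cLnorm2_ge0 f : (0 <= cLnorm mu 2%:E f)%E.
Proof. exact: Lnorm_ge0. Qed.

Lemma cLnorm2_lty f : (cLnorm mu 2%:E f < +oo)%E <->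
  (\int[mu]_x (normc (f x) ^+ 2)%:E < +oo)%E.
Proof.
by rewrite cLnorm2_pow; split; [exact: poweR_lty|apply: lty_poweRy].
Qed.

Lemma cLnorm2E f : sqint mu f -> cLnorm mu 2%:E f = (Num.sqrt (nrm2 mu f))%:E.
Proof.
move=> hf; have := cLnorm2_ge0 f; have := cLnorm2_pow f; rewrite nrm2E//.
case: (cLnorm mu 2%:E f) => [r| |].
- by rewrite poweR_EFin lee_fin => -[->] r0; rewrite powR_mulrn// sqrtr_sqr ger0_norm.
- by rewrite poweRyr ?pnatr_eq0.
- by [].
Qed.

End lebesgue_norms.

(** * Smooth periodic functions *)

Section directional_derivatives.
Context {R : realType} {n : nat}.
Local Notation Tn := 'rV[R]_n.
Local Notation dlt i := (delta_mx 0 i : 'rV[R]_n).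
Implicit Types (f g : Tn -> R[i]) (i : 'I_n) (x v : Tn).

Lemma is_derive_line (h : Tn -> R) x v (t df : R) :
  is_derive (x + t *: v) v h df <-> is_derive t (1 : R) (fun s : R => h (x + s *: v)) df.
Proof.
have E : (fun s : R => s^-1 *: ((h \o shift (x + t *: v)) (s *: v) - h (x + t *: v))) =
    (fun s : R => s^-1 *: (((fun s : R => h (x + s *: v)) \o shift t) (s *: 1) - h (x + t *: v))).
  apply/funext => s /=; congr (_ *: (h _ - _)).
  by rewrite [_ *: 1]mulr1 scalerDl addrCA.
split => -[d e]; apply: DeriveDef.
- by move: d; rewrite /derivable E.
- by move: e; rewrite /derive E.
- by move: d; rewrite /derivable E.
- by move: e; rewrite /derive E.
Qed.

(** A relation, so that the existence of the derivative travels with its value; [cpartial] is a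
    total function that does not record it. *)
Definition cderiv i f g : Prop := forall x,
  is_derive x (dlt i) (fun y => ReC (f y)) (ReC (g x)) /\
  is_derive x (dlt i) (fun y => ImC (f y)) (ImC (g x)).

Lemma cderiv_cpartial i f g : cderiv i f g -> cpartial i f = g.
Proof.
by move=> h; apply/funext => x; rewrite /cpartial; have [[_ ->] [_ ->]] := h x; case: (g x).
Qed.

Lemma smooth_cderiv f s i : smooth f -> cderiv i (cpartials s f) (cpartials (i :: s) f).
Proof.
by move=> h x; have [_ _ /(_ i x)[h1 h2]] := h s; split; apply: DeriveDef.
Qed.

Lemma smooth_cpartials f s : smooth f -> smooth (cpartials s f).
Proof.
by move=> h s'; have := h (s' ++ s); rewrite /cpartials foldr_cat.
Qed.

(** A coinduction principle: all iterated partial derivatives stay in a class [P] that is closed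
    under taking one, so continuity and derivability need checking on [P] only. *)
Lemma smooth_coind (P : (Tn -> R[i]) -> Prop) :
  (forall f, P f -> [/\ continuous (fun x => ReC (f x)), continuous (fun x => ImC (f x)) &
     forall i, exists2 g, P g & cderiv i f g]) ->
  forall f, P f -> smooth f.
Proof.
move=> hP f Pf s.
have Ps : P (cpartials s f).
  elim: s => [//|i s IH]; have [_ _ /(_ i)[g Pg fg]] := hP _ IH.
  by rewrite /= (cderiv_cpartial fg).
have [h1 h2 h3] := hP _ Ps; split => // i x.
by have [g _ /(_ x)[[d1 _] [d2 _]]] := h3 i.
Qed.

Lemma smooth_continuous f : smooth f ->
  continuous (fun x => ReC (f x)) /\ continuous (fun x => ImC (f x)).
Proof. by move=> /(_ [::])[]. Qed.

Lemma smooth_cmeasurable f : smooth f -> cmeasurable f.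
Proof. by move=> /smooth_continuous[h1 h2]; exact: cmeasurable_continuous. Qed.

Lemma smooth_cderiv0 f i : smooth f -> cderiv i f (cpartial i f).
Proof. by move=> /(@smooth_cderiv f [::] i). Qed.

Lemma cderiv_lin i (a : R[i]) f f' g g' : cderiv i f f' -> cderiv i g g' ->
  cderiv i (fun x => a * f x + g x) (fun x => a * f' x + g' x).
Proof.
move=> hf hg x; have [fR fI] := hf x; have [gR gI] := hg x; split.
- have -> : (fun y => ReC (a * f y + g y)) =
    (fun y => ReC a *: ReC (f y) - ImC a *: ImC (f y) + ReC (g y)).
    by apply/funext => y; rewrite ReD ReM.
  by apply: is_derive_eq; rewrite ReD ReM.
- have -> : (fun y => ImC (a * f y + g y)) =
    (fun y => ReC a *: ImC (f y) + ImC a *: ReC (f y) + ImC (g y)).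
    by apply/funext => y; rewrite ImD ImM.
  by apply: is_derive_eq; rewrite ImD ImM.
Qed.

Lemma continuous_lin (a b : R) (h k : Tn -> R) : continuous h -> continuous k ->
  continuous (fun x => a * h x + b * k x).
Proof.
move=> ch ck x.
exact: (cvgD (cvgM (cvg_cst a) (ch x)) (cvgM (cvg_cst b) (ck x))).
Qed.

Lemma continuous_ccomb (a : R[i]) f g :
  continuous (fun x => ReC (f x)) -> continuous (fun x => ImC (f x)) ->
  continuous (fun x => ReC (g x)) -> continuous (fun x => ImC (g x)) ->
  continuous (fun x => ReC (a * f x + g x)) /\ continuous (fun x => ImC (a * f x + g x)).
Proof.
move=> h1 h2 h3 h4; split.
- have -> : (fun x => ReC (a * f x + g x)) =
      (fun x => ReC a * ReC (f x) + - ImC a * ImC (f x) + ReC (g x)).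
    by apply/funext => x; rewrite ReD ReM mulNr.
  move=> x; exact: (cvgD (@continuous_lin (ReC a) (- ImC a) _ _ h1 h2 x) (h3 x)).
- have -> : (fun x => ImC (a * f x + g x)) =
      (fun x => ReC a * ImC (f x) + ImC a * ReC (f x) + ImC (g x)).
    by apply/funext => x; rewrite ImD ImM.
  move=> x; exact: (cvgD (@continuous_lin (ReC a) (ImC a) _ _ h2 h1 x) (h4 x)).
Qed.

Lemma smooth_lin (a : R[i]) f g : smooth f -> smooth g -> smooth (fun x => a * f x + g x).
Proof.
move=> hf hg.
apply: (@smooth_coind (fun h => exists f g, [/\ smooth f, smooth g & h = fun x => a * f x + g x])).
  move=> _ [{hf hg}f [{}g [hf hg ->]]].
  have [cf1 cf2] := smooth_continuous hf; have [cg1 cg2] := smooth_continuous hg.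
  have [c1 c2] := continuous_ccomb a cf1 cf2 cg1 cg2; split => // i.
  exists (fun x => a * cpartial i f x + cpartial i g x).
    exists (cpartial i f), (cpartial i g); split; last reflexivity.
    - exact: (@smooth_cpartials f [:: i]).
    - exact: (@smooth_cpartials g [:: i]).
  by apply: cderiv_lin; exact: smooth_cderiv0.
by exists f, g.
Qed.

Lemma cpartials_lin s (a : R[i]) f g : smooth f -> smooth g ->
  cpartials s (fun x => a * f x + g x) = (fun x => a * cpartials s f x + cpartials s g x).
Proof.
move=> hf hg; elim: s => [//|i s IH]; rewrite /= IH.
apply: cderiv_cpartial; apply: cderiv_lin; exact: smooth_cderiv.
Qed.

Lemma is_derive_cis (a b t : R) :
  is_derive t (1 : R) (fun s : R => ReC (cis (a + s * b))) (- (2 * pi * b) * ImC (cis (a + t * b))) /\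
  is_derive t (1 : R) (fun s : R => ImC (cis (a + s * b))) (2 * pi * b * ReC (cis (a + t * b))).
Proof.
rewrite /cis/=; move: (2 * pi) => c; split.
- by apply: is_derive_eq; rewrite /GRing.scale/=; ring.
- by apply: is_derive_eq; rewrite /GRing.scale/=; ring.
Qed.

Lemma is_derive_line0 (h : Tn -> R) x v (df : R) :
  is_derive 0 (1 : R) (fun s : R => h (x + s *: v)) df -> is_derive x v h df.
Proof. by move/is_derive_line; rewrite scale0r addr0. Qed.

Lemma cderiv_chr i (k : Zn n) :
  cderiv i (chr k) (fun x => (0 +i* (2 * pi * (k ord0 i)%:~R)) * chr k x).
Proof.
move=> x.
have E s : chr k (x + s *: dlt i) = cis (dot k x + s * (k ord0 i)%:~R).
  rewrite /chr dotDr; congr (cis (_ + _)).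
  by rewrite -dot_delta /dot mulr_sumr; apply: eq_bigr => j _; rewrite !mxE mulrCA.
have E0 : chr k x = cis (dot k x + 0 * (k ord0 i)%:~R) by rewrite mul0r addr0.
have [d1 d2] := is_derive_cis (dot k x) (k ord0 i)%:~R 0.
split; apply: is_derive_line0.
- under eq_fun do rewrite E.
  by rewrite E0 ReM mul0r sub0r -mulNr.
- under eq_fun do rewrite E.
  by rewrite E0 ImM mul0r add0r.
Qed.

Lemma continuous_dot (k : Zn n) : continuous (dot k : Tn -> R).
Proof.
rewrite /dot; elim: (index_enum _) => [|i r IH].
  under eq_fun do rewrite big_nil; exact: cst_continuous.
have -> : (fun w : Tn => \sum_(j <- i :: r) (k ord0 j)%:~R * w ord0 j) =
    (fun w : Tn => (k ord0 i)%:~R * w ord0 i + 1 * \sum_(j <- r) (k ord0 j)%:~R * w ord0 j).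
  by apply/funext => w; rewrite big_cons mul1r.
apply: continuous_lin => // x; exact: coord_continuous.
Qed.

Lemma continuous_chr (k : Zn n) :
  continuous (fun x : Tn => ReC (chr k x)) /\ continuous (fun x : Tn => ImC (chr k x)).
Proof.
split => x.
- apply: (@continuous_comp _ _ _ (dot k) (fun t : R => ReC (cis t))); first exact: continuous_dot.
  have := @continuous_cis_Re R 1 (dot k x); under eq_fun do rewrite mul1r.
  by [].
- apply: (@continuous_comp _ _ _ (dot k) (fun t : R => ImC (cis t))); first exact: continuous_dot.
  have := @continuous_cis_Im R 1 (dot k x); under eq_fun do rewrite mul1r.
  by [].
Qed.

Lemma cderiv_cst i (c : R[i]) : cderiv i (fun=> c) (fun=> 0).
Proof. by move=> x; split; apply: is_derive_cst. Qed.

Lemma smooth_cst (c : R[i]) : smooth (fun _ : Tn => c).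
Proof.
apply: (@smooth_coind (fun h => exists c, h = fun=> c)); last by exists c.
move=> _ [{}c ->]; split => [||i]; [exact: cst_continuous|exact: cst_continuous|].
by exists (fun=> 0); [exists 0|exact: cderiv_cst].
Qed.

(** Up to a unimodular constant, a fibre of a time-frequency shifted and conjugated window has this
    shape. *)
Definition twist (k : Zn n) (w : Tn) f : Tn -> R[i] :=
  fun x => chr k x * conjc (f (x - w)).

Lemma is_derive_shift (h : Tn -> R) (x w v : Tn) df :
  is_derive (x - w) v h df -> is_derive x v (fun y => h (y - w)) df.
Proof.
move=> hd; apply: is_derive_line0.
have -> : (fun s : R => h (x + s *: v - w)) = (fun s => h ((x - w) + s *: v)).
  by apply/funext => s; rewrite addrAC.
by apply/is_derive_line; rewrite scale0r addr0.
Qed.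

(** The product rule. The multiplier 2 pi i k_i of the character is moved under the conjugation,
    hence its sign; twists are thereby closed under differentiation. *)
Lemma cderiv_twist i k w f g : cderiv i f g -> cderiv i (twist k w f)
  (twist k w (fun x => (0 -i* (2 * pi * (k ord0 i)%:~R)) * f x + g x)).
Proof.
move=> hf x; have [fR fI] := hf (x - w).
have [cR cI] := cderiv_chr i k x.
have dR := is_derive_shift fR; have dI := is_derive_shift fI.
move: cR cI; rewrite ReM ImM /= !mul0r sub0r add0r.
move: (2 * pi * _) => c cR cI.
split.
- have -> : (fun y => ReC (twist k w f y)) = (fun y => ReC (chr k y) * ReC (f (y - w)) + ImC (chr k y) * ImC (f (y - w))).
    by apply/funext => y; rewrite /twist ReM ReJ ImJ mulrN opprK.
  apply: is_derive_eq; rewrite /twist ReM ReJ ImJ ReD ImD ReM ImM /GRing.scale/=; ring.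
- have -> : (fun y => ImC (twist k w f y)) = (fun y => ImC (chr k y) * ReC (f (y - w)) - ReC (chr k y) * ImC (f (y - w))).
    by apply/funext => y; rewrite /twist ImM ReJ ImJ mulrN addrC.
  apply: is_derive_eq; rewrite /twist ImM ReJ ImJ ReD ImD ReM ImM /GRing.scale/=; ring.
Qed.

Lemma smooth_twist k w f : smooth f -> smooth (twist k w f).
Proof.
move=> hf.
apply: (@smooth_coind (fun h => exists2 f, smooth f & h = twist k w f)); last by exists f.
move=> _ [{hf}f hf ->].
have [c1 c2] := smooth_continuous hf; have [k1 k2] := continuous_chr k.
have sh (h : Tn -> R) : continuous h -> continuous (fun y : Tn => h (y - w)).
  move=> ch y; have s1 : (fun y : Tn => y - w) @ y --> y - w.
    exact: (cvgB cvg_id (cvg_cst w)).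
  exact: (cvg_comp _ _ s1 (ch _)).
split.
- under eq_fun do rewrite /twist ReM ReJ ImJ mulrN opprK.
  by move=> x; exact: (cvgD (cvgM (k1 x) (sh _ c1 x)) (cvgM (k2 x) (sh _ c2 x))).
- under eq_fun do rewrite /twist ImM ReJ ImJ mulrN.
  by move=> x; exact: (cvgD (cvgN (cvgM (k1 x) (sh _ c2 x))) (cvgM (k2 x) (sh _ c1 x))).
- move=> i; exists (twist k w (fun x => (0 -i* (2 * pi * (k ord0 i)%:~R)) * f x + cpartial i f x)).
    eexists; last reflexivity.
    exact: (smooth_lin _ hf (smooth_cpartials [:: i] hf)).
  by apply: cderiv_twist; exact: smooth_cderiv0.
Qed.


Lemma twist0 k f : twist k 0 f = (fun x => chr k x * conjc (f x)).
Proof. by apply/funext => x; rewrite /twist subr0. Qed.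

Lemma periodic_int f (z : int) (i : 'I_n) x : periodic_Zn f -> f (x + z%:~R *: dlt i) = f x.
Proof.
move=> pf.
have pn (m : nat) y : f (y + m%:R *: dlt i) = f y.
  elim: m y => [|m IH] y; first by rewrite scale0r addr0.
  by rewrite -natr1 scalerDl scale1r addrA pf.
case: z => m; first exact: pn.
by rewrite NegzE intrN scaleNr -[in RHS](subrK (m.+1%:R *: dlt i) x) pn.
Qed.

Lemma mvt_line (h h' : Tn -> R) i x (t M : R) :
  (forall y, is_derive y (dlt i) h (h' y)) -> (forall y, `|h' y| <= M) ->
  `|h (x + t *: dlt i) - h x| <= M * `|t|.
Proof.
move=> dh hM.
have dl (s : R) : is_derive s (1 : R) (fun s : R => h (x + s *: dlt i)) (h' (x + s *: dlt i)).
  by apply/is_derive_line.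
have ct : continuous (fun s : R => h (x + s *: dlt i)).
  by move=> s; have [d _] := dl s; apply: differentiable_continuous; exact/derivable1_diffP.
have key (a b : R) : a < b -> `|h (x + b *: dlt i) - h (x + a *: dlt i)| <= M * (b - a).
  move=> ab; have [c _ ->] := @MVT R _ _ a b ab (fun s _ => dl s) (continuous_subspaceT ct).
  by rewrite normrM [`|b - a|]ger0_norm ?subr_ge0 ?(ltW ab)// ler_wpM2r// subr_ge0 ltW.
have [t0|t0|<-] := ltgtP 0 t.
- by have := key 0 t t0; rewrite scale0r addr0 subr0 [`|t|]gtr0_norm.
- have := key t 0 t0; rewrite scale0r addr0 sub0r distrC.
  by rewrite [`|t|]ltr0_norm.
- by rewrite scale0r addr0 subrr normr0 mulr0.
Qed.

(** Periodicity replaces t by its offset from the nearest integer, which the chord dominates. The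
    mean value theorem is applied to real and imaginary parts, hence the factor 2. *)
Lemma chord_step f f' i (M t : R) x : cderiv i f f' -> (forall y, normc (f' y) <= M) ->
  periodic_Zn f -> normc (f (x + t *: dlt i) - f x) <= 2 * M * normc (1 - cis t).
Proof.
move=> df fM pf; have [z hz] := dist_chord t.
have -> : f (x + t *: dlt i) = f (x + (t - z%:~R) *: dlt i).
  by rewrite -[in LHS](subrK z%:~R t) scalerDl addrA periodic_int.
have M0 : 0 <= M by apply: le_trans (fM 0); exact: normc_ge0.
apply: (@le_trans _ _ (2 * M * `|t - z%:~R|)); last by rewrite ler_wpM2l// mulr_ge0.
apply: le_trans (normc_le_ReIm _) _; rewrite ReD ImD ReN ImN.
rewrite -mulrA mulrDl mul1r; apply: lerD.
- apply: (mvt_line (h := fun y => ReC (f y)) (h' := fun y => ReC (f' y))) => y.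
    by have [] := df y.
  exact: le_trans (normc_Re _) (fM y).
- apply: (mvt_line (h := fun y => ImC (f y)) (h' := fun y => ImC (f' y))) => y.
    by have [] := df y.
  exact: le_trans (normc_Im _) (fM y).
Qed.

(** Go from t to x one coordinate at a time. This is the hypothesis that [fmean_bound] requires. *)
Lemma chord_lipschitz f (M : R) : smooth f -> periodic_Zn f ->
  (forall i y, normc (cpartial i f y) <= M) -> forall x t,
  normc (f x - f t) <= 2 * M * \sum_(i < n) normc (1 - cis (x ord0 i - t ord0 i)).
Proof.
move=> sf pf fM x t.
have key (r : seq 'I_n) : normc (f (t + \sum_(i <- r) (x ord0 i - t ord0 i) *: dlt i) - f t) <=
    2 * M * \sum_(i <- r) normc (1 - cis (x ord0 i - t ord0 i)).
  elim: r => [|i r IH]; first by rewrite !big_nil addr0 subrr normc_0 mulr0.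
  rewrite !big_cons [X in t + X]addrC addrA mulrDr.
  set u := t + _ in IH *.
  rewrite -[f (u + _)](subrK (f u)) -addrA; apply: le_trans (normc_D _ _) _.
  by apply: lerD => //; apply: chord_step => //; exact: smooth_cderiv0.
have := key (index_enum _).
have -> : \sum_(i <- index_enum 'I_n) (x ord0 i - t ord0 i) *: dlt i = x - t.
  by rewrite [RHS]row_sum_delta; apply: eq_bigr => i _; rewrite !mxE.
by rewrite [t + _]addrC subrK.
Qed.


Lemma periodic_cpartial i f : periodic_Zn f -> periodic_Zn (cpartial i f).
Proof.
move=> pf x j; rewrite /cpartial /derive /=.
have E (h : R) (y : Tn) : f (h *: dlt i + (y + dlt j)) = f (h *: dlt i + y).
  by rewrite addrA pf.
have El (p : R[i] -> R) : (fun h : R => h^-1 *: (p (f (h *: dlt i + (x + dlt j))) - p (f (x + dlt j)))) =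
    (fun h : R => h^-1 *: (p (f (h *: dlt i + x)) - p (f x))).
  by apply/funext => h; rewrite E pf.
by rewrite (El (@complex.Re R)) (El (@complex.Im R)).
Qed.

Lemma periodic_cpartials s f : periodic_Zn f -> periodic_Zn (cpartials s f).
Proof. by move=> pf; elim: s => [//|i s IH]; exact: periodic_cpartial. Qed.

End directional_derivatives.

(** * Integration by parts and Fourier coefficients of derivatives *)

Section integration_by_parts.
Context {R : realType}.
Local Notation unif := (@unif R).

Lemma rV_cons_addl n (a t : R) (w : 'rV[R]_n) :
  rV_cons (a + t, w) = rV_cons (a, w) + t *: (delta_mx 0 ord0 : 'rV[R]_n.+1).
Proof.
apply/rowP => i; rewrite !mxE eqxx/=; case: unliftP => [j ->|->]/=.
  by rewrite mulr0 addr0.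
by rewrite mulr1.
Qed.

Lemma rV_cons_addr n (a t : R) (w : 'rV[R]_n) (j : 'I_n) :
  rV_cons (a, w + t *: delta_mx 0 j) =
  rV_cons (a, w) + t *: (delta_mx 0 (lift ord0 j) : 'rV[R]_n.+1).
Proof.
apply/rowP => i; rewrite !mxE eqxx/=; case: unliftP => [k ->|->]/=.
  by rewrite !mxE eqxx (inj_eq lift_inj).
by rewrite mulr0 addr0.
Qed.

Lemma continuous_rV_cons_r n (a : R) : continuous (fun w : 'rV[R]_n => rV_cons (a, w)).
Proof.
move=> w A /nbhs_ballP[e e0 sub]; apply/nbhs_ballP; exists e => //= y [_ hb].
apply: sub; split => // i j; rewrite !mxE.
by case: unliftP => [k _|_] /=; [exact: hb|exact: ballxx].
Qed.

Lemma continuous_rV_cons_l n (w : 'rV[R]_n) : continuous (fun a : R => rV_cons (a, w)).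
Proof.
move=> a A /nbhs_ballP[e e0 sub]; apply/nbhs_ballP; exists e => //= y hb.
apply: sub; split => // i j; rewrite !mxE.
by case: unliftP => [k _|_] /=; [exact: ballxx|exact: hb].
Qed.

(** Induction on the dimension with Fubini. If i is the first coordinate, the inner integral
    vanishes by the fundamental theorem of calculus; otherwise freeze the first coordinate. *)
Lemma haar_derive0 n (i : 'I_n) (h h' : 'rV[R]_n -> R) (M : R) :
  continuous h' -> (forall x, `|h' x| <= M) ->
  (forall x, is_derive x (delta_mx 0 i : 'rV[R]_n) h (h' x)) ->
  (forall x, h (x + delta_mx 0 i) = h x) ->
  cintegral (haar R n) (fun x => (h' x)%:C) = 0.
Proof.
elim: n i h h' => [[]//|n IH] i h h' ch' h'M dh ph.
have ih : cintegrable (haar R n.+1) (fun x => (h' x)%:C).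
  apply: (@cintegrable_bounded _ _ _ _ _ M).
    by apply: cmeasurable_real; exact: continuous_measurable_rV.
  by move=> x; rewrite normc_real.
have [_ ip] := (cintegrable_haarS _).1 ih.
rewrite cintegral_haarS//.
case: (unliftP ord0 i) => [j ij|i0].
- have [_ <-] := cfubini12 ip.
  rewrite (eq_cintegral _ (g := fun=> 0)) ?cintegral0// => a.
  apply: (IH j (fun w => h (rV_cons (a, w))) (fun w => h' (rV_cons (a, w)))).
  + by move=> w; exact: (cvg_comp _ _ (@continuous_rV_cons_r _ a w) (ch' _)).
  + by move=> w; exact: h'M.
  + move=> w; apply: is_derive_line0.
    under eq_fun do rewrite rV_cons_addr -ij.
    by apply/is_derive_line; rewrite scale0r addr0.
  + by move=> w; rewrite -[delta_mx 0 j]scale1r rV_cons_addr -ij scale1r ph.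
- have [_ <-] := cfubini21 ip.
  rewrite (eq_cintegral _ (g := fun=> 0)) ?cintegral0// => w.
  rewrite cintegral_real; congr _%:C.
  apply: (Rintegral_deriv_periodic (F := fun a : R => h (rV_cons (a, w)))).
  + by move=> a; exact: (cvg_comp _ _ (@continuous_rV_cons_l _ w a) (ch' _)).
  + move=> a.
    have -> : (fun a : R => h (rV_cons (a, w))) = (fun s : R => h (rV_cons (0, w) + s *: delta_mx 0 i)).
      by apply/funext => s; rewrite i0 -rV_cons_addl add0r.
    have -> : rV_cons (a, w) = rV_cons (0, w) + a *: delta_mx 0 i.
      by rewrite i0 -rV_cons_addl add0r.
    by apply/is_derive_line.
  + by rewrite -[1 in RHS]add0r rV_cons_addl -i0 scale1r ph.
Qed.

Context {n : nat}.
Local Notation Tn := 'rV[R]_n.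
Implicit Types (f g : Tn -> R[i]).

Lemma periodic_chr (k : Zn n) : periodic_Zn (chr k : Tn -> R[i]).
Proof. by move=> x i; rewrite chrDr {2}/chr dot_delta cis_int mulr1. Qed.

Lemma periodic_twist k (w : Tn) f : periodic_Zn f -> periodic_Zn (twist k w f).
Proof. by move=> pf x i; rewrite /twist periodic_chr addrAC pf. Qed.

Definition dmul (i : 'I_n) (k : Zn n) : R[i] := 0 +i* (2 * pi * (k ord0 i)%:~R).

(** The derivative of the periodic function [chr k] conj(f) has integral 0. Conjugated, this reads
    conj(c) f^(k) + (d_i f)^(k) = 0, and c = 2 pi i k_i is purely imaginary. *)
Lemma fcoef_cpartial i f (k : Zn n) (M : R) : smooth f -> periodic_Zn f ->
  (forall x, normc (f x) <= M) -> (forall x, normc (cpartial i f x) <= M) ->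
  fcoef (cpartial i f) k = dmul i k * fcoef f k.
Proof.
move=> sf pf fM f'M.
set c := dmul i k.
have sf' : smooth (cpartial i f) by exact: (@smooth_cpartials R n f [:: i]).
pose g := twist k 0 (fun x => conjc c * f x + cpartial i f x).
have dg : cderiv i (twist k 0 f) g by exact: cderiv_twist (smooth_cderiv0 i sf).
have sg : smooth g by apply: smooth_twist; exact: smooth_lin.
have [cg1 cg2] := smooth_continuous sg.
have pt : periodic_Zn (twist k 0 f) by exact: periodic_twist.
have gM x : normc (g x) <= normc c * M + M.
  rewrite /g /twist normc_M normc_chr mul1r normcJ; apply: le_trans (normc_D _ _) _.
  by rewrite normc_M normcJ lerD// ler_wpM2l// normc_ge0.
have I1 : cintegral (haar R n) (fun x => (ReC (g x))%:C) = 0.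
  apply: (@haar_derive0 n i (fun x => ReC (twist k 0 f x)) (fun x => ReC (g x)) (normc c * M + M)) => // x.
  - exact: le_trans (normc_Re _) (gM x).
  - by have [] := dg x.
  - by rewrite pt.
have I2 : cintegral (haar R n) (fun x => (ImC (g x))%:C) = 0.
  apply: (@haar_derive0 n i (fun x => ImC (twist k 0 f x)) (fun x => ImC (g x)) (normc c * M + M)) => // x.
  - exact: le_trans (normc_Im _) (gM x).
  - by have [] := dg x.
  - by rewrite pt.
have ig : cintegral (haar R n) g = 0.
  by move: I1 I2; rewrite !cintegral_real => -[I1] [I2]; rewrite /cintegral I1 I2.
have mf := smooth_cmeasurable sf; have mf' := smooth_cmeasurable sf'.
have i1 : cintegrable (haar R n) (fun x => f x * conjc (chr k x)).
  by apply: chr_mulr_cintegrable; exact: (@cintegrable_bounded _ _ _ _ _ M).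
have i2 : cintegrable (haar R n) (fun x => cpartial i f x * conjc (chr k x)).
  by apply: chr_mulr_cintegrable; exact: (@cintegrable_bounded _ _ _ _ _ M).
have gE x : conjc (g x) = conjc c * (f x * conjc (chr k x)) + cpartial i f x * conjc (chr k x).
  by rewrite /g twist0 conjcM conjcK; ring.
have : conjc (cintegral (haar R n) g) = conjc c * fcoef f k + fcoef (cpartial i f) k.
  rewrite -cintegralJ; last by apply: (@cintegrable_bounded _ _ _ _ _ (normc c * M + M)) => //; exact: smooth_cmeasurable.
  under eq_cintegral do rewrite gE.
  by rewrite cintegralD ?cintegralZ//; exact: cintegrableZ.
rewrite ig conjc0 => /esym/eqP; rewrite addrC addr_eq0 => /eqP ->.
by rewrite -mulNr; congr (_ * _); rewrite /c /dmul; apply: ReImP => /=; rewrite ?oppr0 ?opprK.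
Qed.

Lemma fcoef_cpartials s f (k : Zn n) (M : R) : smooth f -> periodic_Zn f ->
  (forall s' x, (size s' <= size s)%N -> normc (cpartials s' f x) <= M) ->
  fcoef (cpartials s f) k = \prod_(i <- s) dmul i k * fcoef f k.
Proof.
move=> sf pf; elim: s => [|i s IH] fM; first by rewrite big_nil mul1r.
rewrite big_cons -mulrA -IH; last by move=> s' x ss; apply: fM => /=; exact: leqW.
apply: (@fcoef_cpartial i _ k M).
- exact: smooth_cpartials.
- exact: periodic_cpartials.
- by move=> x; apply: fM => /=.
- by move=> x; apply: (fM (i :: s)).
Qed.

Lemma cpartials_chr s (k : Zn n) :
  cpartials s (chr k : Tn -> R[i]) = (fun x => \prod_(i <- s) dmul i k * chr k x).
Proof.
elim: s => [|i s IH]; first by apply/funext => x; rewrite big_nil mul1r.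
rewrite /= IH; apply: cderiv_cpartial => x.
have h := @cderiv_lin R n i (\prod_(i <- s) dmul i k) _ _ _ _ (cderiv_chr i k) (cderiv_cst i 0).
have -> : \prod_(j <- i :: s) dmul j k * chr k x = \prod_(j <- s) dmul j k * (dmul i k * chr k x) + 0.
  by rewrite big_cons addr0; ring.
have := h x; by under eq_fun do rewrite addr0; under [X in _ /\ is_derive _ _ X _ -> _]eq_fun do rewrite addr0.
Qed.

Lemma smooth_chr (k : Zn n) : smooth (chr k : Tn -> R[i]).
Proof.
have := smooth_twist k 0 (smooth_cst (n := n) (1 : R[i])).
by rewrite twist0; under eq_fun do rewrite conjc1 mulr1.
Qed.

Lemma smooth_sum (I : Type) (r : seq I) (a : I -> R[i]) (F : I -> Tn -> R[i]) :
  (forall i, smooth (F i)) -> smooth (fun x => \sum_(i <- r) a i * F i x).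
Proof.
move=> sF; elim: r => [|i r IH].
  by under eq_fun do rewrite big_nil; exact: smooth_cst.
by under eq_fun do rewrite big_cons; exact: (smooth_lin _ (sF i) IH).
Qed.

Lemma cpartials_cst0 s : cpartials s (fun _ : Tn => 0 : R[i]) = (fun=> 0).
Proof. by elim: s => [//|i s /= ->]; apply: cderiv_cpartial; exact: cderiv_cst. Qed.

Lemma cpartials_sum (I : Type) (r : seq I) (a : I -> R[i]) (F : I -> Tn -> R[i]) s :
  (forall i, smooth (F i)) ->
  cpartials s (fun x => \sum_(i <- r) a i * F i x) = (fun x => \sum_(i <- r) a i * cpartials s (F i) x).
Proof.
move=> sF; elim: r => [|i r IH].
  under eq_fun do rewrite big_nil.
  by rewrite cpartials_cst0; apply/funext => x; rewrite big_nil.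
under eq_fun do rewrite big_cons.
rewrite cpartials_lin//; last exact: smooth_sum.
by rewrite IH; apply/funext => x; rewrite big_cons.
Qed.

End integration_by_parts.


(** * Schwartz functions on the phase space *)

Section schwartz.
Context {R : realType} {n : nat}.
Local Notation Tn := 'rV[R]_n.
Implicit Types (F G : Zn n * Tn -> R[i]).

Definition sbound (N : nat) F (c : R) : Prop := forall s m x, (size s <= N)%N ->
  bracket m ^+ N * normc (cpartials s (fun t => F (m, t)) x) <= c.

Lemma snorm_ZTP N F (c : R) : (snorm_ZT N F <= c%:E)%E <-> sbound N F c.
Proof.
split => [h s m x sN|h].
  rewrite -lee_fin; apply: le_trans h; apply: ereal_sup_ubound.
  by exists s, m, x.
by apply: ge_ereal_sup => _ [s [m [x [sN ->]]]]; rewrite lee_fin; exact: h.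
Qed.

Lemma sbound_ge0 N F c : sbound N F c -> 0 <= c.
Proof.
move=> /(_ [::] 0 0 isT); apply: le_trans.
by rewrite mulr_ge0 ?normc_ge0// exprn_ge0// ltW// bracket_gt0.
Qed.

Lemma schwartz_ZTP F : schwartz_ZT F <->
  (forall m, smooth (fun t => F (m, t)) /\ periodic_Zn (fun t => F (m, t))) /\
  (forall N, exists c, sbound N F c).
Proof.
split=> -[h1 h2]; split => // N; last first.
  by have [c /snorm_ZTP hc] := h2 N; apply: le_lt_trans hc _; rewrite ltry.
have := h2 N; case E : (snorm_ZT N F) => [c| |]// _.
  by exists c; apply/snorm_ZTP; rewrite E.
by exists 0; apply/snorm_ZTP; rewrite E leNye.
Qed.

Lemma sbound_mono N N' F c : (N <= N')%N -> sbound N' F c -> sbound N F c.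
Proof.
move=> NN h s m x sN; apply: le_trans (h s m x (leq_trans sN NN)).
by rewrite ler_wpM2r ?normc_ge0// ler_weXn2l// bracket_ge1.
Qed.

Lemma sbound_normc N F c s m x : sbound N F c -> (size s <= N)%N ->
  normc (cpartials s (fun t => F (m, t)) x) <= c.
Proof.
move=> h sN; apply: le_trans (h s m x sN).
by rewrite ler_peMl ?normc_ge0// exprn_ege1// bracket_ge1.
Qed.

Lemma sbound_lin N (a : R[i]) F G c c' :
  (forall m, smooth (fun t => F (m, t))) -> (forall m, smooth (fun t => G (m, t))) ->
  sbound N F c -> sbound N G c' -> sbound N (fun z => a * F z + G z) (normc a * c + c').
Proof.
move=> sF sG hF hG s m x sN; rewrite cpartials_lin//.
apply: (@le_trans _ _ (bracket m ^+ N * (normc a * normc (cpartials s (fun t => F (m, t)) x) +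
   normc (cpartials s (fun t => G (m, t)) x)))).
  rewrite ler_wpM2l ?exprn_ge0 ?(ltW (bracket_gt0 _))//.
  by apply: le_trans (normc_D _ _) _; rewrite normc_M.
rewrite mulrDr mulrCA; apply: lerD; last exact: hG.
by rewrite ler_wpM2l ?normc_ge0//; exact: hF.
Qed.

Lemma schwartz_lin (a : R[i]) F G : schwartz_ZT F -> schwartz_ZT G ->
  schwartz_ZT (fun z => a * F z + G z).
Proof.
move=> /schwartz_ZTP[sF bF] /schwartz_ZTP[sG bG]; apply/schwartz_ZTP; split => [m|N].
  split; first by apply: smooth_lin; [case: (sF m)|case: (sG m)].
  by move=> x i; rewrite /= (sF m).2 (sG m).2.
have [c hc] := bF N; have [c' hc'] := bG N; exists (normc a * c + c').
by apply: sbound_lin => // m; [case: (sF m)|case: (sG m)].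
Qed.

Lemma cpartials0 s : cpartials s (fun _ : Tn => 0 : R[i]) = (fun=> 0).
Proof. exact: cpartials_cst0. Qed.

Lemma sbound0 N : sbound N (fun _ : Zn n * Tn => 0) 0.
Proof. by move=> s m x _; rewrite cpartials0 normc_0 mulr0. Qed.

Lemma schwartz0 : schwartz_ZT (fun _ : Zn n * Tn => 0 : R[i]).
Proof.
apply/schwartz_ZTP; split => [m|N]; last by exists 0; exact: sbound0.
by split; first exact: smooth_cst.
Qed.

Lemma smooth_scale (a : R[i]) (f : Tn -> R[i]) : smooth f -> smooth (fun x => a * f x).
Proof.
by move=> sf; have := smooth_lin a sf (smooth_cst 0); under eq_fun do rewrite addr0.
Qed.

Lemma cpartials_scale s (a : R[i]) (f : Tn -> R[i]) : smooth f ->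
  cpartials s (fun x => a * f x) = (fun x => a * cpartials s f x).
Proof.
move=> sf; have := @cpartials_lin _ _ s a f (fun=> 0) sf (smooth_cst 0).
under eq_fun do rewrite addr0; move=> ->; apply/funext => x.
by rewrite cpartials0 addr0.
Qed.

Lemma schwartz_scale (a : R[i]) F : schwartz_ZT F -> schwartz_ZT (fun z => a * F z).
Proof.
by move=> sF; have := schwartz_lin a sF schwartz0; under eq_fun do rewrite addr0.
Qed.

Lemma schwartzB F G : schwartz_ZT F -> schwartz_ZT G -> schwartz_ZT (fun z => F z - G z).
Proof.
move=> sF sG; have := schwartz_lin (-1) sG sF.
by under eq_fun do rewrite mulN1r addrC.
Qed.

Lemma schwartz_cmeasurable F : schwartz_ZT F -> cmeasurable F.
Proof.
move=> [h _]; apply: cmeasurable_Zn_prod => m.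
by apply: smooth_cmeasurable; case: (h m).
Qed.

Definition echr (q : Zn n * Zn n) : Zn n * Tn -> R[i] :=
  fun z => if z.1 == q.1 then chr q.2 z.2 else 0.

(* [dmul i k] is the multiplier of the i-th partial derivative on [chr k]. *)
Definition mulsum (k : Zn n) : R := \sum_(i < n) normc (dmul i k : R[i]).

Lemma mulsum_ge0 k : 0 <= mulsum k.
Proof. by apply: sumr_ge0 => i _; exact: normc_ge0. Qed.

Lemma normc_dmul i k : normc (dmul i k : R[i]) <= mulsum k.
Proof. by rewrite /mulsum (bigD1 i)//= lerDl sumr_ge0// => j _; exact: normc_ge0. Qed.

Lemma prod_dmul_le s k N : (size s <= N)%N ->
  normc (\prod_(i <- s) dmul i k : R[i]) <= (1 + mulsum k) ^+ N.
Proof.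
move=> sN; have h1 : 1 <= 1 + mulsum k by rewrite lerDl mulsum_ge0.
apply: (@le_trans _ _ ((1 + mulsum k) ^+ size s)); last by rewrite ler_weXn2l.
elim: s {sN} => [|i s IH]; first by rewrite big_nil /= expr0n addr0 expr1n sqrtr1.
rewrite big_cons normc_M exprS; apply: ler_pM => //; rewrite ?normc_ge0//.
by apply: le_trans (normc_dmul i k) _; rewrite lerDr.
Qed.

Lemma echr_section q m : (fun t => echr q (m, t)) = if m == q.1 then chr q.2 else fun=> 0.
Proof. by apply/funext => t; rewrite /echr/=; case: ifP. Qed.

Lemma schwartz_echr q : schwartz_ZT (echr q).
Proof.
apply/schwartz_ZTP; split => [m|N].
  rewrite echr_section; case: ifP => _; last by split; first exact: smooth_cst.
  by split; [exact: smooth_chr|exact: periodic_chr].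
exists (bracket q.1 ^+ N * (1 + mulsum q.2) ^+ N) => s m x sN.
rewrite echr_section; case: ifP => [/eqP ->|_]; last first.
  rewrite cpartials0 normc_0 mulr0 mulr_ge0 ?exprn_ge0 ?(ltW (bracket_gt0 _))//.
  by rewrite addr_ge0// mulsum_ge0.
rewrite ler_wpM2l ?exprn_ge0 ?(ltW (bracket_gt0 _))//.
by rewrite cpartials_chr normc_M normc_chr mulr1 prod_dmul_le.
Qed.

Definition tsum (L : seq (R[i] * (Zn n * Zn n))) (z : Zn n * Tn) : R[i] :=
  \sum_(p <- L) p.1 * echr p.2 z.

Lemma schwartz_tsum L : schwartz_ZT (tsum L).
Proof.
elim: L => [|p L IH].
  rewrite (_ : tsum _ = fun=> 0); first exact: schwartz0.
  by apply/funext => z; rewrite /tsum big_nil.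
rewrite (_ : tsum _ = fun z => p.1 * echr p.2 z + tsum L z).
  by apply: schwartz_lin => //; exact: schwartz_echr.
by apply/funext => z; rewrite /tsum big_cons.
Qed.

(* The test function against which [dstft_ZT G u y] evaluates [u]. *)
Definition tfshift (y : Zn n * Tn * Tn * Zn n) G : Zn n * Tn -> R[i] :=
  fun z => cis (- dot z.1 y.1.2) * cis (- dot y.2 z.2) *
           conjc (G (z.1 - y.1.1.1, z.2 - y.1.1.2)).

(** The operator that a partial derivative of [twist k w f] induces on f. *)
Let Dop (k : Zn n) i (f : Tn -> R[i]) : Tn -> R[i] :=
  fun x => conjc (dmul i k) * f x + cpartial i f x.

Let smooth_Dop k s f : smooth f -> smooth (foldr (Dop k) f s).
Proof.
move=> sf; elim: s => [|i s IH]; first exact: sf.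
exact: (smooth_lin _ IH (smooth_cpartials [:: i] IH)).
Qed.

Let cpartials_twist k w s f : smooth f ->
  cpartials s (twist k w f) = twist k w (foldr (Dop k) f s).
Proof.
move=> sf; elim: s => [//|i s IH]; rewrite /= IH.
apply: cderiv_cpartial; apply: cderiv_twist; apply: smooth_cderiv0; exact: smooth_Dop.
Qed.

(** Each operator [Dop] costs a factor 1 + [mulsum k]. The list [s1] collects the genuine
    derivatives that arise while [s2] is unfolded. *)
Let Dop_bound k (f : Tn -> R[i]) N (Q : R) : smooth f ->
  (forall s x, (size s <= N)%N -> normc (cpartials s f x) <= Q) ->
  forall s2 s1 x, (size s1 + size s2 <= N)%N ->
  normc (cpartials s1 (foldr (Dop k) f s2) x) <= (1 + mulsum k) ^+ size s2 * Q.
Proof.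
move=> sf hQ; elim => [|i s2 IH] s1 x hs; first by rewrite mul1r hQ// -(addn0 (size s1)).
rewrite /= /Dop cpartials_lin; last 2 first.
- exact: smooth_Dop.
- exact: (@smooth_cpartials _ _ _ [:: i] (smooth_Dop k s2 sf)).
have -> : cpartials s1 (cpartial i (foldr (Dop k) f s2)) =
    cpartials (rcons s1 i) (foldr (Dop k) f s2) by rewrite /cpartials foldr_rcons.
apply: le_trans (normc_D _ _) _; rewrite normc_M normcJ exprS -mulrA [leRHS]mulrDl mul1r addrC.
apply: lerD; first by apply: IH; rewrite size_rcons; move: hs => /=; lia.
apply: ler_pM; rewrite ?normc_ge0 ?normc_dmul//.
by apply: IH; move: hs => /=; lia.
Qed.

Lemma tfshift_section y G m : (fun t => tfshift y G (m, t)) =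
  (fun t => cis (- dot m y.1.2) * twist (- y.2) y.1.1.2 (fun t => G (m - y.1.1.1, t)) t).
Proof.
by apply/funext => t; rewrite /tfshift/= /twist -mulrA /chr dotNl.
Qed.

(** The seminorm bound depends on y = (m, w, xi, k) through m and k alone: the decay weight moves by
    [bracketD], derivatives fall on the character, and w and xi only translate or multiply by
    unimodular factors. *)
Lemma schwartz_tfshift y G : schwartz_ZT G -> schwartz_ZT (tfshift y G) /\
  forall N c, sbound N G c ->
    sbound N (tfshift y G) (bracket y.1.1.1 ^+ N * (1 + mulsum (- y.2)) ^+ N * c).
Proof.
move=> /schwartz_ZTP[sG bG].
have sb N c : sbound N G c ->
    sbound N (tfshift y G) (bracket y.1.1.1 ^+ N * (1 + mulsum (- y.2)) ^+ N * c).
  move=> h s m x sN; rewrite tfshift_section cpartials_scale; last first.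
    by apply: smooth_twist; case: (sG (m - y.1.1.1)).
  rewrite normc_M normc_cis mul1r cpartials_twist; last by case: (sG (m - y.1.1.1)).
  rewrite /twist normc_M normc_chr mul1r normcJ.
  set m' := m - y.1.1.1; have b0 := exprn_gt0 N (bracket_gt0 (R := R) m').
  have hQ s' x' : (size s' <= N)%N ->
      normc (cpartials s' (fun t => G (m', t)) x') <= c / bracket m' ^+ N.
    by move=> sN'; rewrite ler_pdivlMr// mulrC; exact: h.
  have hb := @Dop_bound (- y.2) (fun t => G (m', t)) N _ (sG m').1 hQ s [::] (x - y.1.1.2) sN.
  have c0 := sbound_ge0 h.
  have p0 : 1 <= 1 + mulsum (- y.2) by rewrite lerDl mulsum_ge0.
  apply: (@le_trans _ _ (bracket m ^+ N * ((1 + mulsum (- y.2)) ^+ N * (c / bracket m' ^+ N)))).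
    rewrite ler_wpM2l ?exprn_ge0 ?(ltW (bracket_gt0 _))//; apply: le_trans hb _.
    by rewrite ler_wpM2r ?ler_weXn2l// divr_ge0// ltW.
  have bm : bracket m ^+ N <= bracket m' ^+ N * bracket y.1.1.1 ^+ N :> R.
    rewrite -exprMn lerXn2r ?nnegrE ?mulr_ge0 ?(ltW (bracket_gt0 _))//.
    by rewrite -{1}(subrK y.1.1.1 m) bracketD.
  apply: le_trans (ler_wpM2r _ bm) _.
    by rewrite mulr_ge0 ?exprn_ge0 ?divr_ge0 ?(ltW b0)// (le_trans _ p0).
  rewrite le_eqVlt; apply/orP; left; apply/eqP.
  by move: b0; set b := bracket m' ^+ N => b0; field; rewrite gt_eqF.
split => //; apply/schwartz_ZTP; split => [m|N]; last first.
  by have [c hc] := bG N; exists (bracket y.1.1.1 ^+ N * (1 + mulsum (- y.2)) ^+ N * c); exact: sb.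
have [s1 s2] := sG (m - y.1.1.1).
rewrite tfshift_section; split; first by apply: smooth_scale; exact: smooth_twist.
by move=> x i /=; rewrite (periodic_twist _ _ s2).
Qed.

End schwartz.

(** * Density of trigonometric polynomials in the Schwartz space *)

Section density.
Context {R : realType} {n : nat}.
Local Notation Tn := 'rV[R]_n.
Implicit Types (F G : Zn n * Tn -> R[i]).

(** A Fejer mean is a trigonometric polynomial in the coefficients of f, and differentiation
    multiplies both characters and coefficients by the same factors. Thus uniform approximation
    extends to all derivatives. *)
Lemma cpartials_fmean N s (f : Tn -> R[i]) (M : R) : smooth f -> periodic_Zn f ->
  (forall s' x, (size s' <= size s)%N -> normc (cpartials s' f x) <= M) ->
  cpartials s (fmean N f) = fmean N (cpartials s f).
Proof.
move=> sf pf fM.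
have i0 : cintegrable (haar R n) f.
  apply: (@cintegrable_bounded _ _ _ _ _ M); first exact: smooth_cmeasurable.
  by move=> x; exact: (fM [::]).
have is_ : cintegrable (haar R n) (cpartials s f).
  apply: (@cintegrable_bounded _ _ _ _ _ M).
    by apply: smooth_cmeasurable; exact: smooth_cpartials.
  by move=> x; exact: fM.
have -> : fmean N f = (fun x => (N.+1%:R^-1 ^+ n)%:C *
    \sum_(p : {ffun 'I_n -> 'I_N.+1 * 'I_N.+1}) fcoef f (freq p) * chr (freq p) x).
  by apply/funext => x; rewrite fmeanE.
have ss : smooth (fun x : Tn => \sum_(p : {ffun 'I_n -> 'I_N.+1 * 'I_N.+1}) fcoef f (freq p) * chr (freq p) x).
  by apply: smooth_sum => p; exact: smooth_chr.
rewrite cpartials_scale// cpartials_sum; last by move=> p; exact: smooth_chr.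
apply/funext => x; rewrite fmeanE//; congr (_ * _); apply: eq_bigr => p _.
by rewrite (fcoef_cpartials _ sf pf fM) cpartials_chr mulrCA mulrA.
Qed.

Lemma bracket_finite (B : R) : exists2 ms : seq (Zn n), uniq ms &
  forall m : Zn n, bracket m <= B -> m \in ms.
Proof.
pose M := Num.bound `|B|.
pose r (p : {ffun 'I_n -> 'I_M.*2.+1}) : Zn n := \row_i ((p i)%:Z - M%:Z).
exists (undup (map r (enum {: {ffun 'I_n -> 'I_M.*2.+1}}))); first exact: undup_uniq.
move=> m mB; rewrite mem_undup; apply/mapP.
have hm i : (absz (m ord0 i) <= M)%N.
  have h : `|m ord0 i|%:~R <= B :> R.
    by apply: le_trans mB; apply: le_trans (bracket_coord m i); rewrite lerDr.
  rewrite -(ler_nat R); apply: le_trans (le_trans h (ler_norm _)) (ltW (archi_boundP _)).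
  by [].
pose p := [ffun i : 'I_n => inord (absz (m ord0 i + M%:Z)) : 'I_M.*2.+1].
exists p; first by rewrite mem_enum.
apply/matrixP => a i; rewrite (ord1 a) mxE ffunE.
have := hm i; move: {mB hm p r} (m ord0 i) => z hz; rewrite inordK; last by lia.
by rewrite gez0_abs; lia.
Qed.
Lemma tsum_fmean N (ms : seq (Zn n)) G m t : uniq ms ->
  (forall m, cintegrable (haar R n) (fun t => G (m, t))) ->
  tsum [seq ((N.+1%:R^-1 ^+ n)%:C * fcoef (fun t => G (m', t)) (freq p), (m', freq p)) |
     m' <- ms, p <- enum {: {ffun 'I_n -> 'I_N.+1 * 'I_N.+1}}] (m, t) =
  if m \in ms then fmean N (fun t => G (m, t)) t else 0.
Proof.
move=> us iG; rewrite /tsum big_allpairs_dep/=.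
have inner m' : \sum_(p <- enum {: {ffun 'I_n -> 'I_N.+1 * 'I_N.+1}})
    (N.+1%:R^-1 ^+ n)%:C * fcoef (fun t => G (m', t)) (freq p) * echr (m', freq p) (m, t) =
    if m == m' then fmean N (fun t => G (m, t)) t else 0.
  case: ifP => [/eqP <-|mm]; last first.
    by apply: big1 => p _; rewrite /echr/= mm mulr0.
  rewrite fmeanE// mulr_sumr big_enum/=; apply: eq_bigr => p _.
  by rewrite /echr/= eqxx mulrA.
under eq_bigr do rewrite inner.
rewrite -big_mkcond/=; case: ifP => mm.
  by rewrite (big_rem _ mm)/= eqxx big_seq_cond big1 ?addr0// => i /andP[im /eqP e]; move: im; rewrite -e mem_rem_uniqF.
by rewrite big_seq_cond big1// => i /andP[im /eqP e]; move: im; rewrite -e mm.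
Qed.

(** Drop the fibres with bracket above c/eps and take Fejer means on the finitely many others. The
    seminorm of order N0 + 1 has one power of the bracket to spare for the dropped fibres and one
    derivative to spare for the Lipschitz bound on the kept ones. That the coefficients are
    multiples of those of G serves [fourier_neq0]. *)
Lemma trig_dense G N0 (eps : R) : schwartz_ZT G -> 0 < eps ->
  exists L, sbound N0 (fun z => G z - tsum L z) eps /\
    forall p, p \in L -> exists k, p.1 = k * fcoef (fun t => G (p.2.1, t)) p.2.2.
Proof.
move=> /schwartz_ZTP[sG bG] e0; have [c hc] := bG N0.+1; have c0 := sbound_ge0 hc.
have hcm s m x : (size s <= N0.+1)%N ->
    normc (cpartials s (fun t => G (m, t)) x) <= c / bracket m ^+ N0.+1.
  by move=> sN; rewrite ler_pdivlMr ?exprn_gt0 ?bracket_gt0// mulrC; exact: hc.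
have iG m s : (size s <= N0.+1)%N -> cintegrable (haar R n) (cpartials s (fun t => G (m, t))).
  move=> sN; apply: (@cintegrable_bounded _ _ _ _ _ (c / bracket m ^+ N0.+1)).
    by apply: smooth_cmeasurable; apply: smooth_cpartials; case: (sG m).
  by move=> x; exact: hcm.
have [ms us hms] := bracket_finite (c / eps).
(* [fmean_bound] with delta = [de] and L = 2c / bracket^(N0+1) leaves at most 4 c n de; [D] makes
   this at most eps, and N is so large that 4/(de (N+1)) <= de. *)
pose D : R := 4 * c * n%:R + 1.
have D0 : 0 < D by rewrite ltr_wpDl// !mulr_ge0.
pose de := eps / D; have de0 : 0 < de by rewrite divr_gt0.
pose N := Num.bound (4 / de ^+ 2).
have hN : 4 / (de * N.+1%:R) <= de.
  have h : 4 / de ^+ 2 <= N.+1%:R.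
    apply: (@le_trans _ _ N%:R); last by rewrite ler_nat.
    by apply: ltW; apply: archi_boundP; rewrite divr_ge0// exprn_ge0// ltW.
  rewrite ler_pdivrMr; last by rewrite mulr_gt0.
  by rewrite mulrA -expr2 mulrC -ler_pdivrMr ?exprn_gt0.
exists [seq ((N.+1%:R^-1 ^+ n)%:C * fcoef (fun t => G (m', t)) (freq p), (m', freq p)) |
     m' <- ms, p <- enum {: {ffun 'I_n -> 'I_N.+1 * 'I_N.+1}}]; split; last first.
  by move=> p /allpairsPdep[m' [q [_ _ ->]]]; exists (N.+1%:R^-1 ^+ n)%:C.
move=> s m x sN.
have -> : (fun t => G (m, t) - tsum [seq ((N.+1%:R^-1 ^+ n)%:C * fcoef (fun t => G (m', t)) (freq p), (m', freq p)) |
     m' <- ms, p <- enum {: {ffun 'I_n -> 'I_N.+1 * 'I_N.+1}}] (m, t)) =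
   (if m \in ms then (fun t => (-1) * fmean N (fun t => G (m, t)) t + G (m, t)) else (fun t => G (m, t))).
  apply/funext => t; rewrite tsum_fmean//; last by move=> m'; exact: (iG m' [::]).
  by case: ifP => _; rewrite ?subr0// mulN1r addrC.
have b0 := bracket_gt0 (R := R) m; have b1 := bracket_ge1 (R := R) m.
case: ifPn => [mm|mm]; last first.
  have bm : c / eps < bracket m by rewrite ltNge; apply: contra mm; exact: hms.
  have h := hcm s m x (leqW sN).
  apply: (@le_trans _ _ (bracket m ^+ N0 * (c / bracket m ^+ N0.+1))).
    by rewrite ler_wpM2l// exprn_ge0// ltW.
  have -> : bracket m ^+ N0 * (c / bracket m ^+ N0.+1) = c / bracket m.
    by rewrite exprS invfM mulrCA; congr (c * _); rewrite mulrC mulfVK// expf_neq0// gt_eqF.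
  by rewrite ler_pdivrMr// mulrC -ler_pdivrMr// ltW.
set f := fun t => G (m, t); have [sf pf] := sG m.
have fM s' y : (size s' <= size s)%N -> normc (cpartials s' f y) <= c / bracket m ^+ N0.+1.
  by move=> h; apply: hcm; apply: leq_trans h (leqW sN).
have sfm : smooth (fmean N f).
  rewrite (_ : fmean N f = fun x => (N.+1%:R^-1 ^+ n)%:C *
    \sum_(p : {ffun 'I_n -> 'I_N.+1 * 'I_N.+1}) fcoef f (freq p) * chr (freq p) x).
    by apply: smooth_scale; apply: smooth_sum => p; exact: smooth_chr.
  by apply/funext => y; rewrite fmeanE//; exact: (iG m [::]).
rewrite cpartials_lin// (cpartials_fmean _ sf pf fM).
have L0 : 0 <= 2 * (c / bracket m ^+ N0.+1) by rewrite mulr_ge0// divr_ge0// exprn_ge0// ltW.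
have := @fmean_bound _ _ N (cpartials s f) (2 * (c / bracket m ^+ N0.+1)) de x _ de0 L0 _.
rewrite mulN1r addrC => h.
apply: (@le_trans _ _ (bracket m ^+ N0 * (2 * (c / bracket m ^+ N0.+1) * n%:R * (de + de)))).
  rewrite ler_wpM2l ?exprn_ge0 ?(ltW b0)//; apply: le_trans (h _ _) _.
  - exact: (smooth_cmeasurable (smooth_cpartials s sf)).
  - apply: chord_lipschitz; first exact: (smooth_cpartials s sf).
      exact: periodic_cpartials.
    by move=> i y; apply: (hcm (i :: s)).
  - by apply: ler_wpM2l; [rewrite mulr_ge0|rewrite lerD2l].
have -> : bracket m ^+ N0 * (2 * (c / bracket m ^+ N0.+1) * n%:R * (de + de)) =
    (bracket m)^-1 * (4 * c * n%:R * de).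
  rewrite exprS; move: (expf_neq0 N0 (lt0r_neq0 b0)) (lt0r_neq0 b0).
  by set b := bracket m ^+ N0 => bn bm; field; rewrite ?bn ?bm.
apply: (@le_trans _ _ (4 * c * n%:R * de)).
  have X0 : 0 <= 4 * c * n%:R * de by apply: mulr_ge0 (ltW de0); rewrite !mulr_ge0.
  by rewrite ler_piMl// invf_le1.
rewrite /de mulrCA ler_piMr ?(ltW e0)// ler_pdivrMr// mul1r.
by rewrite /D lerDl.
Qed.

End density.

(** * Integration and Fourier coefficients on Z^n x T^n *)

Section product_integrals.
Context {R : realType} {n : nat}.
Local Notation Tn := 'rV[R]_n.
Local Notation cZ := (countingZ R n).
Local Notation mu := (@muZT R n).
Implicit Types F : Zn n * Tn -> R[i].

Lemma integral_countingZ_at (m : Zn n) (c : R) :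
  (\int[cZ]_k (if k == m then c else 0)%:E = c%:E)%E.
Proof.
rewrite (_ : (fun k => _) = ((fun=> c%:E) \_ [set m])%E).
  by rewrite -integral_mkcond integral_cst// [X in (_ * X)%E]countingZ1 mule1.
by apply/funext => k; rewrite patchE/= in_set1; case: ifP.
Qed.

Lemma cintegral_countingZ_at (m : Zn n) (f : Zn n -> R[i]) :
  cintegral cZ (fun k => if k == m then f k else 0) = f m.
Proof.
rewrite /cintegral.
transitivity ((\int[cZ]_k (if k == m then ReC (f m) else 0))%R +i*
              (\int[cZ]_k (if k == m then ImC (f m) else 0))%R).
  by congr (_ +i* _); apply: eq_Rintegral => k _; case: eqP => [->|].
by rewrite /Rintegral !integral_countingZ_at; case: (f m).
Qed.

Lemma cmeasurable_echr q : cmeasurable (@echr R n q).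
Proof. by apply: schwartz_cmeasurable; exact: schwartz_echr. Qed.

Lemma cintegral_fibre F m : cintegrable mu F -> (forall z, z.1 != m -> F z = 0) ->
  cintegral mu F = cintegral (haar R n) (fun w => F (m, w)).
Proof.
move=> iF F0; have [_ <-] := cfubini12 iF.
rewrite -(cintegral_countingZ_at m (fun m => cintegral (haar R n) (fun w => F (m, w)))).
apply: eq_cintegral => k; case: eqVneq => // km.
by under eq_cintegral do rewrite F0//; exact: cintegral0.
Qed.

Lemma cintegral_echr F q : cintegrable mu (fun z => F z * echr q z) ->
  cintegral mu (fun z => F z * echr q z) =
  cintegral (haar R n) (fun w => F (q.1, w) * chr q.2 w).
Proof.
move=> iE; rewrite (cintegral_fibre (m := q.1) iE).
  by apply: eq_cintegral => w; rewrite /echr eqxx.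
by move=> z zq; rewrite /echr (negbTE zq) mulr0.
Qed.

Lemma cintegrable_section F m : cintegrable mu F ->
  cintegrable (haar R n) (fun w => F (m, w)).
Proof.
move=> /cintegrableP[mF lF]; apply/cintegrableP; split.
  exact: cmeasurable_section1.
apply: le_lt_trans lF; rewrite fubini_tonelli1//; last 2 first.
- by apply/measurable_EFinP; exact: measurable_normc.
- by move=> z; rewrite lee_fin normc_ge0.
apply: (ge_integral_countingZ (f := fun m => \int[haar R n]_w (normc (F (m, w)))%:E)%E).
by move=> k; apply: integral_ge0 => w _; rewrite lee_fin normc_ge0.
Qed.

(** In |F|^2 one factor is bounded by c / bracket^N and the other by c; K is the sum of the
    bracket^-N. Hence Schwartz convergence implies L^2 convergence. *)
Lemma sqint_schwartz : exists N (K : R), 0 <= K /\ forall F c, cmeasurable F ->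
  sbound N F c -> sqint mu F /\ nrm2 mu F <= K * c ^+ 2.
Proof.
have [N hN] := bracket_summable (R := R) (n := n).
have b0 (k : Zn n) := bracket_gt0 (R := R) k.
pose K := fine (\int[cZ]_k ((bracket k ^- N : R)%:E)).
have K0 : (0 <= \int[cZ]_k ((bracket k ^- N : R)%:E))%E.
  by apply: integral_ge0 => k _; rewrite lee_fin invr_ge0 exprn_ge0// ltW.
exists N, K; split; first by rewrite /K fine_ge0.
move=> F c mF hF; have c0 := sbound_ge0 hF.
have hb z : normc (F z) ^+ 2 <= c ^+ 2 * bracket z.1 ^- N.
  case: z => m w /=; rewrite ler_pdivlMr ?exprn_gt0//.
  have h1 := hF [::] m w isT; have h2 := sbound_normc (s := [::]) m w hF isT.
  rewrite expr2 -mulrA [_ * bracket m ^+ N]mulrC expr2 ler_pM ?normc_ge0//.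
  by rewrite mulr_ge0 ?normc_ge0// exprn_ge0// ltW.
have hi : (\int[mu]_z (normc (F z) ^+ 2)%:E <= (K * c ^+ 2)%:E)%E.
  rewrite fubini_tonelli1//; last 2 first.
  - by apply/measurable_EFinP; exact: measurable_sqr_normc.
  - by move=> z; rewrite lee_fin sqr_ge0.
  apply: (@le_trans _ _ (\int[cZ]_m ((c ^+ 2)%:E * (bracket m ^- N : R)%:E))%E).
    apply: ge0_le_integral => //.
    - by move=> m _; apply: integral_ge0 => w _; rewrite lee_fin sqr_ge0.
    - move=> m _; apply: (@le_trans _ _ (\int[haar R n]_w (c ^+ 2 * bracket m ^- N)%:E)%E).
        apply: ge0_le_integral => //.
        + by move=> w _; rewrite lee_fin sqr_ge0.
        + apply/measurable_EFinP; apply: measurable_sqr_normc.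
          exact: (cmeasurable_section1 m mF).
        + by move=> w _; rewrite lee_fin; exact: (hb (m, w)).
      rewrite integral_cst// [X in (_ * X)%E](_ : _ = 1%E) ?mule1 ?EFinM//.
      exact: probability_setT.
  rewrite ge0_integralZl//; last 2 first.
  - by move=> m _; rewrite lee_fin invr_ge0 exprn_ge0// ltW.
  - by rewrite lee_fin sqr_ge0.
  by rewrite (mulrC K) (EFinM (c ^+ 2)) /K fineK// ge0_fin_numE.
have sF : sqint mu F by split => //; apply: le_lt_trans hi _; rewrite ltry.
by split => //; rewrite -lee_fin -nrm2E.
Qed.

Lemma sqint_echr q : sqint mu (@echr R n q).
Proof.
have [N [K [_ h]]] := sqint_schwartz.
have /schwartz_ZTP[_ /(_ N)[c hc]] := @schwartz_echr R n q.
by have [] := h _ _ (cmeasurable_echr q) hc.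
Qed.

Lemma sqint_schwartz_ZT F : schwartz_ZT F -> sqint mu F.
Proof.
move=> sF; have [N [K [_ h]]] := sqint_schwartz.
have /schwartz_ZTP[_ /(_ N)[c hc]] := sF.
by have [] := h _ _ (schwartz_cmeasurable sF) hc.
Qed.

Lemma echrJ q z : conjc (@echr R n q z) = echr (q.1, - q.2) z.
Proof.
rewrite /echr/=; case: ifP => _; last exact: rmorph0.
by rewrite chrN.
Qed.

Lemma echr_orthonormal q q' : ip mu (@echr R n q) (echr q') = if q == q' then 1%:C else 0.
Proof.
have iE : cintegrable mu (fun z => echr q z * conjc (echr q' z)).
  by apply: ip_cintegrable; exact: sqint_echr.
rewrite /ip; have [_ <-] := cfubini12 iE.
rewrite -(cintegral_countingZ_at q.1 (fun m => if q == q' then 1%:C else 0)).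
apply: eq_cintegral => m; rewrite /echr/=; case: ifP => [/eqP ->|_]; last first.
  by under eq_cintegral do rewrite mul0r; exact: cintegral0.
have [qq|qq] := eqVneq q.1 q'.1; last first.
  under eq_cintegral do rewrite rmorph0 mulr0.
  by rewrite cintegral0; have [e|//] := eqVneq q q'; rewrite e eqxx in qq.
rewrite [LHS](chr_orthonormal q.2 q'.2); case: q q' qq {iE} => [a k] [b l] /= ->.
by rewrite -pair_eqE /pair_eq/= eqxx.
Qed.

Lemma fcoef_echr F q : sqint mu F ->
  fcoef (fun w => F (q.1, w)) q.2 = ip mu F (echr q).
Proof.
move=> hF; have iE := ip_cintegrable hF (sqint_echr q).
rewrite /ip; under eq_cintegral do rewrite echrJ.
rewrite cintegral_echr; first by apply: eq_cintegral => w /=; rewrite chrN.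
by rewrite /cintegrable in iE *; under eq_fun do rewrite -echrJ; under [X in _ /\ _.-integrable _ X]eq_fun do rewrite -echrJ.
Qed.

End product_integrals.

(** * Symbols *)

Section product_sigma_finite.
Context {d1 d2 : measure_display} {T1 : measurableType d1} {T2 : measurableType d2}.
Context {R : realType}.
Variables (m1 : {sigma_finite_measure set T1 -> \bar R})
          (m2 : {sigma_finite_measure set T2 -> \bar R}).

Lemma product_sigma_finite : sigma_finite setT (m1 \x m2)%E.
Proof.
have /sigma_finiteP[F [TF ndF Foo]] := sigma_finiteT m1.
have /sigma_finiteP[G [TG ndG Goo]] := sigma_finiteT m2.
exists (fun n => F n `*` G n).
  rewrite -setXTT TF TG predeqE => -[x y]; split.
    move=> [/= [n _ Fnx] [k _ Gky]]; exists (maxn n k) => //; split.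
    - by move: x Fnx; exact/subsetPset/ndF/leq_maxl.
    - by move: y Gky; exact/subsetPset/ndG/leq_maxr.
  by move=> [n _ []/= ? ?]; split; exists n.
move=> k; have [? ?] := Foo k; have [? ?] := Goo k.
split; first exact: measurableX.
by rewrite product_measure1E// lte_mul_pinfty// ge0_fin_numE.
Qed.

(* The library exports no canonical sigma-finite structure on products. *)
Definition product_sf : {sigma_finite_measure set (T1 * T2)%type -> \bar R} :=
  HB.pack_for {sigma_finite_measure set (T1 * T2)%type -> \bar R} (m1 \x m2)%E
    (@Measure_isSigmaFinite.Build _ _ _ (m1 \x m2)%E product_sigma_finite).

End product_sigma_finite.

Section tensor_products.
Local Open Scope ring_scope.
Context {d1 d2 : measure_display} {T1 : measurableType d1} {T2 : measurableType d2}.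
Context {R : realType}.
Variables (m1 : {sigma_finite_measure set T1 -> \bar R})
          (m2 : {sigma_finite_measure set T2 -> \bar R}).
Implicit Types (f : T1 -> R[i]) (g : T2 -> R[i]).

Definition tens f g (z : T1 * T2) : R[i] := f z.1 * g z.2.

Lemma sqint_tens f g : sqint m1 f -> sqint m2 g -> sqint (m1 \x m2)%E (tens f g).
Proof.
move=> hf hg; have [mf _] := hf; have [mg _] := hg.
have /cintegrable_normc h := cintegrableX (cintegrable_real (sqint_integrable hf))
  (cintegrable_real (sqint_integrable hg)).
apply: (sqint_le _ h) => [|z].
  by apply: cmeasurableM; [exact: cmeasurable_fst|exact: cmeasurable_snd].
by rewrite -realcM normc_real -exprMn -normc_M ger0_norm// sqr_ge0.
Qed.

Lemma ip_tens f g f' g' : sqint m1 f -> sqint m2 g -> sqint m1 f' -> sqint m2 g' ->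
  ip (m1 \x m2)%E (tens f g) (tens f' g') = ip m1 f f' * ip m2 g g'.
Proof.
move=> hf hg hf' hg'; rewrite /ip -cintegralX; [|exact: ip_cintegrable..].
by apply: eq_cintegral => z; rewrite /tens conjcM mulrACA.
Qed.

End tensor_products.

Section product_of_probabilities.
Context {d1 d2 : measure_display} {T1 : measurableType d1} {T2 : measurableType d2}.
Context {R : realType} (P : probability T1 R) (Q : probability T2 R).

Lemma normc_cintegral_le d (T : measurableType d) (mu : probability T R) (f : T -> R[i]) B :
  cintegrable mu f -> (forall x, normc (f x) <= B) -> normc (cintegral mu f) <= B.
Proof.
move=> hf fB; apply: le_trans (le_normc_cintegral hf) _.
rewrite -[leRHS](Rintegral_cst_prob mu); apply: le_Rintegral => //.
- exact: cintegrable_normc.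
- exact: finite_measure_integrable_cst.
Qed.

Lemma cintegrable_bounded_prod (f : T1 * T2 -> R[i]) B : cmeasurable f ->
  (forall z, normc (f z) <= B) ->
  cintegrable (P \x Q)%E f /\ normc (cintegral (P \x Q)%E f) <= B.
Proof.
move=> mf fB; have i1 d (T : measurableType d) (mu : probability T R) (c : R[i]) : cintegrable mu (fun=> c).
  by apply: (@cintegrable_bounded _ _ _ _ _ (normc c)) => //; exact: cmeasurable_cst.
have iB : cintegrable (P \x Q)%E (fun=> B%:C * 1).
  exact: (cintegrableX (i1 _ _ P B%:C) (i1 _ _ Q 1)).
have [iBR _] := iB; rewrite mulr1 /= in iBR.
have hf : cintegrable (P \x Q)%E f by apply: (cintegrable_le mf iBR).
split => //; have [_ <-] := cfubini12 hf; apply: normc_cintegral_le.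
  by have [] := cfubini12 hf.
move=> x; apply: normc_cintegral_le => [|y]; last exact: fB.
apply: (@cintegrable_bounded _ _ _ _ _ B) => //.
exact: cmeasurable_section1.
Qed.

End product_of_probabilities.

Section delta_functions.
Context {R : realType} {n : nat}.
Local Notation cZ := (countingZ R n).

Definition kron (k j : Zn n) : R[i] := (j == k)%:R.

Lemma cmeasurable_kron k : cmeasurable (kron k).
Proof. exact: cmeasurable_Zn. Qed.

Lemma sqint_kron k : sqint cZ (kron k).
Proof.
split; first exact: cmeasurable_kron.
rewrite (_ : (fun x => _) = (fun x => (if x == k then 1 else 0)%:E)).
  by rewrite integral_countingZ_at ltry.
apply/funext => x; rewrite /kron; case: eqP => _.
  by rewrite /= expr0n addr0 expr1n sqrtr1 expr1n.
by rewrite normc_0 expr0n.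
Qed.

Lemma kron_orthonormal k l : ip cZ (kron k) (kron l) = if k == l then 1%:C else 0.
Proof.
rewrite -(cintegral_countingZ_at k (fun=> if k == l then 1%:C else 0)).
apply: eq_cintegral => j; rewrite /kron; case: (j =P k) => [->|_]; last by rewrite mul0r.
by case: eqP => _; rewrite mul1r ?rmorph1 ?rmorph0.
Qed.

End delta_functions.

(** * Fourier coefficients of the short-time Fourier transform of a symbol *)

Section functionals.
Context {R : realType} {n : nat}.
Local Notation Tn := 'rV[R]_n.
Implicit Types (F G : Zn n * Tn -> R[i]) (y : Zn n * Tn * Tn * Zn n).

Lemma tfshift_lin y (a : R[i]) F G :
  tfshift y (fun z => a * F z + G z) = (fun z => conjc a * tfshift y F z + tfshift y G z).
Proof.
by apply/funext => z; rewrite /tfshift conjcD conjcM mulrDr mulrCA.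
Qed.

(** Time-frequency shifts permute the [echr] up to unimodular factors. With a trigonometric
    polynomial as window, the transform of u is therefore explicit in the values u(echr q). *)
Lemma tfshift_echr y q : tfshift y (@echr R n q) =
  (fun z => conjc (chr (q.1 + y.1.1.1) y.1.2) * chr q.2 y.1.1.2 *
            echr (q.1 + y.1.1.1, - y.2 - q.2) z).
Proof.
apply/funext => z; rewrite /tfshift /echr [X in _ = _ * X]/= subr_eq.
case: eqP => [->|_]; last by rewrite rmorph0 !mulr0.
have hc (k : Zn n) w : cis (- dot k w) = conjc (chr k w) :> R[i] by rewrite cisN.
rewrite !hc chrDr chrNr (chrD (- y.2)) !chrN !conjcM !conjcK; ring.
Qed.

Lemma tfshift0 y : tfshift y (fun=> 0) = (fun=> 0).
Proof. by apply/funext => z; rewrite /tfshift rmorph0 mulr0. Qed.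

Variable u : (Zn n * Tn -> R[i]) -> R[i].
Hypothesis tu : tempered_ZT u.

Lemma tempered_lin a F G : schwartz_ZT F -> schwartz_ZT G ->
  u (fun z => a * F z + G z) = a * u F + u G.
Proof. by case: tu => + _; apply. Qed.

Lemma tempered0 : u (fun=> 0) = 0.
Proof.
have := tempered_lin 1 schwartz0 schwartz0.
under eq_fun do rewrite mul1r addr0.
by rewrite mul1r => /esym/eqP; rewrite -subr_eq0 addrK => /eqP.
Qed.

Lemma tempered_scale a F : schwartz_ZT F -> u (fun z => a * F z) = a * u F.
Proof.
move=> sF; have := tempered_lin a sF schwartz0; under eq_fun do rewrite addr0.
by rewrite tempered0 addr0.
Qed.

Lemma temperedB F G : schwartz_ZT F -> schwartz_ZT G ->
  u (fun z => F z - G z) = u F - u G.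
Proof.
move=> sF sG; have := tempered_lin (-1) sG sF.
under eq_fun do rewrite mulN1r addrC.
by rewrite mulN1r addrC.
Qed.

Lemma tempered_tsum L : u (tsum L) = \sum_(p <- L) p.1 * u (echr p.2).
Proof.
elim: L => [|p L IH].
  rewrite big_nil (_ : tsum _ = fun=> 0) ?tempered0//.
  by apply/funext => z; rewrite /tsum big_nil.
rewrite big_cons -IH -tempered_lin; [|exact: schwartz_echr|exact: schwartz_tsum].
by congr (u _); apply/funext => z; rewrite /tsum big_cons.
Qed.

Lemma tempered_bound : exists N (C : R), 0 <= C /\
  forall F b, schwartz_ZT F -> sbound N F b -> normc (u F) <= C * b.
Proof.
have [_ [N [C hC]]] := tu; exists N, `|C|; split => // F b sF hb.
rewrite -lee_fin; apply: le_trans (hC F sF) _; rewrite EFinM.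
have s0 : (0 <= snorm_ZT N F)%E.
  have h0 : (0 <= bracket (0 : Zn n) ^+ N * normc (F (0, 0)))%R.
    by rewrite mulr_ge0 ?normc_ge0// exprn_ge0// ltW// bracket_gt0.
  apply: (@le_trans _ _ (bracket (0 : Zn n) ^+ N * normc (F (0, 0)))%:E).
    by rewrite lee_fin.
  by apply: ereal_sup_ubound; exists [::], 0, 0.
apply: (@le_trans _ _ (`|C|%:E * snorm_ZT N F)%E).
  by apply: lee_wpmul2r => //; rewrite lee_fin ler_norm.
by apply: lee_wpmul2l; [rewrite lee_fin|exact/snorm_ZTP].
Qed.

Lemma dstft_tfshift G y : dstft_ZT G u y = u (tfshift y G).
Proof. by case: y => [[[m w] xi] k]. Qed.

Lemma dstft_tsum L y : dstft_ZT (tsum L) u y = \sum_(p <- L)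
  conjc p.1 * (conjc (chr (p.2.1 + y.1.1.1) y.1.2) * chr p.2.2 y.1.1.2) *
  u (echr (p.2.1 + y.1.1.1, - y.2 - p.2.2)).
Proof.
rewrite dstft_tfshift; elim: L => [|p L IH].
  rewrite big_nil (_ : tsum _ = fun=> 0) ?tfshift0 ?tempered0//.
  by apply/funext => z; rewrite /tsum big_nil.
rewrite big_cons -IH -mulrA -tempered_scale; last exact: schwartz_echr.
rewrite -tempered_lin; first last.
- exact: (schwartz_tfshift y (schwartz_tsum L)).1.
- by apply: schwartz_scale; exact: schwartz_echr.
congr (u _).
rewrite (_ : tsum (p :: L) = fun z => p.1 * echr p.2 z + tsum L z).
  by rewrite tfshift_lin tfshift_echr.
by apply/funext => z; rewrite /tsum big_cons.
Qed.

(** On a fixed fibre (m, k) the transform depends continuously on the window, uniformly in w and xi,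
    since the seminorms in [schwartz_tfshift] ignore these. *)
Lemma dstft_bound m k : exists N (C : R), 0 <= C /\
  forall F b, schwartz_ZT F -> sbound N F b -> forall w xi,
  normc (dstft_ZT F u (m, w, xi, k)) <= C * b.
Proof.
have [N [C [C0 hC]]] := tempered_bound.
exists N, (C * (bracket m ^+ N * (1 + mulsum (- k)) ^+ N)); split.
  rewrite !mulr_ge0 ?exprn_ge0 ?(ltW (bracket_gt0 _))//.
  by rewrite addr_ge0// mulsum_ge0.
move=> F b sF hb w xi; rewrite -mulrA; have [sT bT] := schwartz_tfshift (m, w, xi, k) sF.
by apply: hC => //; exact: bT.
Qed.

End functionals.

Section coefficients.
Context {R : realType} {n : nat}.
Local Notation Tn := 'rV[R]_n.
Local Notation H := (haar R n).
Implicit Types (F G : Zn n * Tn -> R[i]).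
Variable u : (Zn n * Tn -> R[i]) -> R[i].
Hypothesis tu : tempered_ZT u.

Let chr2 (l j : Zn n) : Tn * Tn -> R[i] := tens (chr l) (chr (- j)).

(** A Fourier coefficient on T^n x T^n of the fibre (m, k), at the character e^{2 pi i (l.w -
    j.xi)}. *)
Let coef G m k l j := ip (H \x H)%E (fun t => dstft_ZT G u (m, t.1, t.2, k)) (chr2 l j).

Lemma fcoef_tsum L m l :
  fcoef (fun t => @tsum R n L (m, t)) l = \sum_(p <- L) (if p.2 == (m, l) then p.1 else 0).
Proof.
have sT := schwartz_tsum (R := R) L.
rewrite (fcoef_echr (m, l) (sqint_schwartz_ZT sT)) /tsum ip_suml.
- apply: eq_bigr => p _; rewrite ipZl; [|exact: sqint_echr..].
  by rewrite echr_orthonormal; case: ifP => _; rewrite ?mulr1 ?mulr0.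
- by move=> p; apply: sqintZ; exact: sqint_echr.
- exact: sqint_echr.
Qed.

Lemma normc_chr2 l j t : normc (chr2 l j t) = 1.
Proof. by rewrite /chr2 /tens normc_M !normc_chr mulr1. Qed.

Lemma cmeasurable_chr2 l j : cmeasurable (chr2 l j).
Proof.
by apply: cmeasurableM; [apply: cmeasurable_fst|apply: cmeasurable_snd]; exact: measurable_chr.
Qed.

Lemma dstft_tsum_section L m k :
  (fun t : Tn * Tn => dstft_ZT (tsum L) u (m, t.1, t.2, k)) =
   (fun t => \sum_(p <- L) (conjc p.1 * u (echr (p.2.1 + m, - k - p.2.2))) *
      chr2 p.2.2 (p.2.1 + m) t).
Proof.
apply/funext => t; rewrite dstft_tsum//; apply: eq_bigr => p _.
by rewrite /chr2 /tens chrN /=; ring.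
Qed.

(** On the fibre (m, k), a window term echr (b, f) gives the character indexed by (f, b + m) times u
    at echr (b + m, -k - f). For m = j - a and k = -r - l, orthogonality keeps the terms with f = l
    and b = a, and u is then evaluated at echr (j, r). *)
Lemma coef_tsum L a l j r : coef (tsum L) (j - a) (- r - l) l j =
  conjc (fcoef (fun t => tsum L (a, t)) l) * u (echr (j, r)).
Proof.
rewrite fcoef_tsum conjc_sum mulr_suml /coef dstft_tsum_section.
have sc l' j' : sqint (H \x H)%E (chr2 l' j') by apply: sqint_tens; exact: sqint_chr.
rewrite ip_suml//; last by move=> p; exact: sqintZ.
apply: eq_bigr => p _; rewrite ipZl// /chr2 ip_tens; [|exact: sqint_chr..].
rewrite !chr_orthonormal eqr_opp.
case: p => c [b f] /=; rewrite -pair_eqE /pair_eq/=.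
have [->|bl] := eqVneq f l; last by rewrite mul0r mulr0 andbF rmorph0 mul0r.
have -> : (b + (j - a) == j) = (b == a).
  by rewrite addrCA -{2}[j]addr0 (inj_eq (addrI j)) subr_eq0.
case: eqVneq => [->|_]; last by rewrite !mulr0 rmorph0 mul0r.
by rewrite !mulr1 addrC subrK opprD !opprK addrK.
Qed.

Lemma normc_eq_eps (x y : R[i]) K : (forall e, 0 < e -> normc (x - y) <= K * e) -> x = y.
Proof.
move=> h; apply/eqP; rewrite -subr_eq0 -normc_eq0 eq_le normc_ge0 andbT.
apply/ler_addgt0Pl => e e0; rewrite addr0.
have K0 : 0 <= K by have := h 1 ltr01; rewrite mulr1; apply: le_trans (normc_ge0 _).
have e1 : 0 < e / (K + 1) by rewrite divr_gt0// ltr_wpDl.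
apply: le_trans (h _ e1) _; rewrite mulrCA ler_piMr ?(ltW e0)//.
by rewrite ler_pdivrMr ?ltr_wpDl// mul1r lerDl.
Qed.

Lemma cmeasurable_dstft_section G m k : cmeasurable (dstft_ZT G u) ->
  cmeasurable (fun t : Tn * Tn => dstft_ZT G u (m, t.1, t.2, k)).
Proof.
apply: (cmeasurable_comp (h := fun t : Tn * Tn => (m, t.1, t.2, k))).
by do 3?[apply: measurable_fun_pair => //].
Qed.

(** Both sides are continuous in the window, the left by [dstft_bound], and they agree on the
    trigonometric polynomials of [trig_dense]. The constant adds the two moduli of continuity. *)
Lemma coef_schwartz G a l j r : schwartz_ZT G -> cmeasurable (dstft_ZT G u) ->
  coef G (j - a) (- r - l) l j = conjc (fcoef (fun t => G (a, t)) l) * u (echr (j, r)).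
Proof.
move=> sG mG; have [N [C [C0 hC]]] := dstft_bound tu (j - a) (- r - l).
apply: (@normc_eq_eps _ _ (C + normc (u (echr (j, r))))) => e e0.
have [L [hL _]] := trig_dense N sG e0; have sT := schwartz_tsum (R := R) L.
have Tcoef := coef_tsum L a l j r.
have iG F b : schwartz_ZT F -> sbound N F b ->
    cmeasurable (fun t : Tn * Tn => dstft_ZT F u (j - a, t.1, t.2, - r - l)) ->
    let I := fun t : Tn * Tn => dstft_ZT F u (j - a, t.1, t.2, - r - l) * conjc (chr2 l j t) in
    cintegrable (H \x H)%E I /\ normc (cintegral (H \x H)%E I) <= C * b.
  move=> sF bF mF; apply: cintegrable_bounded_prod.
    by apply: cmeasurableM => //; apply: cmeasurableJ; exact: cmeasurable_chr2.
  by move=> t; rewrite normc_M normcJ normc_chr2 mulr1; exact: hC.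
have jG F b : schwartz_ZT F -> sbound N F b ->
    cintegrable H (fun t => F (a, t) * conjc (chr l t)) /\
    normc (cintegral H (fun t => F (a, t) * conjc (chr l t))) <= b.
  move=> sF bF; have Fb t : normc (F (a, t) * conjc (chr l t)) <= b.
    by rewrite normc_M normcJ normc_chr mulr1; exact: (sbound_normc (s := [::]) _ _ bF).
  have iF : cintegrable H (fun t => F (a, t) * conjc (chr l t)).
    apply: (@cintegrable_bounded _ _ _ _ _ b) => //; apply: cmeasurableM.
      exact: cmeasurable_section1 (schwartz_cmeasurable sF).
    by apply: cmeasurableJ; exact: measurable_chr.
  by split => //; exact: normc_cintegral_le.
have /schwartz_ZTP[_ /(_ N)[bG hG]] := sG; have /schwartz_ZTP[_ /(_ N)[bT hT]] := sT.
have mGs := cmeasurable_dstft_section (j - a) (- r - l) mG.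
have mTs : cmeasurable (fun t : Tn * Tn => dstft_ZT (tsum L) u (j - a, t.1, t.2, - r - l)).
  rewrite dstft_tsum_section; apply: cmeasurable_sum => p; apply: cmeasurableZ.
  exact: cmeasurable_chr2.
have [iG1 _] := iG _ _ sG hG mGs; have [iT1 _] := iG _ _ sT hT mTs.
have [jG1 _] := jG _ _ sG hG; have [jT1 _] := jG _ _ sT hT.
have sD := schwartzB sG sT.
have dE t : dstft_ZT (fun z => G z - tsum L z) u (j - a, t.1, t.2, - r - l) =
    dstft_ZT G u (j - a, t.1, t.2, - r - l) - dstft_ZT (tsum L) u (j - a, t.1, t.2, - r - l).
  rewrite !dstft_tfshift -temperedB//; last 2 first.
  - by case: (schwartz_tfshift (j - a, t.1, t.2, - r - l) sG).
  - by case: (schwartz_tfshift (j - a, t.1, t.2, - r - l) sT).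
  by congr (u _); apply/funext => z; rewrite /tfshift conjcB mulrBr.
have mDs : cmeasurable (fun t : Tn * Tn => dstft_ZT (fun z => G z - tsum L z) u (j - a, t.1, t.2, - r - l)).
  by under eq_fun do rewrite dE; apply: cmeasurableD => //; exact: cmeasurableN.
have d1 : normc (coef G (j - a) (- r - l) l j - coef (tsum L) (j - a) (- r - l) l j) <= C * e.
  rewrite /coef /ip -cintegralB//; have [_] := iG _ _ sD hL mDs.
  by under eq_cintegral do rewrite dE mulrBl.
have d2 : normc (fcoef (fun t => G (a, t)) l - fcoef (fun t => tsum L (a, t)) l) <= e.
  rewrite /fcoef /ip -cintegralB//; have [_] := jG _ _ sD hL.
  by under eq_cintegral do rewrite mulrBl.
rewrite -[X in normc (X - _)](subrK (coef (tsum L) (j - a) (- r - l) l j)) Tcoef -addrA -mulrBl -conjcB.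
apply: le_trans (normc_D _ _) _; rewrite -Tcoef mulrDl; apply: lerD => //.
rewrite normc_M normcJ mulrC ler_wpM2l ?normc_ge0// normcB.
exact: d2.
Qed.

(* For i = (p, q) the fibre and the frequencies are those at which the       *)
(* coefficient of [dstft_ZT G u] is the product of the conjugate of the      *)
(* coefficient of G at p and of the value of u on [echr q].                  *)
Definition bas (i : (Zn n * Zn n) * (Zn n * Zn n)) : Zn n * Tn * Tn * Zn n -> R[i] :=
  tens (tens (echr (i.2.1 - i.1.1, i.1.2)) (chr (- i.2.1))) (kron (- i.2.2 - i.1.2)).

Let zt := product_sf (countingZ R n) H.
Let ztt := product_sf zt H.

Let sqint_bas1 m l j : sqint ztt (tens (echr (m, l)) (chr j)).
Proof. exact: (sqint_tens (m1 := zt) (sqint_echr _) (sqint_chr _)). Qed.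

Lemma sqint_bas i : sqint muZTTZ (bas i).
Proof. exact: (sqint_tens (sqint_bas1 _ _ _) (sqint_kron _)). Qed.

(** The family is a tensor product, and its indices (b - a, l, -b, -r - l) determine b and l, then a
    and r, so distinct pairs (p, q) give distinct basis vectors. *)
Lemma bas_orthonormal i j : ip muZTTZ (bas i) (bas j) = if i == j then 1%:C else 0.
Proof.
rewrite /bas [LHS](ip_tens (m1 := ztt)); [|exact: sqint_bas1|exact: sqint_kron|exact: sqint_bas1|exact: sqint_kron].
rewrite [X in X * _](ip_tens (m1 := zt)); [|exact: sqint_echr|exact: sqint_chr|exact: sqint_echr|exact: sqint_chr].
rewrite [X in X * _ * _]echr_orthonormal chr_orthonormal kron_orthonormal eqr_opp.
case: i j => [[a l] [b r]] [[a' l'] [b' r']] /=; rewrite -!pair_eqE /pair_eq/= -!pair_eqE /pair_eq/=.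
have [->|bb] := eqVneq b b'; last by rewrite mulr0 mul0r andbF.
rewrite (inj_eq (addrI b')) eqr_opp.
have [->|ll] := eqVneq l l'; last by rewrite !andbF !mul0r.
rewrite (inj_eq (addIr (- l'))) eqr_opp.
by case: eqVneq => _; case: eqVneq => _; rewrite ?mul0r ?mulr0// !mulr1.
Qed.

Lemma cintegrable_countingZ_section d (T : measurableType d) (mu : {sigma_finite_measure set T -> \bar R})
    (F : T * Zn n -> R[i]) k : cintegrable (mu \x countingZ R n)%E F ->
  cintegrable mu (fun x => F (x, k)).
Proof.
move=> /cintegrableP[mF lF]; apply/cintegrableP; split.
  exact: cmeasurable_section2.
apply: le_lt_trans lF; rewrite fubini_tonelli2//; last 2 first.
- by apply/measurable_EFinP; exact: measurable_normc.
- by move=> z; rewrite lee_fin normc_ge0.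
apply: (ge_integral_countingZ (f := fun k => \int[mu]_x (normc (F (x, k)))%:E)%E).
by move=> j; apply: integral_ge0 => w _; rewrite lee_fin normc_ge0.
Qed.

(** The factor [kron] selects the fibre in k and [echr] the fibre in m. What remains is the
    coefficient on T^n x T^n computed in [coef_schwartz]. *)
Lemma ip_bas G i : schwartz_ZT G -> sqint muZTTZ (dstft_ZT G u) ->
  ip muZTTZ (dstft_ZT G u) (bas i) = conjc (ip muZT G (echr i.1)) * u (echr i.2).
Proof.
move=> sG sV; have iE := ip_cintegrable sV (sqint_bas i); have [mV _] := sV.
case: i iE => [[a l] [j r]] iE; set b := bas _ in iE *.
rewrite -fcoef_echr; last exact: sqint_schwartz_ZT.
rewrite -coef_schwartz// /coef /ip; have [_ <-] := cfubini21 (m1 := ztt) iE.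
pose m0 := j - a; pose k0 := - r - l; set V := dstft_ZT G u in iE sV mV *.
pose I k := cintegral ztt (fun x => V (x, k) * conjc (b (x, k))).
transitivity (cintegral (countingZ R n) (fun k => if k == k0 then I k else 0)).
  apply: eq_cintegral => k; case: eqVneq => // kk.
  rewrite (eq_cintegral _ (g := fun=> 0)) ?cintegral0// => x.
  by rewrite /b /bas /tens /kron /= (negbTE kk) mulr0 rmorph0 mulr0.
rewrite cintegral_countingZ_at.
have iE2 := cintegrable_countingZ_section (mu := ztt) k0 iE.
have [i3 e3] := cfubini12 (m1 := zt) iE2; rewrite /I -e3 (cintegral_fibre (m := m0) i3); last first.
  move=> z zm; rewrite (eq_cintegral _ (g := fun=> 0)) ?cintegral0// => x.
  by rewrite /b /bas /tens /echr /= (negbTE zm) !mul0r rmorph0 mulr0.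
have be w xi : b (m0, w, xi, k0) = chr2 l j (w, xi).
  by rewrite /b /bas /tens /chr2 /tens /echr /kron /= !eqxx mulr1.
have iC : cintegrable (H \x H)%E (fun t => V (m0, t.1, t.2, k0) * conjc (chr2 l j t)).
  have [N [C [C0 hC]]] := dstft_bound tu m0 k0.
  have /schwartz_ZTP[_ /(_ N)[bG hG]] := sG.
  apply: (@cintegrable_bounded_prod _ _ _ _ _ H H _ (C * bG) _ _).1 => [|t].
    apply: cmeasurableM; first exact: cmeasurable_dstft_section.
    by apply: cmeasurableJ; exact: cmeasurable_chr2.
  by rewrite normc_M normcJ normc_chr2 mulr1; exact: hC.
have [_ <-] := cfubini12 iC.
apply: eq_cintegral => w; apply: eq_cintegral => xi.
by rewrite be.
Qed.

(** Each coefficient is a product, so the Bessel sum over A x D factors. *)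
Lemma stft_bessel G A D : schwartz_ZT G -> sqint muZTTZ (dstft_ZT G u) ->
  uniq A -> uniq D ->
  (\sum_(p <- A) normc (ip muZT G (echr p)) ^+ 2) * (\sum_(q <- D) normc (u (echr q)) ^+ 2) <=
  nrm2 muZTTZ (dstft_ZT G u).
Proof.
move=> sG sV uA uD.
have uAD : uniq [seq (p, q) | p <- A, q <- D].
  by apply: allpairs_uniq => // -[? ?] [? ?] _ _ [-> ->].
have := bessel ler01 sqint_bas bas_orthonormal sV uAD.
rewrite mul1r big_allpairs_dep mulr_suml; apply: le_trans.
apply: ler_sum => p _; rewrite mulr_sumr; apply: ler_sum => q _.
by rewrite [X in _ <= normc X ^+ 2](ip_bas (p, q))// normc_M normcJ exprMn.
Qed.

End coefficients.

(** * Representation of a symbol by a function *)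

Section representation.
Context {R : realType} {n : nat}.
Local Notation Tn := 'rV[R]_n.
Local Notation H := (haar R n).
Local Notation mu := (@muZT R n).
Implicit Types (F s : Zn n * Tn -> R[i]).
Variable u : (Zn n * Tn -> R[i]) -> R[i].
Hypothesis tu : tempered_ZT u.

Lemma represents_section s m : represents s u -> cintegrable H (fun w => s (m, w)).
Proof.
move=> [_ /(_ _ (schwartz_echr (m, 0)))[h _]].
have := cintegrable_section m h; rewrite /echr /= eqxx.
by under eq_fun do rewrite /chr dot0l cis0 mulr1.
Qed.

Lemma represents_fibre s q : represents s u ->
  cintegral H (fun w => s (q.1, w) * chr q.2 w) = u (echr q).
Proof.
move=> [_ /(_ _ (schwartz_echr q))[h ->]]; by rewrite cintegral_echr.
Qed.

(** On every fibre both functions have the coefficients u(echr q), so [L1_uniqueness] applies to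
    their difference; Tonelli then sums over the fibres. *)
Lemma represents_unique s s' : represents s u -> represents s' u ->
  {ae mu, forall z, s z = s' z}.
Proof.
move=> rs rs'; have [ms _] := rs; have [ms' _] := rs'.
have md : cmeasurable (fun z => s z - s' z) by apply: cmeasurableD => //; exact: cmeasurableN.
apply: ae_eq_cintegral => //; rewrite fubini_tonelli1//; last 2 first.
- by apply/measurable_EFinP; exact: measurable_normc.
- by move=> z; rewrite lee_fin normc_ge0.
apply: integral0_eq => m _; have i1 := represents_section m rs.
have i2 := represents_section m rs'.
have ch k f : cintegrable H f -> cintegrable H (fun w => f w * chr k w).
  move=> hf; apply: (@cintegrable_mulr _ _ _ _ _ _ 1) => // [|w]; first exact: measurable_chr.
  by rewrite normc_chr.
apply: (L1_uniqueness (f := fun w => s (m, w) - s' (m, w))) => [|k].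
  exact: cintegrableB.
under eq_cintegral do rewrite mulrBl.
rewrite cintegralB; [|exact: ch..].
by rewrite (represents_fibre (m, k) rs) (represents_fibre (m, k) rs') subrr.
Qed.

Variable M : R.
Hypothesis cM : forall D : seq (Zn n * Zn n), uniq D ->
  \sum_(q <- D) normc (u (echr q)) ^+ 2 <= M.

(** Riesz-Fischer produces s with the prescribed coefficients. Integration against s then agrees
    with u on trigonometric polynomials, and on all Schwartz functions by density. *)
Lemma represents_exists : exists s, [/\ represents s u, sqint mu s & nrm2 mu s <= M].
Proof.
(* The inner product conjugates its second argument while [represents] pairs without conjugation,
   hence the opposite frequency. *)
pose e (q : Zn n * Zn n) := @echr R n (q.1, - q.2).
have se q : sqint mu (e q) by exact: sqint_echr.
have oe q q' : ip mu (e q) (e q') = if q == q' then 1%:C else 0.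
  rewrite echr_orthonormal; case: q q' => [a k] [b l] /=.
  by rewrite -!pair_eqE /pair_eq/= eqr_opp.
have [s [ss sM hs]] := riesz_fischer se oe cM.
exists s; split => //; split; first by case: ss.
have iF F : schwartz_ZT F -> cintegrable mu (fun z => s z * F z).
  move=> sF; have := ip_cintegrable ss (sqintJ (sqint_schwartz_ZT sF)).
  by under eq_fun do rewrite conjcK.
have sB F F' : schwartz_ZT F -> schwartz_ZT F' ->
    cintegral mu (fun z => s z * (F z - F' z)) =
    cintegral mu (fun z => s z * F z) - cintegral mu (fun z => s z * F' z).
  move=> sF sF'; rewrite -cintegralB; [|exact: iF..].
  by apply: eq_cintegral => z; rewrite mulrBr.
move=> F sF; split; first exact: iF.
have [N [C [C0 hC]]] := tempered_bound tu; have [N' [K [K0 hK]]] := @sqint_schwartz R n.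
(* The first summand is the continuity constant of u. The second is that of integration against s,
   from Cauchy-Schwarz and the L^2 bound of [sqint_schwartz]. *)
apply: (@normc_eq_eps _ _ _ (C + Num.sqrt (nrm2 mu s * K))) => e0 e00.
have [L [hL _]] := trig_dense (maxn N N') sF e00; have sT := schwartz_tsum (R := R) L.
have sD := schwartzB sF sT.
have uT : u (tsum L) = cintegral mu (fun z => s z * tsum L z).
  rewrite tempered_tsum//.
  under eq_cintegral do rewrite /tsum mulr_sumr.
  rewrite cintegral_sum; last first.
    by move=> p; apply: iF; apply: schwartz_scale; exact: schwartz_echr.
  apply: eq_bigr => p _; under eq_cintegral do rewrite mulrCA.
  rewrite cintegralZ; last by apply: iF; exact: schwartz_echr.
  congr (_ * _); rewrite -hs; apply: eq_cintegral => z.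
  by rewrite /e echrJ/= opprK; case: (p.2).
rewrite -[X in normc (X - _)](subrK (u (tsum L))) -temperedB// -addrA uT -sB//.
have -> : cintegral mu (fun z => s z * (tsum L z - F z)) =
    - cintegral mu (fun z => s z * (F z - tsum L z)) by rewrite !sB// opprB.
apply: le_trans (normc_D _ _) _; rewrite normc_N mulrDl; apply: lerD.
  by apply: hC => //; exact: sbound_mono (leq_maxl _ _) hL.
have [sq nq] := hK _ _ (schwartz_cmeasurable sD) (sbound_mono (leq_maxr N N') hL).
apply: le_trans (le_normc_cintegral (iF _ sD)) _.
have := cauchy_schwarz_abs ss sq; set I := (\int[mu]_x _)%R => hI.
rewrite -(ler_pXn2r (ltn0Sn 1)) ?nnegrE; last 2 first.
- by apply: Rintegral_ge0 => z _; exact: normc_ge0.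
- by rewrite mulr_ge0 ?sqrtr_ge0// ltW.
apply: le_trans hI _; rewrite exprMn sqr_sqrtr; last by rewrite mulr_ge0// nrm2_ge0.
by rewrite -mulrA ler_wpM2l// nrm2_ge0.
Qed.

(** Any representing function agrees almost everywhere with the one from Riesz-Fischer. *)
Lemma represents_nrm2 s : represents s u -> sqint mu s /\ nrm2 mu s <= M.
Proof.
move=> rs; have [s0 [rs0 ss0 sM]] := represents_exists.
have ms : cmeasurable s by case: rs.
have ms0 : cmeasurable s0 by case: rs0.
have Fm := ae_filter_ringOfSetsType mu.
have E : (\int[mu]_z (normc (s z) ^+ 2)%:E = \int[mu]_z (normc (s0 z) ^+ 2)%:E)%E.
  apply: ae_eq_integral => //.
  - by apply/measurable_EFinP; exact: measurable_sqr_normc.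
  - by apply/measurable_EFinP; exact: measurable_sqr_normc.
  - by apply: filterS (represents_unique rs rs0) => z ->.
split; first by split => //; rewrite E; case: ss0.
by rewrite /nrm2 /Rintegral E.
Qed.

End representation.

Section symbol_bound.
Context {R : realType} {n : nat}.
Local Notation Tn := 'rV[R]_n.
Local Notation mu := (@muZT R n).
Implicit Types (G : Zn n * Tn -> R[i]).

(** If all coefficients of G vanished, so would the approximants in [trig_dense], whose coefficients
    are multiples of them, and G would be 0. *)
Lemma fourier_neq0 G : schwartz_ZT G -> (exists z, G z != 0) ->
  exists q, ip mu G (echr q) != 0.
Proof.
move=> sG [z Gz]; have [//|h] := pselect (exists q, ip mu G (echr q) != 0).
have G0 q : ip mu G (echr q) = 0.
  by apply/eqP; apply: contrapT => /negP Gq; apply: h; exists q.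
case/eqP: Gz; apply: (@normc_eq_eps _ _ _ 1) => e e0.
have [L [hL LG]] := trig_dense 0 sG e0.
have -> : 0 = tsum L z.
  rewrite /tsum big_seq big1// => p /LG[k ->].
  by rewrite (fcoef_echr p.2 (sqint_schwartz_ZT sG)) G0 mulr0 mul0r.
by rewrite mul1r; case: z => m w; exact: (sbound_normc (s := [::]) m w hL).
Qed.

(** Let A be the set of frequencies of a trigonometric polynomial close to G in L^2. The orthogonal
    projection P of G onto their span is at least as close, and |G|^2 = |G - P|^2 plus the sum over
    A. *)
Lemma parseval_le G e : schwartz_ZT G -> 0 < e ->
  exists2 A, uniq A & nrm2 mu G <= \sum_(q <- A) normc (ip mu G (echr q)) ^+ 2 + e.
Proof.
move=> sG e0; have [N [K [K0 hK]]] := @sqint_schwartz R n.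
have d0 : 0 < Num.sqrt (e / (K + 1)) by rewrite sqrtr_gt0 divr_gt0// ltr_wpDl.
have [L [hL _]] := trig_dense N sG d0; have sT := schwartz_tsum (R := R) L.
have GT := hK _ _ (schwartz_cmeasurable (schwartzB sG sT)) hL.
pose A := undup (map snd L); have uA : uniq A by exact: undup_uniq.
have se q : sqint mu (@echr R n q) by exact: sqint_echr.
have oe := @echr_orthonormal R n.
have sqG := sqint_schwartz_ZT sG; have sqT := sqint_schwartz_ZT sT.
pose c q := ip mu G (echr q); pose P z := \sum_(q <- A) c q * echr q z.
have sP : sqint mu P by apply: sqint_sum => q; exact: sqintZ.
have sr : sqint mu (fun z => G z - P z) by exact: sqintB.
have r0 q : q \in A -> ip mu (echr q) (fun z => G z - P z) = 0.
  move=> qA; rewrite (ipJ sr (se q)) ipBl// (ip_orthogonal_sum se oe)//.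
  by rewrite mulr1 subrr rmorph0.
have orth f a (l : seq (R[i] * (Zn n * Zn n))) :
    (forall z, f z = \sum_(p <- l) p.1 * echr p.2 z) -> {subset map snd l <= A} ->
    a = ip mu f (fun z => G z - P z) -> a = 0.
  move=> fE lA ->; rewrite (_ : f = fun z => \sum_(p <- l) p.1 * echr p.2 z); last exact/funext.
  rewrite ip_suml//; last by move=> p; exact: sqintZ.
  rewrite big_seq big1// => p pl; rewrite ipZl// r0 ?mulr0//; apply: lA.
  exact: (map_f snd).
have rP : ip mu P (fun z => G z - P z) = 0.
  apply: (orth P _ [seq (c q, q) | q <- A]) => [z|q|//]; first by rewrite big_map.
  by rewrite -map_comp map_id.
have rT : ip mu (tsum L) (fun z => G z - P z) = 0.
  by apply: (orth (tsum L) _ L) => // q; rewrite mem_undup.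
exists A => //.
have nG : nrm2 mu G = nrm2 mu (fun z => G z - P z) + \sum_(q <- A) normc (c q) ^+ 2.
  have := nrm2D sP sr; rewrite rP mulr0 addr0.
  rewrite (nrm2_orthogonal_sum se oe)// mul1r addrC => <-.
  by congr nrm2; apply/funext => z; rewrite addrC subrK.
rewrite nG addrC lerD2l; apply: (@le_trans _ _ (nrm2 mu (fun z => G z - tsum L z))).
  have sPT : sqint mu (fun z => P z - tsum L z) by exact: sqintB.
  have := nrm2D sPT sr; rewrite ipBl// rP rT subrr mulr0 addr0.
  rewrite (_ : (fun z => P z - tsum L z + (G z - P z)) = (fun z => G z - tsum L z)).
    by move=> ->; rewrite lerDr nrm2_ge0.
  by apply/funext => z; ring.
apply: le_trans GT.2 _; rewrite sqr_sqrtr; last by rewrite ltW// divr_gt0// ltr_wpDl.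
by rewrite mulrCA ler_piMr ?(ltW e0)// ler_pdivrMr ?ltr_wpDl// mul1r lerDl.
Qed.

Variables (G : Zn n * Tn -> R[i]) (u : (Zn n * Tn -> R[i]) -> R[i]).
Hypothesis sG : schwartz_ZT G.
Hypothesis tu : tempered_ZT u.
Hypothesis sV : sqint muZTTZ (dstft_ZT G u).

(** Dividing [stft_bessel] by the sum over A bounds the coefficients of u in l^2. The set A stays
    free, so that its sum can later be taken close to |G|^2. *)
Lemma symbol_bound A : uniq A -> 0 < \sum_(p <- A) normc (ip mu G (echr p)) ^+ 2 ->
  (exists s, represents s u) /\ forall s, represents s u -> sqint mu s /\
  (\sum_(p <- A) normc (ip mu G (echr p)) ^+ 2) * nrm2 mu s <=
    nrm2 muZTTZ (dstft_ZT G u).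
Proof.
move=> uA A0; set a := \sum_(p <- A) _ in A0 *.
have cM D : uniq D -> \sum_(q <- D) normc (u (echr q)) ^+ 2 <= nrm2 muZTTZ (dstft_ZT G u) / a.
  by move=> uD; rewrite ler_pdivlMr// mulrC; exact: stft_bessel.
split; first by have [s [rs _ _]] := represents_exists tu cM; exists s.
move=> s rs; have [ss sM] := represents_nrm2 tu cM rs; split => //.
by rewrite mulrC -ler_pdivlMr.
Qed.

End symbol_bound.

(** * Windows and localization operators *)

Section functionals_Zn.
Context {R : realType} {n : nat}.
Local Notation Tn := 'rV[R]_n.
Local Notation cZ := (countingZ R n).
Local Notation H := (haar R n).
Implicit Types (f g h : Zn n -> R[i]).

Definition zbound (N : nat) f (c : R) : Prop := forall k, bracket k ^+ N * normc (f k) <= c.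

Lemma snorm_ZP N f (c : R) : (snorm_Z N f <= c%:E)%E <-> zbound N f c.
Proof.
split => [h k|h].
  by rewrite -lee_fin; apply: le_trans h; apply: ereal_sup_ubound; exists k.
by apply: ge_ereal_sup => _ [k _ <-]; rewrite lee_fin; exact: h.
Qed.

Lemma snorm_Z_ge0 N f : (0 <= snorm_Z N f)%E.
Proof.
apply: (@le_trans _ _ (bracket (0 : Zn n) ^+ N * normc (f 0))%:E).
  by rewrite lee_fin mulr_ge0 ?normc_ge0// exprn_ge0// ltW// bracket_gt0.
by apply: ereal_sup_ubound; exists 0.
Qed.

Lemma schwartz_ZP f : schwartz_Z f <-> forall N, exists c, zbound N f c.
Proof.
split=> h N; last by have [c /snorm_ZP hc] := h N; apply: le_lt_trans hc _; rewrite ltry.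
have := h N; have := snorm_Z_ge0 N f; case E : (snorm_Z N f) => [c| |]// _ _.
by exists c; apply/snorm_ZP; rewrite E.
Qed.

Lemma zbound_ge0 N f c : zbound N f c -> 0 <= c.
Proof.
move=> /(_ 0); apply: le_trans.
by rewrite mulr_ge0 ?normc_ge0// exprn_ge0// ltW// bracket_gt0.
Qed.

Lemma zbound_lin N a f g c c' : zbound N f c -> zbound N g c' ->
  zbound N (fun k => a * f k + g k) (normc a * c + c').
Proof.
move=> hf hg k; have b0 : 0 <= bracket k ^+ N :> R by rewrite exprn_ge0// ltW// bracket_gt0.
apply: (@le_trans _ _ (bracket k ^+ N * (normc a * normc (f k) + normc (g k)))).
  by rewrite ler_wpM2l// -normc_M; exact: normc_D.
by rewrite mulrDr mulrCA; apply: lerD => //; rewrite ler_wpM2l ?normc_ge0.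
Qed.

Lemma schwartz_Z_lin a f g : schwartz_Z f -> schwartz_Z g ->
  schwartz_Z (fun k => a * f k + g k).
Proof.
move=> /schwartz_ZP hf /schwartz_ZP hg; apply/schwartz_ZP => N.
have [c hc] := hf N; have [c' hc'] := hg N.
by exists (normc a * c + c'); exact: zbound_lin.
Qed.

Lemma schwartz_Z_kron k : schwartz_Z (@kron R n k).
Proof.
apply/schwartz_ZP => N; exists (bracket k ^+ N) => j; rewrite /kron.
case: eqP => [->|_]; first by rewrite /= expr0n addr0 expr1n sqrtr1 mulr1.
by rewrite normc_0 mulr0 exprn_ge0// ltW// bracket_gt0.
Qed.

Lemma schwartz_Z0 : schwartz_Z (fun _ : Zn n => 0 : R[i]).
Proof. by apply/schwartz_ZP => N; exists 0 => k; rewrite normc_0 mulr0. Qed.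

Definition finsum (ms : seq (Zn n)) (a : Zn n -> R[i]) (j : Zn n) : R[i] :=
  \sum_(k <- ms) a k * kron k j.

Lemma finsum_cons k ms a : finsum (k :: ms) a = (fun j => a k * kron k j + finsum ms a j).
Proof. by apply/funext => j; rewrite /finsum big_cons. Qed.

Lemma finsum_nil a : finsum [::] a = fun=> 0.
Proof. by apply/funext => j; rewrite /finsum big_nil. Qed.

Lemma finsumE ms a j : uniq ms -> finsum ms a j = if j \in ms then a j else 0.
Proof.
move=> us; rewrite /finsum /kron; case: ifP => jm.
  rewrite (bigD1_seq j)//= eqxx mulr1 big1 ?addr0// => k kj.
  by rewrite eq_sym (negbTE kj) mulr0.
rewrite big_seq big1// => k km; case: eqP => [jk|]; last by rewrite mulr0.
by rewrite jk km in jm.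
Qed.

Lemma schwartz_Z_finsum ms a : schwartz_Z (finsum ms a).
Proof.
elim: ms => [|k ms IH]; first by rewrite finsum_nil; exact: schwartz_Z0.
by rewrite finsum_cons; apply: schwartz_Z_lin => //; exact: schwartz_Z_kron.
Qed.

Lemma schwartz_Z_truncate N h (e : R) : schwartz_Z h -> 0 < e ->
  exists2 ms, uniq ms & forall k, k \notin ms -> bracket k ^+ N * normc (h k) <= e.
Proof.
move=> /schwartz_ZP/(_ N.+1)[c hc] e0; have c0 := zbound_ge0 hc.
have [ms us hms] := bracket_finite (n := n) (c / e); exists ms => // k km.
have b0 := bracket_gt0 (R := R) k.
have : c / e < bracket k by rewrite ltNge; apply: contra km; exact: hms.
rewrite ltr_pdivrMr// => h1; have := hc k; rewrite exprS -mulrA => h2.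
by rewrite -(ler_pM2l b0); apply: le_trans h2 (ltW h1).
Qed.

Variable u : (Zn n -> R[i]) -> R[i].
Hypothesis tu : tempered_Z u.

Lemma temperedZ_lin a f g : schwartz_Z f -> schwartz_Z g ->
  u (fun k => a * f k + g k) = a * u f + u g.
Proof. by case: tu => + _; apply. Qed.

Lemma temperedZ0 : u (fun=> 0) = 0.
Proof.
have := temperedZ_lin 1 schwartz_Z0 schwartz_Z0.
under eq_fun do rewrite mul1r addr0.
by rewrite mul1r => /esym/eqP; rewrite -subr_eq0 addrK => /eqP.
Qed.

Lemma temperedZ_finsum ms a : u (finsum ms a) = \sum_(k <- ms) a k * values u k.
Proof.
elim: ms => [|k ms IH]; first by rewrite finsum_nil big_nil temperedZ0.
rewrite finsum_cons temperedZ_lin; [|exact: schwartz_Z_kron|exact: schwartz_Z_finsum].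
by rewrite big_cons IH.
Qed.

Lemma temperedZ_bound : exists N (C : R), 0 <= C /\
  forall f b, schwartz_Z f -> zbound N f b -> normc (u f) <= C * b.
Proof.
have [_ [N [C hC]]] := tu; exists N, `|C|; split => // f b sf hb.
rewrite -lee_fin; apply: le_trans (hC f sf) _; rewrite EFinM.
apply: (@le_trans _ _ (`|C|%:E * snorm_Z N f)%E).
  by apply: lee_wpmul2r; rewrite ?snorm_Z_ge0// lee_fin ler_norm.
by apply: lee_wpmul2l; [rewrite lee_fin|exact/snorm_ZP].
Qed.

Variable g : Zn n -> R[i].
Hypothesis sg : schwartz_Z g.

Let sh m k : R[i] := conjc (g (k - m)).

Let dstftE m w : dstft g u (m, w) = u (fun k => conjc (chr k w) * sh m k).
Proof. by congr u; apply/funext => k; rewrite /modulate/= conjcM. Qed.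

Let schwartz_sh m : schwartz_Z (sh m).
Proof.
move/schwartz_ZP: sg => hg; apply/schwartz_ZP => N; have [c hc] := hg N.
exists (bracket m ^+ N * c) => k; rewrite /sh normcJ.
have b0 (j : Zn n) : 0 < bracket j ^+ N :> R by rewrite exprn_gt0// bracket_gt0.
apply: (@le_trans _ _ ((bracket m ^+ N * bracket (k - m) ^+ N) * normc (g (k - m)))).
  rewrite ler_wpM2r ?normc_ge0// -exprMn lerXn2r ?nnegrE ?mulr_ge0 ?(ltW (bracket_gt0 _))//.
  by rewrite mulrC -{1}(subrK m k) bracketD.
by rewrite -mulrA ler_wpM2l// ltW.
Qed.

Let schwartz_mod f w : schwartz_Z f -> schwartz_Z (fun k => conjc (chr k w) * f k).
Proof.
move/schwartz_ZP => hf; apply/schwartz_ZP => N; have [c hc] := hf N; exists c => k.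
by rewrite normc_M normcJ normc_chr mul1r.
Qed.

(** Truncating the translated window to a finite set is a small error in the seminorm that controls
    u. Modulation preserves this seminorm, so the approximation is uniform in w. *)
Let dstft_approx m : exists C : R, 0 <= C /\ forall e, 0 < e -> exists2 ms, uniq ms &
  (forall k, k \notin ms -> normc (sh m k) <= e) /\
  forall w, normc (dstft g u (m, w) -
    \sum_(k <- ms) (sh m k * values u k) * conjc (chr k w)) <= C * e.
Proof.
have [N [C [C0 hC]]] := temperedZ_bound; exists C; split => // e e0.
have [ms us hms] := schwartz_Z_truncate N (schwartz_sh m) e0; exists ms => //.
split=> [k km|w].
  apply: le_trans (hms k km); rewrite ler_peMl ?normc_ge0// exprn_ege1//.
  exact: bracket_ge1.
pose a k := conjc (chr k w) * sh m k.
have -> : \sum_(k <- ms) sh m k * values u k * conjc (chr k w) = u (finsum ms a).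
  by rewrite temperedZ_finsum; apply: eq_bigr => k _; rewrite /a; ring.
rewrite dstftE -/a addrC -mulN1r -temperedZ_lin//; last 2 first.
- exact: schwartz_Z_finsum.
- exact: schwartz_mod.
apply: hC; first by apply: schwartz_Z_lin; [exact: schwartz_Z_finsum|exact: schwartz_mod].
move=> k; rewrite finsumE//; case: ifPn => km; last first.
  by rewrite mulr0 add0r /a normc_M normcJ normc_chr mul1r; exact: hms.
by rewrite mulN1r addNr normc_0 mulr0 ltW.
Qed.

Let V := dstft g u.
Hypothesis mV : cmeasurable V.

Lemma cintegrable_dstft_fibre m : cintegrable H (fun w => V (m, w)).
Proof.
have [N [C [C0 hC]]] := temperedZ_bound.
have /schwartz_ZP/(_ N)[c hc] := schwartz_sh m.
apply: (@cintegrable_bounded _ _ _ _ _ (C * c)); first exact: cmeasurable_section1.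
move=> w; rewrite /V dstftE; apply: hC; first exact: schwartz_mod.
by move=> k; rewrite normc_M normcJ normc_chr mul1r.
Qed.

(** The k-th coefficient of the trigonometric polynomial from [dstft_approx] is exact when k is in
    [ms]. Otherwise it is 0, while conj(g(k - m)) is itself at most e in modulus. *)
Lemma cintegral_dstft m k :
  cintegral H (fun w => V (m, w) * chr k w) = conjc (g (k - m)) * values u k.
Proof.
have [C [C0 hC]] := dstft_approx m.
apply: (@normc_eq_eps _ _ _ (C + normc (values u k))) => e e0.
have [ms us [h1 h2]] := hC _ e0.
pose T w : R[i] := \sum_(j <- ms) (sh m j * values u j) * conjc (chr j w).
have iT : cintegrable H T.
  apply: cintegrable_sum => j; apply: cintegrableZ; apply: cintegrableJ; exact: cintegrable_chr.
have ich (f : Tn -> R[i]) : cintegrable H f -> cintegrable H (fun w => f w * chr k w).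
  move=> hf; apply: (@cintegrable_mulr _ _ _ _ _ _ 1) => // [|w]; first exact: measurable_chr.
  by rewrite normc_chr.
have ET : cintegral H (fun w => T w * chr k w) = if k \in ms then sh m k * values u k else 0.
  rewrite -(finsumE (fun k => sh m k * values u k) k us) /finsum.
  rewrite (eq_cintegral _ (g := fun w => \sum_(j <- ms) (sh m j * values u j) *
     (chr k w * conjc (chr j w)))); last first.
    by move=> w; rewrite mulr_suml; apply: eq_bigr => j _; rewrite -mulrA [_ * chr k w]mulrC.
  have ick j : cintegrable H (fun w => chr k w * conjc (chr j w)).
    by apply: ip_cintegrable; exact: sqint_chr.
  rewrite cintegral_sum; last by move=> j; apply: cintegrableZ.
  apply: eq_bigr => j _; rewrite cintegralZ//; congr (_ * _).
  rewrite [LHS](chr_orthonormal k j) /kron.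
  by case: eqP => _; rewrite ?rmorph1.
have iV := cintegrable_dstft_fibre m.
rewrite -[X in normc (X - _)](subrK (cintegral H (fun w => T w * chr k w))) -addrA.
apply: le_trans (normc_D _ _) _; rewrite mulrDl; apply: lerD.
  rewrite -cintegralB; [|exact: ich..].
  apply: normc_cintegral_le; first by apply: cintegrableB; exact: ich.
  by move=> w; rewrite -mulrBl normc_M normc_chr mulr1; exact: h2.
rewrite ET -/(sh m k); case: ifPn => km.
  by rewrite subrr normc_0 mulr_ge0 ?normc_ge0// ltW.
by rewrite sub0r normc_N normc_M mulrC ler_wpM2l ?normc_ge0//; exact: h1.
Qed.

Let A m : R := (\int[H]_w normc (V (m, w)))%R.

Let values_le m k : normc (values u k) * normc (g (k - m)) <= A m.
Proof.
have iV := cintegrable_dstft_fibre m.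
have iVc : cintegrable H (fun w => V (m, w) * chr k w).
  apply: (@cintegrable_mulr _ _ _ _ _ _ 1) => // [|w]; first exact: measurable_chr.
  by rewrite normc_chr.
rewrite mulrC -(normcJ (g _)) -normc_M -cintegral_dstft.
apply: le_trans (le_normc_cintegral iVc) _; rewrite le_eqVlt; apply/orP; left; apply/eqP.
by apply: eq_Rintegral => w _; rewrite normc_M normc_chr mulr1.
Qed.

Hypothesis iV : cintegrable muZT V.
Let W : R := (\int[muZT]_z normc (V z))%R.

Let A_ge0 m : 0 <= A m. Proof. by apply: Rintegral_ge0 => w _; exact: normc_ge0. Qed.

Let integral_A : (\int[cZ]_m (A m)%:E = W%:E)%E.
Proof.
rewrite /W -fin_normc_cintegrable// [RHS]fubini_tonelli1//; last 2 first.
- by apply/measurable_EFinP; exact: measurable_normc.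
- by move=> z; rewrite lee_fin normc_ge0.
apply: eq_integral => m _.
by rewrite /A -fin_normc_cintegrable//; exact: cintegrable_dstft_fibre.
Qed.

Let A_le m : A m <= W.
Proof.
rewrite -lee_fin -integral_A.
by apply: (ge_integral_countingZ (f := fun m => (A m)%:E)) => k; rewrite lee_fin.
Qed.

Let W_ge0 : 0 <= W. Proof. exact: le_trans (A_ge0 0) (A_le 0). Qed.

Let integrable_A j : cZ.-integrable setT (EFin \o (fun k => A (k - j))).
Proof.
apply/integrableP; split => //; under eq_integral do rewrite /= ger0_norm//.
rewrite (integral_countingZ_shift (f := fun m => (A m)%:E)) ?integral_A ?ltry//.
Qed.

(** Taking m = k - j in [values_le] gives |x_k| |g(j)| <= A(k - j), where x = [values u]. Its square
    is at most W A(k - j), which is summable in k. *)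
Lemma sqint_values : (exists j, g j != 0) -> sqint cZ (values u).
Proof.
move=> [j gj]; have gj0 : 0 < normc (g j) by rewrite lt_def normc_eq0 gj normc_ge0.
have ih := integrableZ_EFin (W / normc (g j) ^+ 2) (integrable_A j).
apply: (sqint_le (cmeasurable_Zn (values u)) ih) => k; rewrite mulrAC ler_pdivlMr ?exprn_gt0// -exprMn expr2.
have := values_le (k - j) k; rewrite subKr => h.
have x0 : 0 <= normc (values u k) * normc (g j) by rewrite mulr_ge0 ?normc_ge0.
by apply: ler_pM => //; exact: le_trans h (A_le _).
Qed.

Lemma nrm2_translate f m : nrm2 cZ (fun k => f (k - m)) = nrm2 cZ f.
Proof.
rewrite /nrm2 /Rintegral; congr fine.
by apply: (integral_countingZ_shift (f := fun k => (normc (f k) ^+ 2)%:E)) => k; rewrite lee_fin sqr_ge0.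
Qed.

Lemma sqint_translate f m : sqint cZ f -> sqint cZ (fun k => f (k - m)).
Proof.
move=> [_ lf]; split; first exact: cmeasurable_Zn.
rewrite (integral_countingZ_shift (f := fun k => (normc (f k) ^+ 2)%:E))// => k.
by rewrite lee_fin sqr_ge0.
Qed.

(* sum_{m,k} |x_k g(k-m)|^2 = |x|^2 |g|^2 is at most the sum over m of       *)
(* A_m sum_k |x_k g(k-m)| <= A_m |x| |g|, since A_m bounds each term.        *)
Lemma nrm2_values_le : sqint cZ g -> sqint cZ (values u) ->
  nrm2 cZ (values u) * nrm2 cZ g <= W ^+ 2.
Proof.
move=> hg hx; set x := values u in hx *; set p := _ * _.
have p0 : 0 <= p by rewrite mulr_ge0 ?nrm2_ge0.
pose h (z : Zn n * Zn n) : R[i] := x z.2 * g (z.2 - z.1).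
have mh : cmeasurable h by apply: cmeasurable_Zn_prod => m; exact: cmeasurable_Zn.
have h0 z : (0 <= (normc (h z) ^+ 2)%:E)%E by rewrite lee_fin sqr_ge0.
have mh2 : measurable_fun setT (fun z => (normc (h z) ^+ 2)%:E).
  by apply/measurable_EFinP; exact: measurable_sqr_normc.
have pE : (\int[cZ]_m \int[cZ]_k (normc (h (m, k)) ^+ 2)%:E = p%:E)%E.
  have := @fubini_tonelli _ _ _ _ _ cZ cZ (fun z => (normc (h z) ^+ 2)%:E) mh2 h0.
  rewrite /fubini_F /fubini_G => ->.
  transitivity (\int[cZ]_k ((nrm2 cZ g)%:E * (normc (x k) ^+ 2)%:E))%E.
    apply: eq_integral => k _.
    under eq_integral do rewrite /h/= normc_M exprMn EFinM.
    rewrite ge0_integralZl//; last 2 first.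
    - by move=> m _; rewrite lee_fin sqr_ge0.
    - by rewrite lee_fin sqr_ge0.
    rewrite (integral_countingZ_refl (f := fun m => (normc (g m) ^+ 2)%:E)); last first.
      by move=> m; rewrite lee_fin sqr_ge0.
    by rewrite nrm2E// muleC.
  rewrite ge0_integralZl//; last 2 first.
  - by move=> k _; rewrite lee_fin sqr_ge0.
  - by rewrite lee_fin nrm2_ge0.
  by rewrite nrm2E// -EFinM mulrC.
have inner m : (\int[cZ]_k (normc (h (m, k)) ^+ 2)%:E <= (Num.sqrt p * A m)%:E)%E.
  have hgm := sqint_translate m hg.
  have := ip_cintegrable hx (sqintJ hgm); under eq_fun do rewrite conjcK.
  move=> ih; have := cauchy_schwarz_abs hx hgm; rewrite nrm2_translate -/p => cs.
  apply: (@le_trans _ _ (\int[cZ]_k ((A m)%:E * (normc (x k * g (k - m)))%:E))%E).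
    apply: ge0_le_integral => // => k _; rewrite lee_fin expr2 /h /=.
    rewrite ler_wpM2r ?normc_ge0// normc_M; exact: values_le.
  rewrite ge0_integralZl//; last 2 first.
  - by move=> k _; rewrite lee_fin normc_ge0.
  - by rewrite lee_fin.
  rewrite (fin_normc_cintegrable ih) -EFinM lee_fin mulrC ler_wpM2r//.
  rewrite -(ler_pXn2r (ltn0Sn 1)) ?nnegrE ?sqrtr_ge0//; last first.
    by apply: Rintegral_ge0 => k _; exact: normc_ge0.
  by rewrite sqr_sqrtr.
have : p <= Num.sqrt p * W.
  rewrite -lee_fin -pE EFinM -integral_A -ge0_integralZl//; last by move=> m _; rewrite lee_fin.
  by apply: ge0_le_integral => // m _; apply: integral_ge0 => k _.
(* With q^2 = p the bound reads q^2 <= q W, so q <= W unless q = 0. *)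
rewrite -{1 3}(sqr_sqrtr p0) => hp; have := sqrtr_ge0 p; set q := Num.sqrt p in hp *.
rewrite le_eqVlt => /orP[/eqP <-|q0]; first by rewrite expr0n sqr_ge0.
by rewrite ler_pXn2r ?nnegrE ?(ltW q0)// -(ler_pM2l q0) -expr2.
Qed.

End functionals_Zn.

(** * Localization operators with L^2 symbol and l^2 windows *)

Section localization.
Context {R : realType} {n : nat}.
Local Notation Tn := 'rV[R]_n.
Local Notation cZ := (countingZ R n).
Local Notation H := (haar R n).
Local Notation mu := (@muZT R n).
Implicit Types (f g x : Zn n -> R[i]).

Lemma l2P f : l2 f <-> sqint cZ f.
Proof.
split=> [/cLnorm2_lty lf|[_ lf]]; last exact/cLnorm2_lty.
by split => //; exact: cmeasurable_Zn.
Qed.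

Let atom x (z : Zn n * Tn) k := modulate z.2 (translate z.1 x) k.

Let sqint_atom x z : sqint cZ x -> sqint cZ (atom x z).
Proof.
move=> hx; have ih := sqint_integrable (sqint_translate z.1 hx).
apply: (sqint_le (cmeasurable_Zn _) ih) => k.
by rewrite /atom /modulate normc_M normc_cis mul1r.
Qed.

Let nrm2_atom x z : nrm2 cZ (atom x z) = nrm2 cZ x.
Proof.
rewrite -(nrm2_translate x z.1); apply: eq_Rintegral => k _.
by rewrite /atom /modulate normc_M normc_cis mul1r.
Qed.

(** Cauchy-Schwarz, as time-frequency shifts preserve the l^2 norm. This uniform bound makes [s]
    times the transform square-integrable. *)
Lemma normc_stft f x z : sqint cZ f -> sqint cZ x ->
  normc (stft f x z) <= Num.sqrt (nrm2 cZ f * nrm2 cZ x).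
Proof.
move=> hf hx; have := cauchy_schwarz hf (sqint_atom z hx); rewrite nrm2_atom => h.
rewrite -(ler_pXn2r (ltn0Sn 1)) ?nnegrE ?sqrtr_ge0 ?normc_ge0//.
by rewrite [leRHS]sqr_sqrtr// mulr_ge0 ?nrm2_ge0.
Qed.

Lemma stft_lin a f g x z : sqint cZ f -> sqint cZ g -> sqint cZ x ->
  stft (fun k => a * f k + g k) x z = a * stft f x z + stft g x z.
Proof.
move=> hf hg hx; have ha := sqint_atom z hx.
by rewrite -[LHS]/(ip cZ _ (atom x z)) ipDl ?ipZl//; exact: sqintZ.
Qed.

(** On the fibre m the transform is a sum over k of an integrable function of (k, w), hence
    measurable in w by Fubini. *)
Lemma cmeasurable_stft f x : sqint cZ f -> sqint cZ x -> cmeasurable (stft f x).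
Proof.
move=> hf hx; apply: cmeasurable_Zn_prod => m.
have h1 : cintegrable cZ (fun k => f k * conjc (x (k - m))).
  by apply: ip_cintegrable => //; exact: sqint_translate.
have h2 : cintegrable H (fun=> 1 : R[i]).
  by apply: (@cintegrable_bounded _ _ _ _ _ (normc (1 : R[i]))) => //; exact: cmeasurable_cst.
(* The factor 1 is the constant function on the torus, which puts the first part in the tensor form
   of [cintegrableX]. *)
pose F (z : Zn n * Tn) := f z.1 * conjc (x (z.1 - m)) * 1 * conjc (chr z.1 z.2).
have iF : cintegrable (cZ \x H)%E F.
  apply: (@cintegrable_mulr _ _ _ _ _ _ 1 (cintegrableX h1 h2)) => [|z].
    by apply: cmeasurable_Zn_prod => k; apply: cmeasurableJ; exact: measurable_chr.
  by rewrite normcJ normc_chr.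
have [/cintegrable_meas mF _] := cfubini21 iF.
suff -> : (fun w => stft f x (m, w)) = (fun w => cintegral cZ (fun k => F (k, w))) by [].
apply/funext => w; apply: eq_cintegral => k.
rewrite -[LHS]/(f k * conjc (chr k w * x (k - m))) conjcM.
by rewrite -[RHS]/(f k * conjc (x (k - m)) * 1 * conjc (chr k w)); ring.
Qed.

Variables (s : Zn n * Tn -> R[i]) (x1 x2 : Zn n -> R[i]).
Hypotheses (hs : sqint mu s) (h1 : sqint cZ x1) (h2 : sqint cZ x2).

Let Phi k : Zn n * Tn -> R[i] := tens (fun m : Zn n => conjc (x2 (k - m))) (chr (- k)).

Let sqint_refl k : sqint cZ (fun m : Zn n => conjc (x2 (k - m))).
Proof.
apply: sqintJ; case: h2 => _ l2; split; first exact: cmeasurable_Zn.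
rewrite (integral_countingZ_refl (f := fun m => (normc (x2 m) ^+ 2)%:E))// => m.
by rewrite lee_fin sqr_ge0.
Qed.

Let sqint_Phi k : sqint mu (Phi k).
Proof. exact: (sqint_tens (sqint_refl k) (sqint_chr _)). Qed.

Let Phi_orthogonal k l : ip mu (Phi k) (Phi l) = if k == l then (nrm2 cZ x2)%:C else 0.
Proof.
rewrite [LHS](ip_tens (sqint_refl k) (sqint_chr _) (sqint_refl l) (sqint_chr _)).
rewrite chr_orthonormal eqr_opp; case: eqVneq => [<-|_]; last by rewrite mulr0.
rewrite mulr1 ipff; congr (_%:C); rewrite /nrm2 /Rintegral; congr fine.
under eq_integral do rewrite normcJ.
apply: (integral_countingZ_refl (f := fun m => (normc (x2 m) ^+ 2)%:E)) => m.
by rewrite lee_fin sqr_ge0.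
Qed.

Let sV f z := s z * stft f x1 z.

Let sqint_sV f : sqint cZ f -> sqint mu (sV f).
Proof.
move=> hf; apply: (sqintM_bounded hs (cmeasurable_stft hf h1)) => z.
exact: normc_stft.
Qed.

Let locop_integrandE f k z : locop_integrand s x1 x2 f k z = sV f z * conjc (Phi k z).
Proof.
rewrite /locop_integrand /sV /Phi /tens conjcM conjcK -chrN opprK.
by rewrite /modulate /translate mulrC [X in X * _]mulrC mulrC.
Qed.

Lemma locop_is_defined : locop_defined s x1 x2.
Proof.
move=> f /l2P hf k; rewrite (_ : locop_integrand s x1 x2 f k = fun z => sV f z * conjc (Phi k z)).
  by apply: ip_cintegrable; [exact: sqint_sV|exact: sqint_Phi].
by apply/funext => z; rewrite locop_integrandE.
Qed.

Let locopE f k : locop s x1 x2 f k = ip mu (sV f) (Phi k).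
Proof. by apply: eq_cintegral => z; rewrite locop_integrandE. Qed.

(** The values of [locop s x1 x2 f] are the coefficients of [sV f] against the orthogonal family
    [Phi], whose common squared norm is that of [x2]. Bessel's inequality bounds every finite sum of
    their squares. *)
Lemma locop_bound f : sqint cZ f -> sqint cZ (locop s x1 x2 f) /\
  nrm2 cZ (locop s x1 x2 f) <= nrm2 cZ x2 * (nrm2 mu s * (nrm2 cZ f * nrm2 cZ x1)).
Proof.
move=> hf; set B := _ * _.
have nV : nrm2 mu (sV f) <= nrm2 mu s * (nrm2 cZ f * nrm2 cZ x1).
  rewrite mulrC -RintegralZl//; last exact: sqint_integrable.
  apply: le_Rintegral => //.
  - exact: sqint_integrable (sqint_sV hf).
  - by apply: integrableZ_EFin; exact: sqint_integrable.
  - move=> z _; rewrite normc_M exprMn mulrC ler_wpM2r ?sqr_ge0//.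
    rewrite -[leRHS]sqr_sqrtr ?mulr_ge0 ?nrm2_ge0//.
    by rewrite lerXn2r ?nnegrE ?sqrtr_ge0 ?normc_ge0//; exact: normc_stft.
have hB : (\int[cZ]_k (normc (locop s x1 x2 f k) ^+ 2)%:E <= B%:E)%E.
  apply: integral_countingZ_le => [k|D uD]; first by rewrite lee_fin sqr_ge0.
  rewrite sumEFin lee_fin.
  have := bessel (nrm2_ge0 cZ x2) sqint_Phi Phi_orthogonal (sqint_sV hf) uD.
  under eq_bigr do rewrite -locopE.
  by move/le_trans; apply; rewrite ler_wpM2l ?nrm2_ge0.
have hL : sqint cZ (locop s x1 x2 f).
  by split; [exact: cmeasurable_Zn|apply: le_lt_trans hB _; rewrite ltry].
by split => //; rewrite -lee_fin -nrm2E.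
Qed.

Lemma locop_lin a f g : sqint cZ f -> sqint cZ g ->
  locop s x1 x2 (fun k => a * f k + g k) = (fun k => a * locop s x1 x2 f k + locop s x1 x2 g k).
Proof.
move=> hf hg; apply/funext => k; rewrite !locopE -ipZl//; last exact: sqint_sV.
rewrite -ipDl//; last 2 first.
- by apply: sqintZ; exact: sqint_sV.
- exact: sqint_sV.
by congr ip; apply/funext => z; rewrite /sV stft_lin//; ring.
Qed.

Lemma locop_opnorm : (opnorm_l2 (locop s x1 x2) <=
  (Num.sqrt (nrm2 mu s * nrm2 cZ x1 * nrm2 cZ x2))%:E)%E.
Proof.
apply: ge_ereal_sup => _ [f /= hf1 <-].
have hf : sqint cZ f by apply/l2P; apply: le_lt_trans hf1 _; rewrite ltry.
have [hL nL] := locop_bound hf; rewrite /norm_l2 (cLnorm2E hL) lee_fin ler_wsqrtr//.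
have f1 : nrm2 cZ f <= 1.
  move: hf1; rewrite /norm_l2 (cLnorm2E hf) lee_fin => h.
  by rewrite -[leLHS]sqr_sqrtr ?nrm2_ge0// expr_le1// sqrtr_ge0.
apply: le_trans nL _; rewrite mulrC ler_wpM2r ?nrm2_ge0// ler_wpM2l ?nrm2_ge0//.
by rewrite ler_piMl ?nrm2_ge0.
Qed.

Lemma locop_bounded : bounded_l2 (locop s x1 x2).
Proof.
split=> [f /l2P hf|a f g /l2P hf /l2P hg|].
- by apply/l2P; case: (locop_bound hf).
- exact: locop_lin.
- by apply: le_lt_trans locop_opnorm _; rewrite ltry.
Qed.

End localization.

Section norms.
Context {R : realType} {n : nat}.
Local Notation mu := (@muZT R n).
Local Notation cZ := (countingZ R n).

Lemma inLp2_sqint d (T : measurableType d) (nu : {measure set T -> \bar R}) (f : T -> R[i]) :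
  inLp nu 2%:E f -> sqint nu f.
Proof. by move=> [mf /cLnorm2_lty]. Qed.

Lemma sqint_schwartz_Z (g : Zn n -> R[i]) : schwartz_Z g -> sqint cZ g.
Proof.
move=> /schwartz_ZP hg; have [N hN] := bracket_summable (R := R) (n := n).
have [c hc] := hg N; have [c0 hc0] := hg 0%N.
have b0 (k : Zn n) := exprn_gt0 N (bracket_gt0 (R := R) k).
have ib : cZ.-integrable setT (EFin \o (fun k => bracket k ^- N : R)).
  apply/integrableP; split => //.
  by under eq_integral do rewrite /= gtr0_norm ?invr_gt0//.
apply: (sqint_le (cmeasurable_Zn g) (integrableZ_EFin (c0 * c) ib)) => k.
rewrite ler_pdivlMr// expr2 -mulrA; have := hc0 k; rewrite mul1r => h0.
by apply: ler_pM => //; rewrite ?normc_ge0 ?mulr_ge0 ?normc_ge0 ?(ltW (b0 k))// mulrC.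
Qed.

Lemma nrm2_gt0 (g : Zn n -> R[i]) k : sqint cZ g -> g k != 0 -> 0 < nrm2 cZ g.
Proof.
move=> hg gk; have : 0 < normc (g k) ^+ 2 by rewrite exprn_gt0// lt_def normc_eq0 gk normc_ge0.
move/lt_le_trans; apply; rewrite -lee_fin -nrm2E//.
apply: (ge_integral_countingZ (f := fun k => (normc (g k) ^+ 2)%:E)) => j.
by rewrite lee_fin sqr_ge0.
Qed.

Lemma values_bound (g : Zn n -> R[i]) (u : (Zn n -> R[i]) -> R[i]) :
  schwartz_Z g -> (exists k, g k != 0) -> M_Z 1%:E g u ->
  sqint cZ (values u) /\ exists W : R, [/\ 0 <= W, norm_M_Z 1%:E g u = W%:E &
    Num.sqrt (nrm2 cZ (values u)) * Num.sqrt (nrm2 cZ g) <= W].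
Proof.
move=> sg g0 [tu [mV lV]].
have iV : cintegrable mu (dstft g u) by apply/cintegrableP; rewrite -cLnorm1E.
have hx := sqint_values tu sg mV iV g0; split => //.
exists (\int[mu]_z normc (dstft g u z))%R.
have W0 : 0 <= (\int[mu]_z normc (dstft g u z))%R.
  by apply: Rintegral_ge0 => z _; exact: normc_ge0.
split => //; first by rewrite /norm_M_Z cLnorm1E fin_normc_cintegrable.
rewrite -sqrtrM ?nrm2_ge0// -[leRHS](ger0_norm W0) -sqrtr_sqr ler_wsqrtr//.
exact: nrm2_values_le (sqint_schwartz_Z sg) hx.
Qed.

End norms.

Theorem proposition4p4 (R : realType) (n : nat)
    (g : Zn n -> R[i]) (G : Zn n * 'rV[R]_n -> R[i])
    (g_schwartz : schwartz_Z g) (g_neq0 : exists k, g k != 0)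
    (G_schwartz : schwartz_ZT G) (G_neq0 : exists z, G z != 0) :
  exists2 C : R,
    0 < C /\
    (norm_l2 g = 1%E -> cLnorm muZT 2%:E G = 1%E -> C = 1) &
    forall (sigma : (Zn n * 'rV[R]_n -> R[i]) -> R[i])
           (g1 g2 : (Zn n -> R[i]) -> R[i]),
      M_ZT 2%:E G sigma -> M_Z 1%:E g g1 -> M_Z 1%:E g g2 ->
      (exists s, represents s sigma) /\
      forall s, represents s sigma ->
        [/\ locop_defined s (values g1) (values g2),
            bounded_l2 (locop s (values g1) (values g2)) &
            (opnorm_l2 (locop s (values g1) (values g2)) <=
               C%:E * (norm_M_ZT 2%:E G sigma *
                       norm_M_Z 1%:E g g1 * norm_M_Z 1%:E g g2))%E].
Proof.
have sG := sqint_schwartz_ZT G_schwartz; have sg := sqint_schwartz_Z g_schwartz.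
have [q Gq] := fourier_neq0 G_schwartz G_neq0.
have q0 : 0 < normc (ip muZT G (echr q)) ^+ 2.
  by rewrite exprn_gt0// lt_def normc_eq0 Gq normc_ge0.
have nG0 : 0 < nrm2 muZT G.
  rewrite lt_def nrm2_ge0 andbT; apply: contraTneq q0 => nG.
  by rewrite -leNgt; have := cauchy_schwarz sG (sqint_echr q); rewrite nG mul0r.
have ng0 : 0 < nrm2 muZ g by have [k gk] := g_neq0; exact: nrm2_gt0 gk.
(* [nrm2] is a squared norm: the window g enters twice, once for each of [g1] and [g2], while G
   enters once. *)
exists (Num.sqrt (nrm2 muZT G) * nrm2 muZ g)^-1.
  split; first by rewrite invr_gt0 mulr_gt0// sqrtr_gt0.
  rewrite /norm_l2 (cLnorm2E sG) (cLnorm2E sg) => -[g1] [->].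
  by rewrite -(sqr_sqrtr (ltW ng0)) g1 expr1n mulr1 invr1.
move=> sigma g1 g2 [tsigma /inLp2_sqint sV] /(values_bound g_schwartz g_neq0)[hx1 [W1 [W10 E1 B1]]].
move=> /(values_bound g_schwartz g_neq0)[hx2 [W2 [W20 E2 B2]]].
rewrite /norm_M_ZT (cLnorm2E sV) E1 E2; set W := nrm2 _ (dstft_ZT G sigma).
have bound A := symbol_bound G_schwartz tsigma sV (A := A).
(* One nonzero coefficient of G suffices for the existence of a representing function and its
   square-integrability; the sharp norm needs larger sets. *)
have [|exs bq] := bound [:: q] isT; first by rewrite big_seq1.
split => // s rs; have [ss _] := bq s rs.
(* By [parseval_le], |G|^2 exceeds a sum over some finite A by at most e / (|s|^2 + 1), so the loss
   after multiplying by |s|^2 is at most e. If that sum is not positive, its product with |s|^2 is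
   trivially at most W. *)
have sW : nrm2 muZT s * nrm2 muZT G <= W.
  apply/ler_addgt0Pl => e e0.
  have e1 : 0 < e / (nrm2 muZT s + 1) by rewrite divr_gt0// ltr_wpDl// nrm2_ge0.
  have [A uA hA] := parseval_le G_schwartz e1.
  apply: le_trans (ler_wpM2l (nrm2_ge0 _ _) hA) _; rewrite mulrDr [leRHS]addrC.
  apply: lerD; last first.
    rewrite mulrCA ler_piMr ?(ltW e0)// ler_pdivrMr ?ltr_wpDl ?nrm2_ge0//.
    by rewrite mul1r lerDl.
  have [A0|A0] := ltP 0 (\sum_(p <- A) normc (ip muZT G (echr p)) ^+ 2).
    by have [_ /(_ s rs)[_]] := bound A uA A0; rewrite mulrC.
  by apply: le_trans (nrm2_ge0 _ _); rewrite mulr_ge0_le0 ?nrm2_ge0.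
split; [exact: locop_is_defined|exact: locop_bounded|].
apply: le_trans (locop_opnorm ss hx1 hx2) _; rewrite -!EFinM lee_fin.
rewrite ler_pdivlMl ?mulr_gt0 ?sqrtr_gt0//.
rewrite -(sqr_sqrtr (ltW ng0)) !sqrtrM ?mulr_ge0 ?nrm2_ge0//.
have sW' : Num.sqrt (nrm2 muZT s) * Num.sqrt (nrm2 muZT G) <= Num.sqrt W.
  by rewrite -sqrtrM ?nrm2_ge0// ler_wsqrtr.
set a := Num.sqrt (nrm2 muZT s) in sW' *; set b := Num.sqrt (nrm2 muZT G) in sW' *.
set c := Num.sqrt (nrm2 muZ g); set x1 := Num.sqrt _; set x2 := Num.sqrt _.
have -> : b * c ^+ 2 * (a * x1 * x2) = (a * b) * (x1 * c) * (x2 * c) by ring.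
by rewrite !ler_pM ?mulr_ge0 ?sqrtr_ge0.
Qed.
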